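(* Let $2<q<\infty$ and let $\Omega\subseteq\mathbb{R}^2$ be open, simply connected and bounded with Lipschitz boundary. Then there exists a constant $C>0$ such that for every $\varphi\in H^1_0(\Omega;\mathbb{R}^2)\cap W^{1,q}_0(\Omega;\mathbb{R}^2)$ there exist $h\in H^2_0(\Omega)\cap W^{2,q}_0(\Omega)$ and $g\in L^\infty(\Omega;\mathbb{R}^2)\cap H^1_0(\Omega;\mathbb{R}^2)\cap W^{1,q}_0(\Omega;\mathbb{R}^2)$ such that (1) $\varphi=g+\nabla h$; (2) $\|g\|_{L^\infty(\Omega;\mathbb{R}^2)}+\|g\|_{H^1_0(\Omega;\mathbb{R}^2)}+\|h\|_{H^2_0(\Omega)}\le C\|\varphi\|_{H^1_0(\Omega;\mathbb{R}^2)}$; (3) $\|g\|_{W^{1,q}_0(\Omega;\mathbb{R}^2)}+\|h\|_{W^{2,q}_0(\Omega)}\le C\|\varphi\|_{W^{1,q}_0(\Omega;\mathbb{R}^2)}$. *)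

(* Defs.v *)
From HB Require Import structures.
From mathcomp Require Import all_boot all_order all_algebra.
From mathcomp Require Import all_classical all_reals all_analysis.
From mathcomp Require Import ess_sup_inf.
Set Implicit Arguments. Unset Strict Implicit. Unset Printing Implicit Defensive.
Import Order.TTheory GRing.Theory Num.Theory.
Import numFieldNormedType.Exports.
Local Open Scope classical_set_scope.
Local Open Scope ring_scope.

Section Defs.
Variable R : realType.
Notation T := (R * R)%type.

Definition leb2 := (@lebesgue_measure R \x @lebesgue_measure R)%E.

Definition dir (i : 'I_2) : T := if val i == 0%N then (1, 0) else (0, 1).

Definition partial (i : 'I_2) (f : T -> R) : T -> R := 'D_(dir i) f.

Fixpoint iter_partial (s : seq 'I_2) (f : T -> R) : T -> R :=
  if s is i :: s' then partial i (iter_partial s' f) else f.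

Definition smooth (f : T -> R) : Prop :=
  forall (s : seq 'I_2) (x : T), differentiable (iter_partial s f) x.

Definition Cc_inf (D : set T) (f : T -> R) : Prop :=
  smooth f /\ exists K : set T, [/\ compact K, K `<=` D & forall x, ~ K x -> f x = 0].

Definition inLq (q : R) (D : set T) (f : T -> R) : Prop :=
  measurable_fun D f /\ leb2.-integrable D (fun x => (`|f x| `^ q)%:E).

Definition Lqnorm (q : R) (D : set T) (f : T -> R) : R :=
  (fine (\int[leb2]_(x in D) (`|f x| `^ q)%:E)) `^ q^-1.

Definition inLinf (D : set T) (f : T -> R) : Prop :=
  measurable_fun D f /\ (ess_sup leb2 (fun x => (`|f x| * \1_D x)%:E) < +oo)%E.

Definition Linfnorm (D : set T) (f : T -> R) : R :=
  fine (ess_sup leb2 (fun x => (`|f x| * \1_D x)%:E)).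

Fixpoint multi (k : nat) : seq (seq 'I_2) :=
  if k is k'.+1 then [::] :: [seq i :: s | i <- enum 'I_2, s <- multi k'] else [:: [::]].

Definition inW0 (k : nat) (q : R) (D : set T) (u : seq 'I_2 -> T -> R) : Prop :=
  (forall s, s \in multi k -> inLq q D (u s)) /\
  exists phi : nat -> T -> R, (forall n, Cc_inf D (phi n)) /\
    forall s, s \in multi k ->
      (Lqnorm q D (fun x => iter_partial s (phi n) x - u s x)) @[n --> \oo] --> (0:R).

Definition W0norm (k : nat) (q : R) (D : set T) (u : seq 'I_2 -> T -> R) : R :=
  \sum_(s <- multi k) Lqnorm q D (u s).

Definition rot (th : R) (y : T) : T :=
  (cos th * y.1 - sin th * y.2, sin th * y.1 + cos th * y.2).

Definition lipschitz_boundary (O : set T) : Prop :=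
  forall x0 : T, closure O x0 -> ~ O x0 ->
  exists (U : set T) (th : R) (gam : R -> R) (L : R),
    [/\ open U, U x0,
        (forall a b, `|gam a - gam b| <= L * `|a - b|) &
        forall y, U y -> (O y <-> gam (rot th (y - x0)).1 < (rot th (y - x0)).2)].

Definition simply_connected (O : set T) : Prop :=
  (forall x y, O x -> O y -> exists p : R -> T,
      [/\ {within `[0, 1], continuous p}, p @` `[0, 1] `<=` O, p 0 = x & p 1 = y]) /\
  (forall gam : R -> T, {within `[0, 1], continuous gam} -> gam @` `[0, 1] `<=` O ->
     gam 0 = gam 1 ->
     exists H : T -> T,
       [/\ {within `[0, 1] `*` `[0, 1], continuous H},
           H @` (`[0, 1] `*` `[0, 1]) `<=` O,
           (forall t, t \in `[0, 1] -> H (0, t) = gam t /\ H (1, t) = gam 0) &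
           (forall s, s \in `[0, 1] -> H (s, 0) = gam 0 /\ H (s, 1) = gam 0)]).

End Defs.

(* Main.v *)
(**
Everything is reduced to smooth compactly supported [u], for which one needs a single smooth compactly supported [h], independent of the exponent, with [|u - grad h|] bounded by the [L^2] norm of [grad u] and the second derivatives of [h] bounded in [L^r] by [grad u], for [r = 2] and [r = q]. The general case follows by telescoping a rapidly converging sequence of approximants.

On a fine grid let [m] be a maximal function of [|grad u|], so that [|u(p) - u(q)| <= C |p - q| (m(p) + m(q))], and, since the complement of the domain is thick by the Lipschitz condition, [|u(p)| <= C m(p) dist(p, complement)]. Cut [m] at the dyadic levels [t_k]: a Lipschitz extension of [u] from [{m <= t_k}] is [C t_k]-Lipschitz, and consecutive extensions differ by [b_k], supported in [{m > t_k}]. On a Whitney-type partition of unity of [{m > t_k}], [h] is a sum of affine functions [x |-> sum_c mu_c <b_k(c), x - c>], whose gradient averages [b_k].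

The key choice is to take [mu_c] proportional to [m(c)^2]. Then [|D^2 h| <= C m] holds pointwise, because the bounds [C t_k] over the levels [t_k < m] form a geometric series; and, [h_k] being the part of [h] at level [k], [|b_k - grad h_k|] at [x] is at most [C t_k sum_c mu_c |x - c|], the sum of which over [k] is controlled by the integral of [dF / sqrt F] with [F(s)] the sum of [m^2] over the ball of radius [s], hence by [2 sqrt F]: this is the [L^2] norm of [m].
*)
Require Import Defs.
From HB Require Import structures.
From mathcomp Require Import all_boot all_order all_algebra.
From mathcomp Require Import all_classical all_reals all_analysis.
From mathcomp Require Import ess_sup_inf measurable_realfun.
From mathcomp Require Import ring lra zify.
Import Order.TTheory GRing.Theory Num.Theory.
Import numFieldNormedType.Exports.
Local Open Scope classical_set_scope.
Local Open Scope ring_scope.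
Set Implicit Arguments.
Unset Strict Implicit.

(** A square-integrable gradient in the plane just fails to bound [u], and the errors of unboundedly
    many levels have to be added. A square of side [r] in [{m > t_k}] satisfies [t_k r <= |m|_2], so
    averaging with uniform weights costs up to [|m|_2] at every level, and the sum over levels is
    lost: for [m] like [1/|x|] on [n] dyadic rings, the levels would cost of order [n] in all,
    against a norm of order [sqrt n]. The weights [m^2] pull each average towards the points where
    [m] is large, which are the points shared by many levels; each point [c] is then charged a
    geometric series over the levels, whose peak is of order [m(c)^2 / sqrt F].

    The work is done on a finite grid, where maximal functions, Lipschitz extensions and weighted
    averages are finite maxima, minima and sums. The maximal function is assembled from
    one-dimensional ones along rows and columns. Sampling a smooth field costs an arbitrarily small
    [eta], which the geometric errors of the telescoping absorb. *)

Local Notation ind b := ((nat_of_bool b%R)%:R) (only parsing).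

(** * One-dimensional discrete maximal function: weak and strong type *)

Section DiscreteMaximal.
Variable R : realType.
Implicit Types (f g : nat -> R) (t p : R).

(** One-sided Hardy-Littlewood maximal function, over intervals ending at [i]. With one end fixed,
    the weak-type bound follows from a recursion, without a covering argument. *)
Definition backavg f (i : nat) : R :=
  \big[Num.max/0]_(j < i.+1) ((\sum_(j <= l < i.+1) f l) / (i.+1 - j)%:R).

Lemma backavg_ge0 f i : 0 <= backavg f i.
Proof. exact: bigmax_ge_id. Qed.

Lemma sum_le_backavg f i j : (j <= i)%N ->
  \sum_(j <= l < i.+1) f l <= (i.+1 - j)%:R * backavg f i.
Proof.
move=> ji; have ij : 0 < (i.+1 - j)%:R :> R by rewrite ltr0n; lia.
rewrite mulrC -ler_pdivrMr//.
have ji' : (j < i.+1)%N by lia.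
exact: (le_bigmax 0
  (fun j : 'I_i.+1 => (\sum_(j <= l < i.+1) f l) / (i.+1 - j)%:R) (Ordinal ji')).
Qed.

(** Lindley's recursion for a queue with arrivals [f] and service [t]: the largest excess of a sum
    of [f] over [t] times its length, among intervals ending just before [i]. It is positive after
    step [i] wherever the maximal function at [i] exceeds [t]. *)
Fixpoint queue f t (i : nat) : R :=
  if i is i'.+1 then Num.max 0 (queue f t i' + f i' - t) else 0.

Lemma queue_ge0 f t i : 0 <= queue f t i.
Proof. by case: i => //= i; rewrite le_max lexx. Qed.

Lemma sum_le_queue f t i j : (j <= i)%N ->
  \sum_(j <= l < i) (f l - t) <= queue f t i.
Proof.
elim: i => [|i IH] ji; first by rewrite big_geq// queue_ge0.
have [->|ne] := eqVneq j i.+1; first by rewrite big_geq// queue_ge0.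
rewrite big_nat_recr/=; last lia.
by rewrite le_max; apply/orP; right; rewrite addrA lerB// lerD2r IH//; lia.
Qed.

Lemma backavg_queue f t i : 0 <= t -> t < backavg f i -> 0 < queue f t i.+1.
Proof.
move=> t0 /bigmax_gtP[|[j _ tj]]; first lra.
have ij : 0 < (i.+1 - j)%:R :> R by rewrite ltr0n; have := ltn_ord j; lia.
move: tj; rewrite ltr_pdivlMr// => tj.
apply: (lt_le_trans _ (sum_le_queue f t (ltnW (ltn_ord j)))).
by rewrite sumrB big_const_nat iter_addr addr0 -mulr_natr subr_gt0.
Qed.

(* The increments of [queue] are [f i - t] where it is positive, and nonpositive elsewhere: summing them gives the weak-type inequality. *)
Lemma backavg_weak f t m : 0 < t -> (forall i, 0 <= f i) ->
  t * \sum_(i < m) ind (t < backavg f i) <=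
  2 * \sum_(i < m) ind (t < 2 * f i) * f i.
Proof.
move=> t0 f0.
have q0 : 0 <= \sum_(i < m) ind (0 < queue f t i.+1) * (f i - t).
  apply: (le_trans (queue_ge0 f t m)).
  elim: m => [|m IH]; first by rewrite big_ord0.
  rewrite big_ord_recr /=; case: ltP => /= [|] h; last first.
    by have := queue_ge0 f t m; nra.
  move: h; rewrite lt_max ltxx /= => h; rewrite max_r; last by apply: ltW.
  by rewrite mul1r -addrA lerD2r.
(* Where [2 * f i <= t] the increment [f i - t] is at most [- t / 2], so that only the values of [f]
   above [t / 2] are charged. *)
have : \sum_(i < m) ind (0 < queue f t i.+1) * (f i - t) <=
   \sum_(i < m) (ind (t < 2 * f i) * f i - t / 2 * ind (t < backavg f i)).
  apply: ler_sum => i _; have := @backavg_queue f t i (ltW t0).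
  have := f0 i; case: (ltP t (backavg _ _)) => _ fi0.
    by move=> /(_ isT) ->; rewrite mul1r; case: ltP => /=; lra.
  by move=> _; case: (0 < _); case: ltP => /=; lra.
rewrite sumrB -mulr_sumr; nra.
Qed.

Lemma geom_sum (a : nat -> R) K : (forall k, 0 <= a k) -> (forall k, 2 * a k <= a k.+1) ->
  \sum_(k < K.+1) a k <= 2 * a K.
Proof.
move=> a0 a2; elim: K => [|K IH]; first by rewrite big_ord1; have := a0 0%N; lra.
by rewrite big_ord_recr /=; have := a2 K; lra.
Qed.

(** The terms at least double, so the last one selected by [P] dominates; the bound does not depend
    on the number [K] of terms. *)
Lemma geom_sum_lt (a : nat -> R) (P : pred nat) z K : (forall k, 0 <= a k) ->
  (forall k, 2 * a k <= a k.+1) -> 0 <= z -> (forall k, P k -> a k <= z) ->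
  \sum_(k < K) ind (P k) * a k <= 2 * z.
Proof.
move=> a0 a2 z0 Pz; elim: K => [|K IH]; first by rewrite big_ord0; lra.
rewrite big_ord_recr /=; case: (boolP (P K)) => [PK|_]; last by rewrite mul0r addr0.
apply: (@le_trans _ _ (\sum_(k < K.+1) a k)).
  rewrite big_ord_recr/= mul1r lerD2r; apply: ler_sum => k _.
  by rewrite ler_piMl//; case: (P k).
by apply: le_trans (geom_sum K a0 a2) _; rewrite ler_pM2l// Pz.
Qed.

Definition lev t (k : nat) : R := t * 2 ^+ k.

Lemma lev_gt0 t k : 0 < t -> 0 < lev t k.
Proof. by move=> t0; rewrite mulr_gt0// exprn_gt0. Qed.

Lemma levS t k : lev t k.+1 = 2 * lev t k.
Proof. by rewrite /lev exprS; ring. Qed.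

Lemma lev_large t z : 0 < t -> exists K, z <= lev t K.
Proof.
move=> t0; exists (Num.truncn (`|z| / t)).+1.
rewrite /lev -ler_pdivrMl//.
apply: (@le_trans _ _ (`|z| / t)).
  by rewrite mulrC ler_pM2r ?invr_gt0// ler_norm.
apply: ltW; apply: lt_le_trans (truncnS_gt _) _.
by rewrite -natrX ler_nat; exact/ltnW/ltn_expl.
Qed.

(** Dyadic layer-cake formula: the successor of the last level below [y] already exceeds [y], so
    that single term suffices. *)
Lemma powR_layers t p y K : 0 < t -> 0 <= p -> 0 <= y -> y <= lev t K ->
  y `^ p <= t `^ p + \sum_(k < K) ind (lev t k < y) * lev t k.+1 `^ p.
Proof.
move=> t0 p0 y0; elim: K => [|K IH] yK.
  by rewrite big_ord0 addr0 ge0_ler_powR ?nnegrE ?(ltW t0)// -(mulr1 t).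
rewrite big_ord_recr /=; case: (ltP (lev t K) y) => h /=.
  rewrite mul1r addrA ler_wpDl ?ge0_ler_powR ?nnegrE ?(ltW (lev_gt0 _ _))//.
  by rewrite addr_ge0 ?powR_ge0// sumr_ge0// => i _; rewrite mulr_ge0 ?powR_ge0.
by rewrite mul0r addr0; exact: IH.
Qed.

Lemma powR_double p z : 1 <= p -> 0 < z -> 2 * z `^ p <= (2 * z) `^ p.
Proof.
move=> p1 z0; rewrite powRM// ?(ltW z0)//; apply: ler_wpM2r; first exact: powR_ge0.
by apply: le1r_powR; lra.
Qed.

(** The weak-type bound is weighted by the power [p - 1] of the level and summed over dyadic levels.
    As it charges only values above half the level, [f i] meets only levels below [2 * f i]; their
    powers at least double because [p - 1 >= 1], and sum geometrically. *)
Lemma backavg_Lp p m f : 2 <= p -> (forall i, 0 <= f i) ->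
  \sum_(i < m) backavg f i `^ p <= 4 * 4 `^ p * \sum_(i < m) f i `^ p.
Proof.
move=> p2 f0; apply/ler_addgt0Pr => e e0.
have p0 : 0 < p by lra.
(* Chosen so that what lies below the lowest level, [m] times the power [p] of [t], is at most
   [e]. *)
pose t := (e / m.+1%:R) `^ p^-1.
have m0 : 0 < m.+1%:R :> R by rewrite ltr0n.
have em0 : 0 < e / m.+1%:R by rewrite divr_gt0.
have t0 : 0 < t by apply: powR_gt0.
have tp : m%:R * t `^ p <= e.
  rewrite /t -powRrM mulVf ?gt_eqF// powRr1 ?(ltW em0)//.
  rewrite mulrCA -[leRHS]mulr1 ler_pM2l// ler_pdivrMr// mul1r ler_nat; lia.
have [K mK] := lev_large (\sum_(i < m) backavg f i) t0.
have MK (i : 'I_m) : backavg f i <= lev t K.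
  apply: le_trans mK; rewrite (bigD1 i)//= lerDl sumr_ge0// => j _.
  exact: backavg_ge0.
have lev0 k : 0 < lev t k by exact: lev_gt0.
apply: (@le_trans _ _ (m%:R * t `^ p +
    \sum_(k < K) lev t k.+1 `^ p * \sum_(i < m) ind (lev t k < backavg f i))).
  under [X in _ + X]eq_bigr do rewrite mulr_sumr.
  rewrite exchange_big /= (_ : m%:R * _ = \sum_(i < m) t `^ p); last first.
    by rewrite sumr_const card_ord mulr_natl.
  rewrite -big_split/=.
  apply: ler_sum => i _; under [X in _ <= _ + X]eq_bigr do rewrite mulrC.
  apply: powR_layers => //; [exact: ltW|exact: backavg_ge0].
rewrite addrC lerD//.
apply: (@le_trans _ _ (\sum_(k < K) 2 `^ p * (lev t k) `^ (p - 1) *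
    (2 * \sum_(i < m) ind (lev t k < 2 * f i) * f i))).
  apply: ler_sum => k _.
  rewrite levS powRM ?(ltW (lev0 _))// -mulrA -[leRHS]mulrA.
  apply: ler_wpM2l; first exact: powR_ge0.
  rewrite -[in leLHS](mulr_powRB1 (ltW (lev0 k)) p0) mulrAC mulrC.
  apply: ler_wpM2l; first exact: powR_ge0.
  exact: backavg_weak.
under eq_bigr do rewrite !mulr_sumr.
rewrite exchange_big/= mulr_sumr; apply: ler_sum => i _.
under eq_bigr => k _.
  rewrite (_ : _ * _ = 2 * 2 `^ p * f i * (ind (lev t k < 2 * f i) * lev t k `^ (p - 1))).
    over.
  ring.
rewrite -mulr_sumr.
have := f0 i; rewrite le_eqVlt => /predU1P[<-|fi0].
  by rewrite mulr0 mul0r mulr_ge0 ?powR_ge0// mulr_ge0 ?powR_ge0.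
have fi : 0 <= 2 * f i by lra.
apply: (@le_trans _ _ (2 * 2 `^ p * f i * (2 * (2 * f i) `^ (p - 1)))).
  apply: ler_wpM2l; first by rewrite !mulr_ge0 ?powR_ge0// ltW.
  apply: (@geom_sum_lt (fun k => lev t k `^ (p - 1)) (fun k => lev t k < 2 * f i)).
  - by move=> k; exact: powR_ge0.
  - by move=> k; rewrite levS; apply: powR_double => //; lra.
  - exact: powR_ge0.
  - move=> k /ltW h; apply: ge0_ler_powR => //; rewrite ?nnegrE ?(ltW (lev0 _))//; lra.
rewrite (_ : _ * _ = 2 * 2 `^ p * (2 * f i * (2 * f i) `^ (p - 1))); last by ring.
rewrite (mulr_powRB1 fi p0) (powRM _ (ler0n R 2) (ltW fi0)).
rewrite (_ : 4 = 2 * 2 :> R) ?(powRM _ (ler0n R 2) (ler0n R 2))//; last by ring.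
by have := powR_ge0 2 p; have := powR_ge0 (f i) p; nra.
Qed.

(** Two-sided maximal function on the indices [0..n]: the reversal [l -> n - l] turns averages
    starting at [i] into averages ending at [n - i]. *)
Definition maxavg n f i : R := backavg f i + backavg (fun l => f (n - l)%N) (n - i)%N.

Lemma maxavg_ge0 n f i : 0 <= maxavg n f i.
Proof. by rewrite addr_ge0 ?backavg_ge0. Qed.

Lemma sum_le_maxavg_l n f j i : (j <= i)%N -> 
  \sum_(j <= l < i.+1) f l <= (i.+1 - j)%:R * maxavg n f i.
Proof.
move=> ji; apply: le_trans (sum_le_backavg f ji) _.
by rewrite mulrDr lerDl mulr_ge0 ?backavg_ge0.
Qed.

Lemma sum_le_maxavg_r n f i j : (i <= j)%N -> (j <= n)%N ->
  \sum_(i <= l < j.+1) f l <= (j.+1 - i)%:R * maxavg n f i.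
Proof.
move=> ij jn; have nji : (n - j <= n - i)%N by lia.
rewrite big_nat_rev /=.
have -> : \sum_(i <= l < j.+1) f (i + j.+1 - l.+1)%N =
   \sum_(n - j <= l < (n - i).+1) f (n - l)%N.
  have E a b (F : nat -> R) : \sum_(a <= l < b) F l = \sum_(l < b - a) F (l + a)%N.
    by rewrite -{1}[a]add0n big_addn big_mkord.
  rewrite !E (_ : (n - i).+1 - (n - j) = j.+1 - i)%N; last lia.
  by apply: eq_bigr => l _; congr f; have := ltn_ord l; lia.
apply: le_trans (sum_le_backavg (fun l => f (n - l)%N) nji) _.
rewrite (_ : (n - i).+1 - (n - j) = j.+1 - i)%N; last lia.
by rewrite mulrDr lerDr mulr_ge0 ?backavg_ge0.
Qed.

Lemma powR_sum2 p (x y : R) : 0 <= p -> 0 <= x -> 0 <= y ->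
  (x + y) `^ p <= 2 `^ p * (x `^ p + y `^ p).
Proof.
move=> p0; wlog xy : x y / x <= y => [H x0 y0|x0 y0].
  by case: (leP x y) => h; [exact: H|rewrite addrC [_ `^ p + _]addrC; apply: H => //; exact: ltW].
apply: (@le_trans _ _ ((2 * y) `^ p)).
  by apply: ge0_ler_powR; rewrite ?nnegrE ?addr_ge0 ?mulr_ge0//; lra.
by rewrite powRM// ler_wpM2l ?powR_ge0// lerDr powR_ge0.
Qed.

Lemma maxavg_Lp p n f : 2 <= p -> (forall i, 0 <= f i) ->
  \sum_(i < n.+1) maxavg n f i `^ p <=
  2 * 2 `^ p * (4 * 4 `^ p) * \sum_(i < n.+1) f i `^ p.
Proof.
move=> p2 f0.
apply: (@le_trans _ _ (2 `^ p * (\sum_(i < n.+1) backavg f i `^ p +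
   \sum_(i < n.+1) backavg (fun l => f (n - l)%N) i `^ p))).
  have -> : \sum_(i < n.+1) backavg (fun l => f (n - l)%N) i `^ p =
            \sum_(i < n.+1) backavg (fun l => f (n - l)%N) (n - i)%N `^ p.
    by rewrite (reindex_inj rev_ord_inj)/=; apply: eq_bigr => i _; rewrite subSS.
  rewrite -big_split/= mulr_sumr; apply: ler_sum => i _.
  by apply: powR_sum2; rewrite ?backavg_ge0//; lra.
have -> : 2 * 2 `^ p * (4 * 4 `^ p) * \sum_(i < n.+1) f i `^ p =
   2 `^ p * (4 * 4 `^ p * \sum_(i < n.+1) f i `^ p + 4 * 4 `^ p * \sum_(i < n.+1) f i `^ p).
  by ring.
apply: ler_wpM2l; first exact: powR_ge0.
apply: lerD; first exact: backavg_Lp.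
have -> : \sum_(i < n.+1) f i `^ p = \sum_(i < n.+1) f (n - i)%N `^ p.
  by rewrite (reindex_inj rev_ord_inj)/=; apply: eq_bigr => i _; rewrite subSS.
by apply: (@backavg_Lp p n.+1 (fun l => f (n - l)%N)).
Qed.

End DiscreteMaximal.

(** * Maximal function on a square grid, and the oscillation it controls *)

Section GridMaximal.
Variable R : realType.
Implicit Types (p : R).

Definition dn (i j : nat) : nat := maxn (i - j) (j - i).

Lemma telescope_le (g f : nat -> R) n i j : (i <= j)%N -> (j <= n)%N ->
  (forall l, (l < n)%N -> `|g l.+1 - g l| <= f l) ->
  `|g j - g i| <= \sum_(i <= l < j) f l.
Proof.
move=> ij jn gf; elim: j ij jn => [|j IH] ij jn.
  by rewrite (_ : i = 0%N) ?subrr ?normr0 ?big_geq//; lia.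
have [->|ne] := eqVneq i j.+1; first by rewrite subrr normr0 big_geq.
rewrite big_nat_recr/=; last lia.
rewrite (_ : g j.+1 - g i = (g j - g i) + (g j.+1 - g j)); last by ring.
by apply: le_trans (ler_normD _ _) _; rewrite lerD ?IH ?gf//; lia.
Qed.

(** The average is taken over the closed interval between [i] and [j], which has one increment more
    than the telescoping sum: hence the successor. *)
Lemma variation_le_maxavg (g f : nat -> R) n i j : (i <= n)%N -> (j <= n)%N ->
  (forall l, 0 <= f l) ->
  (forall l, (l < n)%N -> `|g l.+1 - g l| <= f l) ->
  `|g i - g j| <= (dn i j).+1%:R * maxavg n f i.
Proof.
move=> iN jN f0 gf; case: (leqP i j) => ij.
  rewrite distrC; apply: le_trans (telescope_le ij jN gf) _.
  apply: (@le_trans _ _ (\sum_(i <= l < j.+1) f l)).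
    by rewrite big_nat_recr//= lerDl.
  apply: le_trans (sum_le_maxavg_r f ij jN) _.
  by rewrite (_ : j.+1 - i = (dn i j).+1)%N //; rewrite /dn; lia.
apply: le_trans (telescope_le (ltnW ij) iN gf) _.
apply: (@le_trans _ _ (\sum_(j <= l < i.+1) f l)).
  by rewrite big_nat_recr//=; [rewrite lerDl|lia].
apply: le_trans (sum_le_maxavg_l n f (ltnW ij)) _.
by rewrite (_ : i.+1 - j = (dn i j).+1)%N //; rewrite /dn; lia.
Qed.

(** The interval may miss [i]: it is enlarged to reach [i] and cut there into two one-sided
    intervals of at most [r + 1] points each. *)
Lemma sum_interval_le_maxavg (g : nat -> R) n i r c w : (forall l, 0 <= g l) ->
  (i <= n)%N -> (c + w <= n)%N ->
  (forall s, (c <= s <= c + w)%N -> (dn i s <= r)%N) ->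
  \sum_(s < w.+1) g (c + s)%N <= (2 * r + 2)%:R * maxavg n g i.
Proof.
move=> g0 iN cw H.
have H0 := H c; have H1 := H (c + w)%N; rewrite /dn in H0 H1.
pose a := minn c i; pose b := maxn (c + w) i.
apply: (@le_trans _ _ (\sum_(a <= s < i.+1) g s + \sum_(i <= s < b.+1) g s)).
  apply: (@le_trans _ _ (\sum_(a <= s < b.+1) g s)).
    rewrite (@big_cat_nat _ _ _ c)/=; [|rewrite /a; lia|rewrite /b; lia].
    rewrite ler_wpDl ?sumr_ge0//.
    rewrite (@big_cat_nat _ _ _ (c + w).+1)/=; [|lia|rewrite /b; lia].
    rewrite ler_wpDr ?sumr_ge0// -{2}[c]add0n big_addn big_mkord.
    rewrite (_ : (c + w).+1 - c = w.+1)%N; last lia.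
    by apply: ler_sum => s _; rewrite addnC.
  rewrite (@big_cat_nat _ _ _ i.+1)/=; [|rewrite /a; lia|rewrite /b; lia].
  rewrite lerD2l [leRHS]big_ltn ?lerDr//; rewrite /b; lia.
have ai : (a <= i)%N by rewrite /a; lia.
have ib : (i <= b)%N by rewrite /b; lia.
have bn : (b <= n)%N by rewrite /b; lia.
apply: le_trans (lerD (sum_le_maxavg_l n g ai) (sum_le_maxavg_r g ib bn)) _.
rewrite -mulrDl -natrD; apply: ler_wpM2r; first exact: maxavg_ge0.
rewrite ler_nat /a /b; lia.
Qed.

Variables (n : nat).
Implicit Types (f phi : nat -> nat -> R).

Definition rowmax f i j : R := maxavg n (f ^~ j) i.
Definition colmax f i j : R := maxavg n (f i) j.
(** An iterated maximal function, bounded on L^p by two applications of the one-dimensional theorem.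
    The second summand dominates averages over columns spread along a row, the first a path along
    the row itself. *)
Definition gridmax f i j : R := rowmax f i j + rowmax (colmax f) i j.

Lemma gridmax_ge0 f i j : 0 <= gridmax f i j.
Proof. by rewrite addr_ge0 ?maxavg_ge0. Qed.

Definition gridmax_const p : R :=
  2 `^ p * (2 * 2 `^ p * (4 * 4 `^ p) + (2 * 2 `^ p * (4 * 4 `^ p)) ^+ 2).

Lemma gridmax_Lp p f : 2 <= p -> (forall i j, 0 <= f i j) ->
  \sum_(i < n.+1) \sum_(j < n.+1) gridmax f i j `^ p <=
  gridmax_const p * \sum_(i < n.+1) \sum_(j < n.+1) f i j `^ p.
Proof.
move=> p2 f0; rewrite /gridmax_const; set D := 2 * 2 `^ p * (4 * 4 `^ p).
have D0 : 0 <= D by rewrite !mulr_ge0 ?powR_ge0.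
have row g : (forall i j, 0 <= g i j) ->
    \sum_(i < n.+1) \sum_(j < n.+1) rowmax g i j `^ p <=
    D * \sum_(i < n.+1) \sum_(j < n.+1) g i j `^ p.
  move=> g0; rewrite exchange_big [X in _ <= D * X]exchange_big /= mulr_sumr.
  by apply: ler_sum => j _; apply: (maxavg_Lp n p2 (f := g ^~ j)).
have col : \sum_(i < n.+1) \sum_(j < n.+1) colmax f i j `^ p <=
    D * \sum_(i < n.+1) \sum_(j < n.+1) f i j `^ p.
  by rewrite mulr_sumr; apply: ler_sum => i _; exact: maxavg_Lp.
apply: (@le_trans _ _ (2 `^ p * (\sum_(i < n.+1) \sum_(j < n.+1) rowmax f i j `^ p +
   \sum_(i < n.+1) \sum_(j < n.+1) rowmax (colmax f) i j `^ p))).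
  rewrite -big_split/= mulr_sumr; apply: ler_sum => i _.
  rewrite -big_split/= mulr_sumr; apply: ler_sum => j _.
  by apply: powR_sum2; rewrite ?maxavg_ge0//; lra.
rewrite -mulrA ler_wpM2l ?powR_ge0// mulrDl lerD ?row//.
apply: le_trans (row _ _) _; first by move=> i j; exact: maxavg_ge0.
by rewrite expr2 -mulrA ler_wpM2l.
Qed.

Variables (f phi : nat -> nat -> R).
Hypothesis f0 : forall i j, 0 <= f i j.
Hypothesis phi1 : forall i j, (i < n)%N -> (j <= n)%N -> `|phi i.+1 j - phi i j| <= f i j.
Hypothesis phi2 : forall i j, (i <= n)%N -> (j < n)%N -> `|phi i j.+1 - phi i j| <= f i j.

Lemma variation_row i i' j : (i <= n)%N -> (i' <= n)%N -> (j <= n)%N ->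
  `|phi i j - phi i' j| <= (dn i i').+1%:R * rowmax f i j.
Proof.
by move=> iN iN' jN; apply: (@variation_le_maxavg (phi ^~ j)) => // l ln; exact: phi1.
Qed.

Lemma variation_col i j j' : (i <= n)%N -> (j <= n)%N -> (j' <= n)%N ->
  `|phi i j - phi i j'| <= (dn j j').+1%:R * colmax f i j.
Proof.
by move=> iN jN jN'; apply: (@variation_le_maxavg (phi i)) => // l ln; exact: phi2.
Qed.

(* Joining [(i, j)] to [v] through columns [s] of an interval and averaging over [s]. *)
Lemma average_columns i j r c w (v : nat -> R) (B : R) :
  (i <= n)%N -> (j <= n)%N -> (c + w <= n)%N ->
  (forall s, (c <= s <= c + w)%N -> (dn i s <= r)%N) ->
  (forall s, (c <= s <= c + w)%N -> exists j', [/\ (j' <= n)%N, (dn j j' <= r)%N &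
      `|phi s j' - v s| <= B]) ->
  (forall s, v s = v 0%N) ->
  w.+1%:R * `|phi i j - v 0%N| <=
  w.+1%:R * (r.+1%:R * rowmax f i j) +
  r.+1%:R * (2 * r + 2)%:R * rowmax (colmax f) i j + w.+1%:R * B.
Proof.
move=> iN jN cwN ir H vE.
have step (s : 'I_w.+1) : `|phi i j - v 0%N| <=
   r.+1%:R * rowmax f i j + r.+1%:R * colmax f (c + s)%N j + B.
  have cs : (c <= c + s <= c + w)%N by have := ltn_ord s; lia.
  have [j' [j'n jr Hs]] := H _ cs.
  have csn : (c + s <= n)%N by lia.
  rewrite (_ : phi i j - v 0%N = (phi i j - phi (c + s)%N j) +
    (phi (c + s)%N j - phi (c + s)%N j') + (phi (c + s)%N j' - v (c + s)%N)); last first.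
    by rewrite vE; ring.
  do 2![apply: le_trans (ler_normD _ _) _; apply: lerD => //].
    apply: le_trans (variation_row iN csn jN) _.
    apply: ler_wpM2r; [exact: maxavg_ge0|rewrite ler_nat ltnS; exact: ir].
  apply: le_trans (variation_col csn jN j'n) _.
  by apply: ler_wpM2r; [exact: maxavg_ge0|rewrite ler_nat ltnS].
rewrite mulr_natl -[in leLHS](card_ord w.+1) -sumr_const.
apply: le_trans (ler_sum _ (fun s _ => step s)) _.
rewrite !big_split/= !sumr_const !card_ord -(mulr_natl (_ * _)) -(mulr_natl B).
rewrite lerD2r lerD2l -mulr_sumr -mulrA ler_wpM2l//.
by apply: sum_interval_le_maxavg => // l; exact: maxavg_ge0.
Qed.

(** The path runs along the row of [(i, j)] to a column [s], along that column to the row [j'], and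
    along that row to [(i', j')]. Averaging over the columns [s] near [i] turns the middle part, a
    [colmax], into [rowmax (colmax f)]. *)
Lemma two_point i j i' j' r : (i <= n)%N -> (j <= n)%N -> (i' <= n)%N -> (j' <= n)%N ->
  (0 < r <= n)%N -> (dn i i' <= r)%N -> (dn j j' <= r)%N ->
  `|phi i j - phi i' j'| <= r%:R * (6 * (gridmax f i j + gridmax f i' j')).
Proof.
move=> iN jN iN' jN' /andP[r0 rN] ii jj.
(* The columns within [r] of [i], clipped to the grid; at least [r + 1] of them remain because
   [r <= n]. *)
pose c := (i - r)%N; pose w := (minn (i + r) n - c)%N.
have cw : (c + w <= n)%N by rewrite /w /c; lia.
have wr : (r <= w)%N by rewrite /w /c; lia.
have Hs s : (c <= s <= c + w)%N -> (dn i s <= r)%N by rewrite /w /c /dn; lia.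
have Hv s : (c <= s <= c + w)%N -> exists j'', [/\ (j'' <= n)%N, (dn j j'' <= r)%N &
    `|phi s j'' - phi i' j'| <= (2 * r).+1%:R * rowmax f i' j'].
  move=> cs; exists j'; split => //.
  have sN : (s <= n)%N by lia.
  rewrite distrC; apply: le_trans (variation_row iN' sN jN') _.
  apply: ler_wpM2r; first exact: maxavg_ge0.
  by rewrite ler_nat; have := Hs _ cs; move: ii; rewrite /dn; lia.
have H := @average_columns i j r c w (fun=> phi i' j') _ iN jN cw Hs Hv (fun=> erefl).
have w0 : 0 < w.+1%:R :> R by rewrite ltr0n.
rewrite -(ler_pM2l w0); apply: le_trans H _.
have a0 := maxavg_ge0 n (f ^~ j) i.
have b0 := maxavg_ge0 n ((colmax f) ^~ j) i.
have a0' := maxavg_ge0 n (f ^~ j') i'.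
have b0' := maxavg_ge0 n ((colmax f) ^~ j') i'.
rewrite /gridmax /rowmax.
have wr' : r%:R + 1 <= w%:R + 1 :> R by rewrite lerD2r ler_nat.
have r1 : 1 <= r%:R :> R by rewrite ler1n.
rewrite -!natr1 (natrD _ (2 * r) 2) (natrM _ 2 r).
set A := maxavg _ _ _ in a0 *; set B := maxavg _ _ _ in b0 *.
set A' := maxavg _ _ _ in a0' *; set B' := maxavg _ _ _ in b0' *.
set W := w%:R + 1 in wr' *; set r' := r%:R in wr' r1 *.
apply: (@le_trans _ _ (W * ((r' + 1) * A) + W * (2 * r' + 2) * B + W * ((2 * r' + 1) * A'))).
  rewrite lerD2r lerD2l ler_wpM2r// ler_wpM2r//; lra.
rewrite -!mulrA -!mulrDr ler_pM2l//; last by rewrite /W; lra.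
nra.
Qed.

(** A Hardy-type estimate: if the columns on which [phi] vanishes somewhere nearby form a proportion
    at least [1 / k] of the radius [r], averaging over these columns alone costs only a factor
    depending on [k]. *)
Lemma columns_zero i j r c w (k : R) : (i <= n)%N -> (j <= n)%N -> (c + w <= n)%N ->
  (0 < r)%N -> r%:R <= k * w.+1%:R -> 
  (forall s, (c <= s <= c + w)%N -> (dn i s <= r)%N /\
     exists j', [/\ (j' <= n)%N, (dn j j' <= r)%N & phi s j' = 0]) ->
  `|phi i j| <= r%:R * ((2 + 8 * k) * gridmax f i j).
Proof.
move=> iN jN cw r0 rk H.
have Hv s : (c <= s <= c + w)%N -> exists j', [/\ (j' <= n)%N, (dn j j' <= r)%N &
    `|phi s j' - 0| <= 0].
  move=> /H[_ [j' [j'n jr ph]]]; exists j'; split => //.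
  by rewrite ph subr0 normr0.
have := @average_columns i j r c w (fun=> 0) 0 iN jN cw (fun s h => (H s h).1) Hv (fun=> erefl).
rewrite subr0 mulr0 addr0 => {}H.
have w0 : 0 < w.+1%:R :> R by rewrite ltr0n.
rewrite -(ler_pM2l w0); apply: le_trans H _.
have a0 := maxavg_ge0 n (f ^~ j) i.
have b0 := maxavg_ge0 n ((colmax f) ^~ j) i.
rewrite /gridmax /rowmax.
have r1 : 1 <= r%:R :> R by rewrite ler1n.
rewrite -(natr1 r) (natrD _ (2 * r) 2) (natrM _ 2 r).
set A := maxavg _ _ _ in a0 *; set B := maxavg _ _ _ in b0 *.
set W := w.+1%:R in w0 rk *; set r' := r%:R in rk r1 *.
have k0 : 0 < k by rewrite -(pmulr_lgt0 _ w0); lra.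
apply: (@le_trans _ _ (W * (2 * r' * A) + 2 * r' * (4 * (k * W)) * B)).
  apply: lerD; first by rewrite ler_pM2l// ler_wpM2r//; lra.
  by rewrite ler_wpM2r// ler_pM//; lra.
rewrite (_ : _ + _ = W * (r' * (2 * A + 8 * k * B))); last by ring.
rewrite ler_pM2l// ler_pM2l//; last lra.
have := mulr_ge0 (ltW k0) a0; lra.
Qed.

End GridMaximal.

(** * Lipschitz extension, and the sums behind the uniform bound *)

Section FiniteSums.
Variable R : realType.

(** McShane's formula, the minimum over [q] in [S] of [phi q + L d(p, q)], attained since [T] is
    finite and [s0] makes [S] nonempty. *)
Lemma mcshane (T : finType) (d : T -> T -> nat) (S : pred T) (phi : T -> R) (L : R) (s0 : T) :
  (forall p, d p p = 0%N) -> (forall p q, d p q = d q p) ->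
  (forall p q r, (d p r <= d p q + d q r)%N) -> 0 <= L -> S s0 ->
  (forall p q, S p -> S q -> `|phi p - phi q| <= L * (d p q)%:R) ->
  exists psi : T -> R, (forall p, S p -> psi p = phi p) /\
    (forall p q, `|psi p - psi q| <= L * (d p q)%:R).
Proof.
move=> dpp dC dT L0 Ss0 phiL.
pose F p q := phi q + L * (d p q)%:R.
have argF p : exists2 q, S q & forall q', S q' -> F p q <= F p q'.
  by case: (arg_minP (F p) Ss0) => q Sq qmin; exists q.
have [sel selS] := boolp.choice (fun p => let: ex_intro2 q a b := argF p in ex_intro _ q (conj a b)).
exists (fun p => F p (sel p)); split=> [p Sp|p q].
  have [Sq qmin] := selS p; apply/eqP; rewrite eq_le.
  have := qmin _ Sp; rewrite /F dpp mulr0 addr0 => -> /=.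
  by have := phiL _ _ Sp Sq; rewrite ler_norml => /andP[_]; lra.
wlog : p q / F p (sel p) <= F q (sel q).
  move=> H; case: (leP (F p (sel p)) (F q (sel q))) => h; first exact: H.
  by rewrite distrC dC H// ltW.
move=> h; rewrite distrC ger0_norm ?subr_ge0//.
have [Sp _] := selS p; have [_ qmin] := selS q.
have := qmin _ Sp; rewrite /F.
have : L * (d q (sel p))%:R <= L * (d p q)%:R + L * (d p (sel p))%:R.
  by rewrite -mulrDr ler_wpM2l// -natrD ler_nat (dC p q) dT.
lra.
Qed.

Lemma sum_min_geometric (K : nat) (x : R) : 0 < x ->
  \sum_(k < K) Num.min (x * 2 ^+ k) (x * 2 ^+ k)^-1 <= 4.
Proof.
(* Strengthened for an induction that doubles [x]: below 1 the terms still rise, and [4 - 2 x] pays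
   for the rise and the descent; from 1 on only the decreasing series, of sum at most [2 / x], is
   left. *)
suff H : 0 < x -> \sum_(k < K) Num.min (x * 2 ^+ k) (x * 2 ^+ k)^-1 <=
    if x < 1 then 4 - 2 * x else 2 / x.
  move=> x0; apply: le_trans (H x0) _; case: ltP => h; first lra.
  by rewrite ler_pdivrMr//; lra.
elim: K x => [|K IH] x x0.
  rewrite big_ord0; case: ltP => h; first lra.
  by rewrite divr_ge0// ltW.
rewrite big_ord_recl /= expr0 mulr1.
have -> : \sum_(i < K) Num.min (x * 2 ^+ bump 0 i) (x * 2 ^+ bump 0 i)^-1 =
   \sum_(i < K) Num.min ((2 * x) * 2 ^+ i) ((2 * x) * 2 ^+ i)^-1.
  by apply: eq_bigr => i _; rewrite (_ : x * 2 ^+ bump 0 i = 2 * x * 2 ^+ i)// /bump exprS; ring.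
have {IH} := IH (2 * x) _; rewrite mulr_gt0// => /(_ isT) IH.
apply: (le_trans (lerD (lexx _) IH)).
have xV : 0 < x^-1 by rewrite invr_gt0.
have xx : x * x^-1 = 1 by rewrite mulfV// gt_eqF.
case: (ltP x 1) => h1; case: ltP => h2.
- have : Num.min x x^-1 <= x by rewrite ge_min lexx.
  lra.
- have : Num.min x x^-1 <= x by rewrite ge_min lexx.
  rewrite invfM mulrA mulfV// mul1r.
  have : x^-1 <= 4 - 3 * x.
    by rewrite -(ler_pM2l x0) xx; nra.
  lra.
- lra.
- have : Num.min x x^-1 <= x^-1 by rewrite ge_min lexx orbT.
  rewrite invfM mulrA mulfV// mul1r; lra.
Qed.

(** Grouping by the value of [s], the points of one shell raise the cumulative mass from [b^2] to
    [a^2], and [(a^2 - b^2) / a <= 2 (a - b)] telescopes. *)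
Lemma sum_over_sqrt (T : finType) (s : T -> nat) (nu : T -> R) : (forall c, 0 <= nu c) ->
  \sum_c nu c / Num.sqrt (\sum_(c' | (s c' <= s c)%N) nu c') <=
  2 * Num.sqrt (\sum_c nu c).
Proof.
move=> nu0.
suff H r : \sum_(c | (s c < r)%N) nu c / Num.sqrt (\sum_(c' | (s c' <= s c)%N) nu c') <=
  2 * Num.sqrt (\sum_(c | (s c < r)%N) nu c).
  have all c : (s c < (\max_c s c).+1)%N by rewrite ltnS leq_bigmax.
  have E (G : T -> R) : \sum_(c | (s c < (\max_c s c).+1)%N) G c = \sum_c G c.
    by apply: eq_bigl => c; rewrite all.
  by have := H (\max_c s c).+1; rewrite !E.
elim: r => [|r IH]; first by rewrite !big_pred0// mulr_ge0 ?sqrtr_ge0.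
rewrite (bigID (fun c => s c < r)%N)/=.
rewrite (eq_bigl (fun c => s c < r)%N); last by move=> c; lia.
rewrite [X in _ + X](eq_bigl (fun c => s c == r)); last by move=> c; lia.
rewrite [X in 2 * Num.sqrt X](bigID (fun c => s c < r)%N)/=.
rewrite [in leRHS](eq_bigl (fun c => s c < r)%N); last by move=> c; lia.
rewrite [X in 2 * Num.sqrt (_ + X)](eq_bigl (fun c => s c == r)); last by move=> c; lia.
apply: le_trans (lerD IH (lexx _)) _.
set E := \sum_(c | (s c < r)%N) nu c; set V := \sum_(c | s c == r) nu c.
have E0 : 0 <= E by apply: sumr_ge0.
have V0 : 0 <= V by apply: sumr_ge0.
have -> : \sum_(c | s c == r) nu c / Num.sqrt (\sum_(c' | (s c' <= s c)%N) nu c') =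
   V / Num.sqrt (E + V).
  rewrite mulr_suml; apply: eq_bigr => c /eqP ->.
  congr (_ / Num.sqrt _); rewrite (bigID (fun c => s c < r)%N)/=.
  by congr (_ + _); apply: eq_bigl => c'; lia.
have a0 := sqrtr_ge0 (E + V); have b0 := sqrtr_ge0 E.
have ab : Num.sqrt E <= Num.sqrt (E + V) by rewrite ler_wsqrtr// lerDl.
have aE := sqr_sqrtr (addr_ge0 E0 V0); have bE := sqr_sqrtr E0.
set a := Num.sqrt (E + V) in a0 ab aE *; set b := Num.sqrt E in b0 ab bE *.
(* With no mass at all the quotient is 0 by the convention on inverses, and [b <= a] concludes. *)
have [az|an] := eqVneq a 0; first by rewrite az invr0 mulr0; lra.
have {an}a0 : 0 < a by rewrite lt_neqAle eq_sym an.
have -> : V = a ^+ 2 - b ^+ 2 by rewrite aE bE; ring.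
suff : (a ^+ 2 - b ^+ 2) / a <= 2 * (a - b) by lra.
by rewrite ler_pdivrMr//; nra.
Qed.

(** Truncating [w] at [S / 2] loses at most a factor 2 on [B], and the points of [O] outside [B],
    where [w] is at least [S / 2], can then only raise the mean. So the mean over [B] is at most
    twice the mean over [O]; it is stated without denominators. It serves to replace a ball about a
    Whitney square by a ball about the point of evaluation. *)
Lemma average_enlarge (T : finType) (B O : pred T) (w nu : T -> R) (S : R) :
  (forall c, 0 <= nu c) -> (forall c, 0 <= w c) -> (forall c, B c -> O c) ->
  (forall c, B c -> w c <= S) -> (forall c, O c -> ~~ B c -> S / 2 <= w c) -> 0 <= S ->
  (\sum_(c | B c) w c * nu c) * (\sum_(c | O c) nu c) <=
  2 * (\sum_(c | O c) w c * nu c) * (\sum_(c | B c) nu c).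
Proof.
move=> nu0 w0 BO wS Sw S0.
have split (h : T -> R) : \sum_(c | O c) h c =
    \sum_(c | B c) h c + \sum_(c | O c && ~~ B c) h c.
  rewrite (bigID B)/=; congr (_ + _); apply: eq_bigl => c.
  by case: (boolP (B c)) => [/BO ->|]; rewrite ?andbF.
rewrite !split.
pose psi c := Num.min (w c) (S / 2).
set V := \sum_(c | B c) nu c; set D := \sum_(c | O c && ~~ B c) nu c.
have V0 : 0 <= V by apply: sumr_ge0.
have D0 : 0 <= D by apply: sumr_ge0.
have W1 : \sum_(c | B c) w c * nu c <= 2 * \sum_(c | B c) psi c * nu c.
  rewrite mulr_sumr; apply: ler_sum => c Bc; rewrite mulrA ler_wpM2r// /psi.
  have := wS _ Bc; have := w0 c; rewrite minElt; case: ifP; lra.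
have P1 : \sum_(c | B c) psi c * nu c <= S / 2 * V.
  by rewrite mulr_sumr; apply: ler_sum => c Bc; rewrite ler_wpM2r// ge_min lexx orbT.
have P2 : \sum_(c | B c) psi c * nu c <= \sum_(c | B c) w c * nu c.
  by apply: ler_sum => c Bc; rewrite ler_wpM2r// ge_min lexx.
have W2 : S / 2 * D <= \sum_(c | O c && ~~ B c) w c * nu c.
  by rewrite mulr_sumr; apply: ler_sum => c /andP[Oc nBc]; rewrite ler_wpM2r// Sw.
set a := \sum_(c | B c) w c * nu c in W1 P2 *.
set b := \sum_(c | B c) psi c * nu c in W1 P1 P2 *.
set d := \sum_(c | _ && _) w c * nu c in W2 *.
apply: (@le_trans _ _ (2 * b * (V + D))); first by rewrite ler_wpM2r// addr_ge0.
rewrite -!mulrA ler_pM2l// mulrDr mulrDl lerD ?ler_wpM2r//.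
apply: (@le_trans _ _ (S / 2 * V * D)); first by rewrite ler_wpM2r.
by rewrite mulrAC ler_wpM2r.
Qed.

(** For a point [c] in the ball, its mass [V] is at least the cumulative mass [F c], and also at
    least the squared level times [4 ^ j], hence times [(s c + 1)^2 / 100]. The first bound makes
    the share of [c] rise with the level, the second makes it fall, so the shares sum to a multiple
    of [nu c / sqrt (F c)]. The constant is 10 from the radius, 2 scales per level, 4 from the
    geometric sums and 2 from [sum_over_sqrt]. *)
Lemma weighted_distance_sum (T : finType) (s : T -> nat) (nu : T -> R) (tau : R)
  (act : nat -> nat -> bool) K N :
  (forall c, 0 <= nu c) -> 0 < tau ->
  (forall k j, act k j ->
    lev tau k ^+ 2 * 4 ^+ j <= \sum_(c | (s c <= 9 * 2 ^ j)%N) nu c) ->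
  (forall k, \sum_(j < N) (act k j : nat)%:R <= 2 :> R) ->
  \sum_(k < K) \sum_(j < N) (act k j : nat)%:R *
     (lev tau k * (\sum_(c | (s c <= 9 * 2 ^ j)%N) (s c).+1%:R * nu c) /
        \sum_(c | (s c <= 9 * 2 ^ j)%N) nu c)
  <= 160 * Num.sqrt (\sum_c nu c).
Proof.
move=> nu0 tau0 rich act2.
pose F c := \sum_(c' | (s c' <= s c)%N) nu c'.
pose V j := \sum_(c | (s c <= 9 * 2 ^ j)%N) nu c.
(* Normalised so that the two bounds on the share of [c] agree when [x c * 2 ^ k] is 1. *)
pose x c := tau * (s c).+1%:R / (10 * Num.sqrt (F c)).
have lev0 k := lev_gt0 k tau0.
have key c k j : act k j -> (s c <= 9 * 2 ^ j)%N ->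
   lev tau k * ((s c).+1%:R * nu c) / V j <=
   10 * (nu c / Num.sqrt (F c)) * Num.min (x c * 2 ^+ k) (x c * 2 ^+ k)^-1.
  move=> kj cj.
  have [nz|nn] := eqVneq (nu c) 0.
    by rewrite nz !(mulr0, mul0r).
  have nup : 0 < nu c by rewrite lt_neqAle eq_sym nn nu0.
  have Fp : 0 < F c.
    apply: lt_le_trans nup _; rewrite /F (bigD1 c)//= lerDl; exact: sumr_ge0.
  have FV : F c <= V j.
    rewrite /V (bigID (fun c' => s c' <= s c)%N)/= /F.
    rewrite (eq_bigl (fun c' => s c' <= s c)%N); last by move=> c'; lia.
    by rewrite lerDl; exact: sumr_ge0.
  have Vp : 0 < V j by exact: lt_le_trans FV.
  have sp : 0 < (s c).+1%:R :> R by rewrite ltr0n.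
  have qp : 0 < Num.sqrt (F c) by rewrite sqrtr_gt0.
  have qq := sqr_sqrtr (ltW Fp).
  have xk : x c * 2 ^+ k = lev tau k * (s c).+1%:R / (10 * Num.sqrt (F c)).
    by rewrite /x /lev; ring.
  have xp : 0 < x c * 2 ^+ k by rewrite xk divr_gt0 ?mulr_gt0.
  rewrite minr_pMr; last by rewrite ltW// mulr_gt0// divr_gt0.
  rewrite le_min; apply/andP; split.
    rewrite xk; apply: (@le_trans _ _ (lev tau k * ((s c).+1%:R * nu c) / F c)).
      by rewrite ler_pM2l ?mulr_gt0// lef_pV2.
    rewrite -[in leLHS]qq le_eqVlt; apply/orP; left; apply/eqP; field.
    by rewrite gt_eqF.
  rewrite xk ler_pdivrMr//.
  have rk := rich _ _ kj.
  have s2 : (s c).+1%:R ^+ 2 <= 100 * 4 ^+ j :> R.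
    rewrite -natrX -(natrX _ 4) -(natrM _ 100) ler_nat.
    have : ((s c).+1 <= 10 * 2 ^ j)%N.
      by have : (0 < 2 ^ j)%N; [rewrite expn_gt0|lia].
    rewrite (_ : 4 ^ j = 2 ^ j * 2 ^ j)%N; last by rewrite -expnMn.
    by move=> h; apply: leq_trans (leq_mul h h) _; rewrite mulnACA.
  have -> : 10 * (nu c / Num.sqrt (F c)) * (lev tau k * (s c).+1%:R / (10 * Num.sqrt (F c)))^-1 * V j
     = 100 * nu c * V j / (lev tau k * (s c).+1%:R).
    by field; rewrite !gt_eqF.
  rewrite ler_pdivlMr ?mulr_gt0//.
  have -> : lev tau k * ((s c).+1%:R * nu c) * (lev tau k * (s c).+1%:R) =
     nu c * (lev tau k ^+ 2 * (s c).+1%:R ^+ 2) by ring.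
  rewrite [leRHS](_ : _ = nu c * (100 * V j)); last by ring.
  rewrite ler_pM2l//.
  apply: (@le_trans _ _ (lev tau k ^+ 2 * (100 * 4 ^+ j))).
    by rewrite ler_wpM2l// exprn_ge0// ltW.
  rewrite mulrCA ler_pM2l//.
apply: (@le_trans _ _ (\sum_(k < K) \sum_(j < N) \sum_c (act k j : nat)%:R *
   (10 * (nu c / Num.sqrt (F c)) * Num.min (x c * 2 ^+ k) (x c * 2 ^+ k)^-1))).
  have m0 c k : 0 <= 10 * (nu c / Num.sqrt (F c)) * Num.min (x c * 2 ^+ k) (x c * 2 ^+ k)^-1.
    have x0 : 0 <= x c * 2 ^+ k.
      by rewrite /x !mulr_ge0 ?exprn_ge0 ?invr_ge0 ?mulr_ge0 ?sqrtr_ge0// ltW.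
    rewrite mulr_ge0 ?mulr_ge0 ?divr_ge0 ?sqrtr_ge0// le_min x0 invr_ge0//.
  apply: ler_sum => k _; apply: ler_sum => j _.
  case: (boolP (act k j)) => kj; last by rewrite mul0r sumr_ge0// => c _; rewrite mul0r.
  rewrite mul1r mulr_sumr mulr_suml.
  rewrite big_mkcond/=; apply: ler_sum => c _; rewrite mul1r.
  by case: ifP => cj; [exact: key|exact: m0].
apply: (@le_trans _ _ (\sum_c 80 * (nu c / Num.sqrt (F c)))); last first.
  rewrite -mulr_sumr; have := sum_over_sqrt s nu0; rewrite -/F; lra.
under eq_bigr do rewrite exchange_big/=.
rewrite exchange_big/=; apply: ler_sum => c _.
under eq_bigr do rewrite -mulr_suml.
have n0 : 0 <= nu c / Num.sqrt (F c) by rewrite divr_ge0 ?sqrtr_ge0.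
have [fz|fn] := eqVneq (Num.sqrt (F c)) 0.
  by rewrite fz invr0 !mulr0 big1// => k _; rewrite !mul0r mulr0.
have xp : 0 < x c by rewrite /x divr_gt0 ?mulr_gt0 ?ltr0n// lt_neqAle eq_sym fn sqrtr_ge0.
have min0 k : 0 <= Num.min (x c * 2 ^+ k) (x c * 2 ^+ k)^-1.
  by rewrite le_min invr_ge0 andbb mulr_ge0 ?exprn_ge0// ltW.
apply: (@le_trans _ _ (\sum_(k < K) 20 * (nu c / Num.sqrt (F c)) *
    Num.min (x c * 2 ^+ k) (x c * 2 ^+ k)^-1)).
  apply: ler_sum => k _; rewrite mulrA ler_wpM2r//.
  by have := act2 k; nra.
rewrite -mulr_sumr.
by have := sum_min_geometric K xp; nra.
Qed.

End FiniteSums.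

(** * Smooth functions of one variable and a partition of unity *)

Section Smooth1.
Variable R : realType.
Implicit Types (u v : R -> R).

(** Derivatives are asserted to exist rather than computed, so that closure under the operations is
    an induction on [n] with explicit derivatives. *)
Fixpoint nder (n : nat) u : Prop :=
  if n is n'.+1 then exists2 u' : R -> R, (forall x : R, is_derive x (1 : R) u (u' x)) & nder n' u'
  else True.

Definition smooth1 u := forall n, nder n u.

Lemma nderW n u : nder n.+1 u -> nder n u.
Proof. by elim: n u => [//|n IH] u [u' du nu]; exists u' => //; exact: IH. Qed.

Lemma nder_cst n (c : R) : nder n (fun=> c).
Proof. by elim: n c => [//|n IH] c; exists (fun=> 0) => // x; exact: is_derive_cst. Qed.

Lemma nderD n u v : nder n u -> nder n v -> nder n (fun x => u x + v x).
Proof.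
elim: n u v => [//|n IH] u v [u' du nu] [v' dv nv].
exists (fun x => u' x + v' x) => [x|]; last exact: IH.
exact: (@is_deriveD _ _ _ u v x 1 _ _ (du x) (dv x)).
Qed.

Lemma nderM n u v : nder n u -> nder n v -> nder n (fun x => u x * v x).
Proof.
elim: n u v => [//|n IH] u v nu nv.
case: (nu) => u' du nu'; case: (nv) => v' dv nv'.
exists (fun x => u x * v' x + v x * u' x) => [x|].
  exact: (@is_deriveM _ _ u v x 1 _ _ (du x) (dv x)).
by apply: nderD; apply: IH => //; exact: nderW.
Qed.

Lemma nderZ n c u : nder n u -> nder n (fun x => c * u x).
Proof. by move=> nu; apply: nderM => //; exact: nder_cst. Qed.

Lemma nderB n u v : nder n u -> nder n v -> nder n (fun x => u x - v x).
Proof.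
move=> nu nv; have := nderD nu (nderZ (-1) nv).
by under eq_fun do rewrite mulN1r.
Qed.

Lemma is_derive_affine a b (x : R) : is_derive x (1 : R) (fun x : R => a * x + b) a.
Proof.
have := @is_deriveD _ _ _ (a \*: (id : R -> R)) (cst b) x 1 _ _
  (is_deriveZ a (is_derive_id x 1)) (is_derive_cst b x 1).
by move=> dd; apply: (is_derive_eq dd); rewrite addr0 /GRing.scale/= mulr1.
Qed.

Lemma nder_affine n a b u : nder n u -> nder n (fun x => u (a * x + b)).
Proof.
elim: n u => [//|n IH] u [u' du nu].
exists (fun x => a * u' (a * x + b)) => [x|]; last by apply: nderZ; exact: IH.
rewrite mulrC.
exact: (@is_derive1_comp R u (fun x => a * x + b) x _ _ (du _) (is_derive_affine a b x)).
Qed.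

Lemma nder_id n : nder n id.
Proof.
case: n => [//|n]; exists (fun=> 1); last exact: nder_cst.
by move=> x; exact: is_derive_id.
Qed.

Lemma nderV n u : (forall x, u x != 0) -> nder n u -> nder n (fun x => (u x)^-1).
Proof.
move=> u0; elim: n => [//|n IH] nu; case: (nu) => u' du nu'.
exists (fun x => - u x ^- 2 *: u' x) => [x|]; first exact: (is_deriveV (u0 x) (du x)).
have -> : (fun x => - u x ^- 2 *: u' x) = (fun x => -1 * ((u x)^-1 * (u x)^-1 * u' x)).
  by apply/funext => x; rewrite /GRing.scale/= -exprVn expr2; ring.
apply: nderZ; apply: nderM => //.
by apply: nderM; apply: IH; exact: nderW.
Qed.

(** The classical flat function [exp(-1/x)] with a power of [1/x] in front: the powers make the
    family closed under differentiation up to linear combinations. *)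
Definition flat (k : nat) (x : R) : R := if 0 < x then x^-1 ^+ k * expR (- x^-1) else 0.

Lemma flat_ge0 k x : 0 <= flat k x.
Proof.
rewrite /flat; case: ltP => // x0.
by rewrite mulr_ge0 ?expR_ge0// exprn_ge0// invr_ge0 ltW.
Qed.

(** The Taylor term of order [k + 1] of [exp(1/x)] absorbs one power of [1/x] more than [flat k]
    carries; this gives the derivative at 0. *)
Lemma flat_le k x : 0 <= x -> flat k x <= (k.+1)`!%:R * x.
Proof.
rewrite /flat; case: ltP => [x0 _|_ x0]; last by rewrite mulr_ge0// ler0n.
have xV : 0 < x^-1 by rewrite invr_gt0.
have f0 : 0 < (k.+1)`!%:R :> R by rewrite ltr0n fact_gt0.
rewrite expRN ler_pdivrMr ?expR_gt0//.
have := expR_ge1Dxn k (ltW xV); rewrite -lerBrDl => h.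
have {}h : x^-1 ^+ k.+1 <= expR x^-1 * (k.+1)`!%:R by rewrite -ler_pdivrMr//; lra.
have -> : x^-1 ^+ k = x * x^-1 ^+ k.+1 by rewrite exprS mulrA mulfV ?mul1r// gt_eqF.
by rewrite -mulrA [leRHS]mulrCA ler_pM2l// mulrC.
Qed.

Lemma is_derive_flat k (x : R) : is_derive x (1 : R) (flat k) (- k%:R * flat k.+1 x + flat k.+2 x).
Proof.
have [x0|x0|->] := ltgtP x 0.
- rewrite /flat !ltNge !(ltW x0)/= mulr0 addr0.
  apply: (@near_eq_is_derive _ _ _ (cst 0)).
  near=> y; rewrite /= ltNge ltW//; near: y.
  exact: lt_nbhsl.
- have xn : x != 0 by rewrite gt_eqF.
  have dV : is_derive x 1 (fun y : R => y^-1) (- x ^- 2).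
    have := is_deriveV xn (is_derive_id x (1:R)).
    by move=> dd; apply: (is_derive_eq dd); rewrite /GRing.scale/= mulr1.
  have dX : is_derive x 1 (fun y : R => y^-1 ^+ k) (k%:R * x^-1 ^+ k.-1 * (- x ^- 2)).
    have dd := is_deriveX k dV; rewrite exprfctE in dd.
    by apply: (is_derive_eq dd); rewrite /GRing.scale.
  have dE : is_derive x 1 (fun y : R => expR (- y^-1)) (expR (- x^-1) * x ^- 2).
    have dN : is_derive x 1 (fun y : R => - y^-1) (x ^- 2).
      by have := is_deriveN dV; move=> dd; apply: (is_derive_eq dd); rewrite opprK.
    exact: (@is_derive1_comp _ expR (fun y : R => - y^-1) x _ _ (is_derive_expR _) dN).
  have dd := is_deriveM dX dE.
  suff : is_derive x (1 : R) (fun y => y^-1 ^+ k * expR (- y^-1)) (- k%:R * flat k.+1 x + flat k.+2 x).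
    apply: near_eq_is_derive; near=> y; rewrite /flat ifT//; near: y; exact: lt_nbhsr.
  apply: (is_derive_eq dd).
  rewrite /flat x0 /GRing.scale/= -exprVn.
  by case: (k) => [|k']; rewrite /= ?mul0r ?mulr0 ?expr0 !exprS; ring.
(* At 0 the difference quotient is zero from the left and [flat k.+1 h] from the right, which tends
   to zero by [flat_le]. *)
- rewrite /flat ltxx mulr0 addr0.
  have H : (h^-1 *: ((flat k \o shift 0) (h *: 1) - flat k 0)) @[h --> (0:R)^'] --> (0:R).
    apply/cvgrPdist_le => e e0; near=> h.
    rewrite /= /flat ltxx subr0 sub0r normrN addr0 /GRing.scale/= mulr1.
    case: ltP => h0; last by rewrite mulr0 normr0 ltW.
    have := @flat_le k.+1 h (ltW h0); rewrite /flat h0 exprS -mulrA => hk.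
    rewrite ger0_norm; last by rewrite mulr_ge0 ?invr_ge0 ?ltW// mulr_gt0 ?expR_gt0 ?exprn_gt0 ?invr_gt0.
    apply: le_trans hk _; rewrite -ler_pdivlMl ?ltr0n ?fact_gt0//.
    apply: le_trans (ler_norm _) _.
    near: h; apply: dnbhs0_le; rewrite mulr_gt0// invr_gt0 ltr0n fact_gt0//.
  have Hc : derivable (flat k) 0 1 by apply/cvg_ex; exists 0.
  by apply: DeriveDef => //; rewrite /derive; apply: cvg_lim.
Unshelve. all: by end_near. Qed.

Lemma nder_flat n k : nder n (flat k).
Proof.
elim: n k => [//|n IH] k.
exists (fun x => - k%:R * flat k.+1 x + flat k.+2 x); first exact: is_derive_flat.
by apply: nderD => //; exact: nderZ.
Qed.

Definition step (x : R) : R := flat 0 x / (flat 0 x + flat 0 (-1 * x + 1)).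

Lemma step_den x : 0 < flat 0 x + flat 0 (-1 * x + 1).
Proof.
have f0 y : 0 < y -> 0 < flat 0 y.
  by move=> y0; rewrite /flat y0 expr0 mul1r expR_gt0.
have [x0|x0] := ltP 0 x.
  by rewrite ltr_pwDl ?f0 ?flat_ge0.
by rewrite ltr_wpDl ?flat_ge0// f0//; lra.
Qed.

Lemma smooth1_step : smooth1 step.
Proof.
move=> n; apply: nderM; first exact: nder_flat.
apply: nderV => [x|]; first by rewrite gt_eqF// step_den.
by apply: nderD; [exact: nder_flat|apply: nder_affine; exact: nder_flat].
Qed.

Lemma step_le0 x : x <= 0 -> step x = 0.
Proof. by move=> x0; rewrite /step {1}/flat ltNge x0/= mul0r. Qed.

Lemma step_ge1 x : 1 <= x -> step x = 1.
Proof.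
move=> x1; rewrite /step (_ : flat 0 (-1 * x + 1) = 0) ?addr0.
  by rewrite mulfV// /flat ifT ?expr0 ?mul1r ?gt_eqF ?expR_gt0//; lra.
by rewrite /flat ltNge (_ : _ <= _)//; lra.
Qed.

Lemma step_mono x y : x <= y -> step x <= step y.
Proof.
move=> xy.
have fm a b : a <= b -> flat 0 a <= flat 0 b.
  move=> ab; rewrite /flat !expr0 !mul1r; case: ltP => a0; last by case: ltP; rewrite ?expR_ge0.
  have b0 : 0 < b by lra.
  by rewrite b0 ler_expR lerN2 lef_pV2.
have h1 := fm _ _ xy; have h2 : flat 0 (-1 * y + 1) <= flat 0 (-1 * x + 1) by apply: fm; lra.
rewrite /step ler_pdivrMr ?step_den// mulrAC ler_pdivlMr ?step_den//.
have := flat_ge0 0 x; have := flat_ge0 0 y.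
have := flat_ge0 0 (-1 * x + 1); have := flat_ge0 0 (-1 * y + 1); nra.
Qed.

(** A step minus its translate by one: the integer translates telescope to 1, and the support is
    [[-1, 1]]. *)
Definition hat (x : R) : R := step (1 * x + 1) - step x.

Lemma smooth1_hat : smooth1 hat.
Proof.
by move=> n; apply: nderB; [apply: nder_affine|]; exact: smooth1_step.
Qed.

Lemma hat_ge0 x : 0 <= hat x.
Proof. by rewrite subr_ge0 step_mono//; lra. Qed.

Lemma hat_eq0 x : 1 <= `|x| -> hat x = 0.
Proof.
rewrite /hat ler_normr => /orP[] h.
  by rewrite !step_ge1 ?subrr//; lra.
by rewrite !step_le0 ?subrr//; lra.
Qed.

Lemma hat_sum M x : 0 <= x <= M%:R -> \sum_(a < M.+1) hat (x - a%:R) = 1.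
Proof.
move=> /andP[x0 xM].
have -> : \sum_(a < M.+1) hat (x - a%:R) = step (x + 1) - step (x - M%:R).
  elim: (M) => [|m IH]; first by rewrite big_ord1 /hat subr0 mul1r.
  rewrite big_ord_recr/= IH /hat mul1r.
  have -> : x - m.+1%:R + 1 = x - m%:R by rewrite -natr1; ring.
  by ring.
by rewrite step_ge1 ?step_le0 ?subr0//; lra.
Qed.

Lemma hat_le1 x : hat x <= 1.
Proof.
have s1 y : step y <= 1.
  by have [h|h] := leP 1 y; [rewrite step_ge1|rewrite -(step_ge1 (lexx 1)) step_mono// ltW].
have s0 y : 0 <= step y.
  by have [h|h] := leP y 0; [rewrite step_le0|rewrite -(step_le0 (lexx 0)) step_mono// ltW].
by rewrite /hat; have := s1 (1 * x + 1); have := s0 x; lra.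
Qed.

End Smooth1.

(** * Smooth functions on the plane: tensor products, supports, measurability *)

Section Smooth2.
Variable R : realType.
Notation T := (R * R)%type.
Implicit Types (f g : T -> R) (u v : R -> R) (s : seq 'I_2) (i : 'I_2) (D : set T).

Lemma iter_partialD s f g : smooth f -> smooth g ->
  iter_partial s (fun x => f x + g x) = (fun x => iter_partial s f x + iter_partial s g x).
Proof.
move=> sf sg; elim: s => [//|i s IH] /=; rewrite IH; apply/funext => x.
by rewrite /partial deriveD//; apply: diff_derivable; [exact: sf|exact: sg].
Qed.

Lemma iter_partialZ s (c : R) f : smooth f ->
  iter_partial s (fun x => c * f x) = (fun x => c * iter_partial s f x).
Proof.
move=> sf; elim: s => [//|i s IH] /=; rewrite IH; apply/funext => x.
by rewrite /partial (@deriveZ _ _ _ (iter_partial s f))//; apply: diff_derivable; exact: sf.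
Qed.

Lemma smoothD f g : smooth f -> smooth g -> smooth (fun x => f x + g x).
Proof.
move=> sf sg s x; rewrite iter_partialD//.
by apply: (@differentiableD _ _ _ (iter_partial s f)); [exact: sf|exact: sg].
Qed.

Lemma smoothZ c f : smooth f -> smooth (fun x => c * f x).
Proof.
move=> sf s x; rewrite iter_partialZ//.
by apply: (@differentiableZ _ _ _ (iter_partial s f)); exact: sf.
Qed.

Lemma iter_partial0 s : iter_partial s (fun=> 0 : R) = (fun=> 0).
Proof.
elim: s => [//|i s IH] /=; rewrite IH; apply/funext => x.
exact: (@derive_cst _ _ _ (0 : R)).
Qed.

Lemma smooth0 : smooth (fun=> 0 : R).
Proof. by move=> s x; rewrite iter_partial0; exact: differentiable_cst. Qed.

Lemma smooth_sum (I : Type) (r : seq I) (P : pred I) (F : I -> T -> R) :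
  (forall j, smooth (F j)) -> smooth (fun x => \sum_(j <- r | P j) F j x).
Proof.
move=> sF; elim: r => [|j r IH].
  by under eq_fun do rewrite big_nil; exact: smooth0.
under eq_fun do rewrite big_cons.
by case: (P j) => //; exact: smoothD.
Qed.

Lemma iter_partial_sum s (I : Type) (r : seq I) (P : pred I) (F : I -> T -> R) :
  (forall j, smooth (F j)) ->
  iter_partial s (fun x => \sum_(j <- r | P j) F j x) =
  (fun x => \sum_(j <- r | P j) iter_partial s (F j) x).
Proof.
move=> sF; elim: r => [|j r IH].
  under eq_fun do rewrite big_nil; rewrite iter_partial0.
  by apply/funext => x; rewrite big_nil.
under eq_fun do rewrite big_cons.
under [RHS]eq_fun do rewrite big_cons.
case: (P j) => //; rewrite iter_partialD//; first by rewrite IH.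
exact: smooth_sum.
Qed.

Lemma iter_partial_cat s s' f : iter_partial s (iter_partial s' f) = iter_partial (s ++ s') f.
Proof. by elim: s => [//|i s /= ->]. Qed.

Lemma smooth_iter_partial s f : smooth f -> smooth (iter_partial s f).
Proof. by move=> sf s' x; rewrite iter_partial_cat; exact: sf. Qed.

Lemma smooth1_der u : smooth1 u -> (forall x, derivable u x 1) /\ smooth1 (derive1 u).
Proof.
move=> su; split.
  by move=> x; have [u' du _] := su 1%N; have d := du x; exact: ex_derive.
move=> n; have [u' du nu] := su n.+1.
suff -> : derive1 u = u' by [].
by apply/funext => x; rewrite derive1E; have := du x => dd; rewrite derive_val.
Qed.

Lemma smooth1_dern n u : smooth1 u -> smooth1 (derive1n n u).
Proof. by move=> su; elim: n => [//|n IH]; rewrite derive1nS; have [] := smooth1_der IH. Qed.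

Lemma is_derive_fst u (x : T) i : smooth1 u ->
  is_derive x (dir R i) (fun y : T => u y.1) (if val i == 0%N then derive1 u x.1 else 0).
Proof.
move=> /smooth1_der[du _]; rewrite /dir; case: ifP => _.
  have d := du x.1.
  apply: DeriveDef; first exact: d.
  by rewrite derive1E.
have H : (h^-1 *: (((fun y : T => u y.1) \o shift x) (h *: (0, 1)) - u x.1))
    @[h --> (0:R)^'] --> (0:R).
  apply: cvg_near_cst; near=> h.
  by rewrite /= /GRing.scale /= mulr0 add0r subrr mulr0.
by apply: DeriveDef; [apply/cvg_ex; exists 0|exact: cvg_lim].
Unshelve. all: by end_near. Qed.

Lemma is_derive_snd u (x : T) i : smooth1 u ->
  is_derive x (dir R i) (fun y : T => u y.2) (if val i == 0%N then 0 else derive1 u x.2).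
Proof.
move=> /smooth1_der[du _]; rewrite /dir; case: ifP => _; last first.
  have d := du x.2.
  apply: DeriveDef; first exact: d.
  by rewrite derive1E.
have H : (h^-1 *: (((fun y : T => u y.2) \o shift x) (h *: (1, 0)) - u x.2))
    @[h --> (0:R)^'] --> (0:R).
  apply: cvg_near_cst; near=> h.
  by rewrite /= /GRing.scale /= mulr0 add0r subrr mulr0.
by apply: DeriveDef; [apply/cvg_ex; exists 0|exact: cvg_lim].
Unshelve. all: by end_near. Qed.

(** Every explicit function of the construction is a sum of such products, so that a mixed partial
    reduces to counting directions and to derivatives in one variable. *)
Definition tens u v : T -> R := fun x => u x.1 * v x.2.

Lemma partial_tens u v i : smooth1 u -> smooth1 v ->
  partial i (tens u v) = if val i == 0%N then tens (derive1 u) v else tens u (derive1 v).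
Proof.
move=> su sv; apply/funext => x.
have := is_deriveM (is_derive_fst x i su) (is_derive_snd x i sv) => d.
rewrite /partial (_ : tens u v = (fun y : T => u y.1) * (fun y : T => v y.2))// derive_val.
by case: ifP => _; rewrite /tens /GRing.scale/= ?mulr0 ?add0r ?addr0 // mulrC.
Qed.

Lemma iter_partial_tens s u v : smooth1 u -> smooth1 v ->
  iter_partial s (tens u v) =
  tens (derive1n (count (fun i => val i == 0%N) s) u) (derive1n (count (fun i => val i != 0%N) s) v).
Proof.
move=> su sv; elim: s => [//|i s IH] /=.
rewrite IH partial_tens; [|exact: smooth1_dern|exact: smooth1_dern].
by case: ifP => _; rewrite ?add0n ?add1n derive1nS.
Qed.

Lemma smooth_tens u v : smooth1 u -> smooth1 v -> smooth (tens u v).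
Proof.
move=> su sv s x; rewrite iter_partial_tens//.
move: (smooth1_dern (count (fun i => val i == 0%N) s) su); set a := derive1n _ _ => sa.
move: (smooth1_dern (count (fun i => val i != 0%N) s) sv); set b := derive1n _ _ => sb.
have df w (p : T -> R) (y : T) : smooth1 w -> differentiable p y ->
    differentiable (fun z : T => w (p z)) y.
  move=> /smooth1_der[dw _] dp; apply: (@differentiable_comp _ _ _ _ p w) => //.
  by apply/derivable1_diffP.
apply: (@differentiableM _ _ (fun z : T => a z.1) (fun z : T => b z.2)); apply: df => //.
  apply: (@linear_differentiable R T R (fst : {linear T -> R}) x).
  by move=> z; exact: cvg_fst.
apply: (@linear_differentiable R T R (snd : {linear T -> R}) x).
by move=> z; exact: cvg_snd.
Qed.

Lemma smooth_continuous f : smooth f -> continuous f.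
Proof. by move=> sf x; apply: differentiable_continuous; exact: (sf [::]). Qed.

Lemma hausdorffT : hausdorff_space T.
Proof. exact: norm_hausdorff. Qed.

Lemma iter_partial_support s f (K : set T) : closed K -> (forall x, ~ K x -> f x = 0) ->
  forall x, ~ K x -> iter_partial s f x = 0.
Proof.
move=> cK fK; elim: s => [//|i s IH] /= x Kx.
have /(near_eq_derive (dir R i)) : \near x, iter_partial s f x = (cst 0 : T -> R) x.
  have : nbhs x (~` K) by apply: open_nbhs_nbhs; split => //; exact: closed_openC.
  by apply: filterS => y /IH.
by rewrite /partial => ->; exact: derive_cst.
Qed.

Lemma Cc_inf_iter_partial D s f : Cc_inf D f -> Cc_inf D (iter_partial s f).
Proof.
move=> [sf [K [cK KD Kf]]]; split; first exact: smooth_iter_partial.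
exists K; split => //; apply: iter_partial_support => //.
exact: (compact_closed hausdorffT).
Qed.

Lemma Cc_inf0 D : Cc_inf D (fun=> 0 : R).
Proof.
by split; [exact: smooth0|exists set0; split => //; exact: compact0].
Qed.

Lemma Cc_infD D f g : Cc_inf D f -> Cc_inf D g -> Cc_inf D (fun x => f x + g x).
Proof.
move=> [sf [K [cK KD Kf]]] [sg [K' [cK' KD' Kg]]]; split; first exact: smoothD.
exists (K `|` K'); split; first exact: compactU.
  by move=> x [/KD|/KD'].
by move=> x H; rewrite Kf ?Kg ?addr0// => h; apply: H; [right|left].
Qed.

Lemma Cc_infZ D c f : Cc_inf D f -> Cc_inf D (fun x => c * f x).
Proof.
move=> [sf [K [cK KD Kf]]]; split; first exact: smoothZ.
by exists K; split => // x /Kf ->; rewrite mulr0.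
Qed.

Lemma Cc_infB D f g : Cc_inf D f -> Cc_inf D g -> Cc_inf D (fun x => f x - g x).
Proof.
move=> cf cg; have := Cc_infD cf (Cc_infZ (-1) cg).
by under eq_fun do rewrite mulN1r.
Qed.

Lemma Cc_inf_sum D (I : Type) (r : seq I) (P : pred I) (F : I -> T -> R) :
  (forall j, P j -> Cc_inf D (F j)) -> Cc_inf D (fun x => \sum_(j <- r | P j) F j x).
Proof.
move=> sF; elim: r => [|j r IH].
  by under eq_fun do rewrite big_nil; exact: Cc_inf0.
under eq_fun do rewrite big_cons.
by case: (boolP (P j)) => // Pj; apply: Cc_infD => //; exact: sF.
Qed.

Lemma iter_partialB s f g : smooth f -> smooth g ->
  iter_partial s (fun x => f x - g x) = (fun x => iter_partial s f x - iter_partial s g x).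
Proof.
move=> sf sg; have := iter_partialD s sf (smoothZ (-1) sg).
rewrite iter_partialZ// => H.
have -> : (fun x => f x - g x) = (fun x => f x + -1 * g x).
  by apply/funext => x; rewrite mulN1r.
by rewrite H; apply/funext => x; rewrite mulN1r.
Qed.

Lemma ballT (x y : T) (e : R) : ball x e y <-> `|x.1 - y.1| < e /\ `|x.2 - y.2| < e.
Proof. by []. Qed.

(** The sigma-algebra is that of the product, generated by rectangles: the open set is exhibited as
    a countable union of squares with rational centres and radii [1 / (n + 1)]. *)
Lemma open_measurable2 (U : set T) : open U -> measurable U.
Proof.
move=> oU.
pose B (q : rat * rat * nat) : set T := `]ratr q.1.1 - (q.2.+1%:R)^-1, ratr q.1.1 + (q.2.+1%:R)^-1[%classic `*`
   `]ratr q.1.2 - (q.2.+1%:R)^-1, ratr q.1.2 + (q.2.+1%:R)^-1[%classic.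
pose F q := if pselect (B q `<=` U) then B q else set0.
have -> : U = \bigcup_q F q.
  apply/seteqP; split => [x Ux|x [q _]]; last first.
    by rewrite /F; case: pselect => //= BU /BU.
  have /nbhs_ballP[e /= e0 eU] : nbhs x U by apply: open_nbhs_nbhs.
  have [n ne] : exists n : nat, (n.+1%:R)^-1 < e / 2 :> R.
    exists (Num.truncn (e / 2)^-1); rewrite invf_plt ?posrE ?divr_gt0//.
    exact: truncnS_gt.
  have n0 : 0 < (n.+1%:R)^-1 :> R by rewrite invr_gt0 ltr0n.
  pose r : R := (n.+1%:R)^-1; rewrite -/r in ne n0.
  have i (z : R) : z - r < z + r by lra.
  have [q1 /itvP q1x] := rat_in_itvoo (i x.1).
  have [q2 /itvP q2x] := rat_in_itvoo (i x.2).
  have a1 : x.1 - r < ratr q1 by rewrite q1x.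
  have a2 : ratr q1 < x.1 + r by rewrite q1x.
  have b1 : x.2 - r < ratr q2 by rewrite q2x.
  have b2 : ratr q2 < x.2 + r by rewrite q2x.
  have BU : B (q1, q2, n) `<=` U.
    move=> y [/=]; rewrite -/r !in_itv/= => /andP[y1 y2] /andP[z1 z2].
    by apply: eU; apply/ballT; rewrite !ltr_norml; split; apply/andP; split; lra.
  exists (q1, q2, n) => //; rewrite /F; case: pselect => //= _.
  by split; rewrite /= -/r in_itv/=; apply/andP; split; lra.
apply: countable_bigcupT_measurable => [|q]; first exact: countableP.
rewrite /F; case: pselect => //= _.
by apply: measurableX; exact: measurable_itv.
Qed.

Lemma continuous_measurable2 f D : measurable D -> continuous f -> measurable_fun D f.
Proof.
move=> mD cf; apply: (@measurable_funS _ _ _ _ setT) => //.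
apply: (measurability _ (RGenOInfty.measurableE R)) => //.
move=> _ [_ [x ->] <-]; rewrite setTI.
by apply: open_measurable2; apply: open_comp => [y _|]; [exact: cf|rewrite set_itvoy; exact: open_gt].
Qed.

End Smooth2.

(** * Scale-invariant bounds on derivatives up to order two *)

Section Jets.
Variable R : realType.
Implicit Types (u v : R -> R).

Lemma smooth1_continuous u : smooth1 u -> continuous u.
Proof. by move=> /smooth1_der[du _] x; apply/differentiable_continuous/derivable1_diffP. Qed.

Lemma derive1n_hat_eq0 i (t : R) : 1 <= `|t| -> derive1n i (@hat R) t = 0.
Proof.
have gt1 : forall i (t : R), 1 < `|t| -> derive1n i (@hat R) t = 0.
  elim=> [|{}i IH] {}t t1; first by rewrite derive1n0 hat_eq0// ltW.
  rewrite derive1nS derive1E.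
  have /near_eq_derive -> : \near t, derive1n i (@hat R) t = (cst 0 : R -> R) t.
    have : \forall y \near t, 1 < `|y|.
      apply: (@open_nbhs_nbhs _ t [set y : R | 1 < `|y|]); split => //.
      by apply: (@open_comp _ _ (fun y : R => `|y|) [set z | 1 < z]) => [y _|];
        [exact: norm_continuous|exact: open_gt].
    by apply: filterS => y /IH.
  exact: derive_cst.
(* At [|t| = 1] continuity decides: a nonzero value would persist at [t * (1 + e / 2)], outside the
   support. *)
rewrite le_eqVlt => /predU1P[t1|]; last exact: gt1.
apply/eqP/contraT => nz.
have c := smooth1_continuous (smooth1_dern i (@smooth1_hat R)).
have nn : \forall y \near t, derive1n i (@hat R) y != 0.
  apply: (@open_nbhs_nbhs _ t [set y : R | derive1n i (@hat R) y != 0]); split => //.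
  by apply: (@open_comp _ _ (derive1n i (@hat R)) [set z : R | z != 0]) => [y _|];
    [exact: c|exact: open_neq].
have /nbhs_ballP[e /= e0 eN] := nn.
have := eN (t * (1 + e / 2)) _; rewrite gt1 ?eqxx.
  by move=> H; apply: H; rewrite /ball/= mulrDr mulr1 opprD addNKr normrN normrM -t1 mul1r gtr0_norm; lra.
by rewrite normrM -t1 mul1r gtr0_norm; lra.
Qed.

Lemma hat_derivs : exists H : R, 1 <= H /\
  forall i t, (i <= 2)%N -> `|derive1n i (@hat R) t| <= H.
Proof.
have bnd i : exists M : R, forall t, `|derive1n i (@hat R) t| <= M.
  have c : {within `[-1, 1], continuous (fun t => `|derive1n i (@hat R) t|)}.
    apply: continuous_subspaceT => x; apply: cvg_norm.
    exact: (smooth1_continuous (smooth1_dern i (@smooth1_hat R))).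
  have [|t0 _ tM] := EVT_max _ c; first lra.
  exists `|derive1n i (@hat R) t0| => t; have [|h] := leP 1 `|t|.
    by move=> /derive1n_hat_eq0 ->; rewrite normr0.
  by apply: tM; rewrite in_itv/=; move: h; rewrite ltr_norml => /andP[]; lra.
have [M0 H0] := bnd 0%N; have [M1 H1] := bnd 1%N; have [M2 H2] := bnd 2%N.
exists (1 + M0 + M1 + M2).
have n0 := le_trans (normr_ge0 _) (H0 0); have n1 := le_trans (normr_ge0 _) (H1 0).
have n2 := le_trans (normr_ge0 _) (H2 0).
split; first lra.
by case=> [|[|[|//]]] t _; [apply: le_trans (H0 t) _|apply: le_trans (H1 t) _|
  apply: le_trans (H2 t) _]; lra.
Qed.

Lemma smooth1M u v : smooth1 u -> smooth1 v -> smooth1 (fun x => u x * v x).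
Proof. by move=> su sv n; apply: nderM. Qed.

Lemma smooth1_affine a b u : smooth1 u -> smooth1 (fun x => u (a * x + b)).
Proof. by move=> su n; apply: nder_affine. Qed.

Lemma smooth1_lin a b : smooth1 (fun x : R => a * x + b).
Proof. by move=> n; apply: nderD; [apply: nderZ; exact: nder_id|exact: nder_cst]. Qed.

Lemma derive1n_affine i a b u x : smooth1 u ->
  derive1n i (fun x => u (a * x + b)) x = a ^+ i * derive1n i u (a * x + b).
Proof.
move=> su; elim: i x => [|i IH] x; first by rewrite expr0 mul1r.
rewrite !derive1nS (_ : derive1n i _ = fun x => a ^+ i * derive1n i u (a * x + b)); last exact/funext.
have [du _] := smooth1_der (smooth1_dern i su).
have d := derivableP (du (a * x + b)).
rewrite derive1E.
have D := is_deriveZ (a ^+ i)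
  (@is_derive1_comp R (derive1n i u) (fun x => a * x + b) x _ _ d (is_derive_affine a b x)).
have -> : (fun x0 => a ^+ i * derive1n i u (a * x0 + b)) =
  a ^+ i \*: (derive1n i u \o (fun x0 => a * x0 + b)) by [].
by rewrite derive_val /GRing.scale/= derive1E exprS; ring.
Qed.

(** A C^2 bound at one point, normalised by the length [l] so that it is preserved by products and
    by rescaling. *)
Definition jet u (x l B : R) := forall i, (i <= 2)%N -> `|derive1n i u x| <= B / l ^+ i.

Lemma derive1M u v : smooth1 u -> smooth1 v ->
  derive1 (fun x => u x * v x) = (fun x => u x * derive1 v x + v x * derive1 u x).
Proof.
move=> /smooth1_der[du _] /smooth1_der[dv _]; apply/funext => x; rewrite !derive1E.
by rewrite (deriveM (du x) (dv x)).
Qed.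

Lemma derive1D u v : smooth1 u -> smooth1 v ->
  derive1 (fun x => u x + v x) = (fun x => derive1 u x + derive1 v x).
Proof.
move=> /smooth1_der[du _] /smooth1_der[dv _]; apply/funext => x; rewrite !derive1E.
by rewrite (deriveD (du x) (dv x)).
Qed.

(** Leibniz's rule: the binomial coefficients of order at most two sum to at most 4. *)
Lemma jetM u v x l B B' : smooth1 u -> smooth1 v -> 0 < l -> 
  jet u x l B -> jet v x l B' -> jet (fun x => u x * v x) x l (4 * B * B').
Proof.
move=> su sv l0 ju jv i i2.
have [_ su'] := smooth1_der su; have [_ sv'] := smooth1_der sv.
have u0 := ju 0%N isT; have u1 := ju 1%N isT; have u2 := ju 2%N isT.
have v0 := jv 0%N isT; have v1 := jv 1%N isT; have v2 := jv 2%N isT.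
move: u0 u1 u2 v0 v1 v2; rewrite !derive1nS !derive1n0 expr0 expr1 !divr1.
move=> u0 u1 u2 v0 v1 v2.
have B0 : 0 <= B by apply: le_trans u0.
have B0' : 0 <= B' by apply: le_trans v0.
have pr (a b p q : R) : `|a| <= p -> `|b| <= q -> `|a * b| <= p * q.
  by move=> ap bq; rewrite normrM ler_pM.
have li : 0 < l^-1 by rewrite invr_gt0.
have BB : 0 <= B * B' by rewrite mulr_ge0.
case: i i2 => [|[|[|//]]] _.
- rewrite derive1n0 expr0 divr1; apply: le_trans (pr _ _ _ _ u0 v0) _.
  by move: BB; clear; lra.
- rewrite derive1n1 derive1M// expr1.
  apply: le_trans (le_trans (ler_normD _ _) (lerD (pr _ _ _ _ u0 v1) (pr _ _ _ _ v0 u1))) _.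
  rewrite (_ : _ + _ = 2 * (B * B' / l)); last by ring.
  rewrite (_ : 4 * B * B' / l = 4 * (B * B' / l)); last by ring.
  have : 0 <= B * B' / l by rewrite divr_ge0// ltW.
  by clear; lra.
- rewrite derive1nS derive1n1 derive1M// derive1D; [|exact: smooth1M|exact: smooth1M].
  rewrite derive1M// derive1M//.
  have h1 := pr _ _ _ _ u0 v2; have h2 := pr _ _ _ _ v1 u1.
  have h3 := pr _ _ _ _ v0 u2; have h4 := pr _ _ _ _ u1 v1.
  apply: le_trans (le_trans (ler_normD _ _) (lerD (le_trans (ler_normD _ _) (lerD h1 h2))
    (le_trans (ler_normD _ _) (lerD h3 h4)))) _.
  rewrite le_eqVlt; apply/orP; left; apply/eqP; field.
  by rewrite gt_eqF.
Qed.

Lemma jetW u x l B B' : 0 < l -> B <= B' -> jet u x l B -> jet u x l B'.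
Proof.
move=> l0 BB ju i i2; apply: le_trans (ju i i2) _.
by rewrite ler_pM2r// invr_gt0 exprn_gt0.
Qed.

Lemma jet_lin a b x l B : 0 < l -> `|a * x + b| <= B -> `|a| <= B / l ->
  jet (fun x => a * x + b) x l B.
Proof.
move=> l0 h0 h1 i i2.
have d1 : derive1 (fun x => a * x + b) = cst a.
  by apply/funext => y; rewrite derive1E; have d := is_derive_affine a b y; rewrite derive_val.
case: i i2 => [|[|[|//]]] _.
- by rewrite derive1n0 expr0 divr1.
- by rewrite derive1n1 d1 expr1.
- rewrite derive1nS derive1n1 d1 derive1_cst normr0 divr_ge0 ?exprn_ge0 ?(ltW l0)//.
  exact: le_trans h0.
Qed.

Lemma jet_affine u H l l' b x : smooth1 u -> 0 < l -> l <= l' ->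
  (forall i t, (i <= 2)%N -> `|derive1n i u t| <= H) ->
  jet (fun x => u (l'^-1 * x + b)) x l H.
Proof.
move=> su l0 ll uH i i2; rewrite derive1n_affine// normrM.
have l0' : 0 < l' by exact: lt_le_trans ll.
have H0 : 0 <= H by apply: le_trans (uH 0%N 0 isT).
rewrite mulrC; apply: ler_pM => //; first exact: uH.
rewrite ger0_norm ?exprn_ge0 ?invr_ge0 ?(ltW l0')// exprVn lef_pV2 ?posrE ?exprn_gt0//.
by rewrite lerXn2r// nnegrE ltW.
Qed.

End Jets.

(** * Grid points and their sup-distance *)

Definition dd (p q : nat * nat) : nat := maxn (dn p.1 q.1) (dn p.2 q.2).

Definition grid (N : nat) : finType := ('I_(2 ^ N).+1 * 'I_(2 ^ N).+1)%type.

Definition gp N (c : grid N) : nat * nat := (c.1 : nat, c.2 : nat).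

(** The node of index [a] in the lattice of step [2 ^ j], in mesh units. It may fall outside the
    grid, and so is a pair of naturals. *)
Definition lat N (j : nat) (a : grid N) : nat * nat := (2 ^ j * a.1, 2 ^ j * a.2)%N.

Lemma ddxx p : dd p p = 0%N. Proof. by rewrite /dd /dn; lia. Qed.

Lemma dnC i j : dn i j = dn j i. Proof. exact: maxnC. Qed.

Lemma ddC p q : dd p q = dd q p. Proof. by rewrite /dd dnC (dnC p.2). Qed.

Lemma dn_le i j r : (dn i j <= r)%N = (i <= j + r)%N && (j <= i + r)%N.
Proof. by rewrite /dn; lia. Qed.

Lemma dd_le p q r : (dd p q <= r)%N =
  [&& p.1 <= q.1 + r, q.1 <= p.1 + r, p.2 <= q.2 + r & q.2 <= p.2 + r]%N.
Proof. by rewrite /dd geq_max !dn_le -andbA. Qed.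

Lemma dd_trans p q r : (dd p r <= dd p q + dd q r)%N.
Proof.
have := leqnn (dd p q); have := leqnn (dd q r); rewrite !dd_le; lia.
Qed.

(** * The potential built from the level differences [b] *)

Section Construction.
Variable R : realType.
Notation T := (R * R)%type.
Variables (N K : nat) (o : T) (delta A tau H : R).
Let n := (2 ^ N)%N.
Let G := grid N.
Variables (m : G -> R) (Lam : nat -> pred G) (b : 'I_2 -> nat -> G -> R).
Hypothesis delta0 : 0 < delta.
Hypothesis A0 : 0 < A.
Hypothesis tau0 : 0 < tau.
Hypothesis m0 : forall p, 0 <= m p.
Hypothesis H1 : 1 <= H.
Hypothesis hatH : forall i t, (i <= 2)%N -> `|derive1n i (@hat R) t| <= H.
Hypothesis Lam_m : forall k p, Lam k p -> lev tau k < m p.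
Hypothesis Lam_in : forall k p, Lam k p -> (0 < p.1 < n)%N /\ (0 < p.2 < n)%N.
Hypothesis b_out : forall i k p, ~~ Lam k p -> b i k p = 0.
Hypothesis b_lip : forall i k p q, `|b i k p - b i k q| <= 6 * A * lev tau k * (dd (gp p) (gp q))%:R.

Let nu c := m c ^+ 2.
Let nu0 c : 0 <= nu c. Proof. exact: sqr_ge0. Qed.

Let coef_ge0 k : 0 <= 6 * A * lev tau k.
Proof. by rewrite !mulr_ge0// ltW// lev_gt0. Qed.

Definition scale (j : nat) : R := delta * 2 ^+ j.

Lemma scale_gt0 j : 0 < scale j.
Proof. by rewrite mulr_gt0// exprn_gt0. Qed.

Definition bump1 (c l : R) (a : nat) (x : R) : R := hat (l^-1 * x + (- (c / l) - a%:R)).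

Definition weight (c : R) (j a a' : nat) (x : R) : R :=
  bump1 c (scale j) a x * bump1 c (scale j.+1) a' x.

(* A dyadic square of side [2^j] is used at level [k] when it is [good] and its neighbour [a'] of side [2^(j+1)] is not: these pairs play the role of Whitney squares of [Lam k]. *)
Definition good k j (a : G) : bool :=
  [&& 2 ^ j * a.1 <= n, 2 ^ j * a.2 <= n &
      [forall q : G, (dd (gp q) (lat j a) <= 10 * 2 ^ j) ==> Lam k q]]%N.

Definition cball j (a : G) : pred G := fun c => (dd (gp c) (lat j a) <= 8 * 2 ^ j)%N.

Definition coord (T' : Type) (i : 'I_2) (x : T' * T') : T' := if val i == 0%N then x.1 else x.2.

Definition slope i k j a : R :=
  (\sum_(c | cball j a c) nu c * b i k c) / \sum_(c | cball j a c) nu c.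

Definition offset i k j a : R :=
  (\sum_(c | cball j a c) nu c * b i k c * (coord i o + delta * (coord i (gp c))%:R)) /
  \sum_(c | cball j a c) nu c.

(** The share of one coordinate in the affine function [sum_c mu_c <b(c), x - c>]: it depends on
    that coordinate alone, which keeps each term of the potential a sum of two tensor products. *)
Definition linpart i k j a (x : R) : R := slope i k j a * x + - offset i k j a.

Definition term k j (a a' : G) : T -> R := fun x =>
  tens (fun t => weight o.1 j a.1 a'.1 t * linpart ord0 k j a t) (weight o.2 j a.2 a'.2) x +
  tens (weight o.1 j a.1 a'.1) (fun t => weight o.2 j a.2 a'.2 t * linpart ord_max k j a t) x.

Definition potential : T -> R := fun x =>
  \sum_(k < K) \sum_(j < N) \sum_(a : G | good k j a) \sum_(a' : G | ~~ good k j.+1 a')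
    term k j a a' x.

Lemma smooth1_bump1 c l a : smooth1 (bump1 c l a).
Proof. by apply: smooth1_affine; exact: smooth1_hat. Qed.

Lemma smooth1_weight c j a a' : smooth1 (weight c j a a').
Proof. by apply: smooth1M; exact: smooth1_bump1. Qed.

Lemma smooth1_linpart i k j a : smooth1 (linpart i k j a).
Proof. exact: smooth1_lin. Qed.

Lemma smooth_term k j a a' : smooth (term k j a a').
Proof.
have sw := smooth1_weight; have sl := smooth1_linpart.
by apply: smoothD; apply: smooth_tens => //; exact: smooth1M.
Qed.

Lemma iter_partial_potential s : iter_partial s potential = fun x =>
  \sum_(k < K) \sum_(j < N) \sum_(a : G | good k j a) \sum_(a' : G | ~~ good k j.+1 a')
    iter_partial s (term k j a a') x.
Proof.
have st := smooth_term.
rewrite iter_partial_sum; last by move=> k; do 3![apply: smooth_sum => ?].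
apply/funext => x; apply: eq_bigr => k _.
rewrite iter_partial_sum; last by move=> j; do 2![apply: smooth_sum => ?].
apply: eq_bigr => j _.
rewrite iter_partial_sum; last by move=> a; apply: smooth_sum => ?.
by apply: eq_bigr => a _; rewrite iter_partial_sum.
Qed.

(** The edges of the grid carry no point of [Lam k], so the neighbourhood of a good square cannot
    reach them; the balls about its node are therefore never clipped. *)
Lemma good_interior k j a : good k j a ->
  (10 * 2 ^ j < 2 ^ j * a.1 < n - 10 * 2 ^ j)%N /\ (10 * 2 ^ j < 2 ^ j * a.2 < n - 10 * 2 ^ j)%N.
Proof.
case/and3P=> a1 a2 /forallP gq.
have l1 : (2 ^ j * a.1 < n.+1)%N by rewrite ltnS.
have l2 : (2 ^ j * a.2 < n.+1)%N by rewrite ltnS.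
have col (c : 'I_n.+1) : (dn c (2 ^ j * a.1) <= 10 * 2 ^ j)%N -> (0 < c < n)%N.
  move=> h; have := gq (c, Ordinal l2); rewrite (_ : (_ <= _)%N).
    by rewrite implyTb => /Lam_in[].
  by rewrite /dd /gp /lat/= geq_max h /dn subnn.
have row (c : 'I_n.+1) : (dn c (2 ^ j * a.2) <= 10 * 2 ^ j)%N -> (0 < c < n)%N.
  move=> h; have := gq (Ordinal l1, c); rewrite (_ : (_ <= _)%N).
    by rewrite implyTb => /Lam_in[].
  by rewrite /dd /gp /lat/= geq_max h /dn subnn.
have c0 := col ord0; have c1 := col ord_max; have r0 := row ord0; have r1 := row ord_max.
move: a1 a2 c0 c1 r0 r1; rewrite !dn_le /=; clear; lia.
Qed.

(** * Estimates at a point [x] of the cell of [p] *)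

Section AtPoint.
Variables (x : T) (p : G).
Let X i := (coord i x - coord i o) / delta.
Hypothesis px : forall i, (coord i (gp p))%:R <= X i < (coord i (gp p))%:R + 1.

Definition near1 (i : 'I_2) j (a : nat) : bool := `|X i / 2 ^+ j - a%:R| < 1.
Definition near2 j (a : G) : bool := near1 ord0 j a.1 && near1 ord_max j a.2.

Lemma bump1E i j a : bump1 (coord i o) (scale j) a (coord i x) = hat (X i / 2 ^+ j - a%:R).
Proof.
rewrite /bump1 /scale /X; congr hat.
have e0 : 2 ^+ j != 0 :> R by rewrite expf_neq0.
have d0 : delta != 0 by rewrite gt_eqF.
move: e0; set e := 2 ^+ j => e0; by field; rewrite e0.
Qed.

Lemma near1_dn i j a : near1 i j a -> (dn (coord i (gp p)) (2 ^ j * a) <= 2 ^ j)%N.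
Proof.
rewrite /near1 => na; have /andP[h1 h2] := px i.
have e0 : 0 < 2 ^+ j :> R by rewrite exprn_gt0.
move: na; rewrite -(ltr_pM2r e0) mul1r -[X in _ * X]gtr0_norm// -normrM mulrBl.
rewrite divfK ?gt_eqF// ltr_norml => /andP[n1 n2].
have q1 : (coord i (gp p))%:R < (2 ^ j * a + 2 ^ j)%N%:R :> R.
  by rewrite natrD natrM natrX; lra.
have q2 : (2 ^ j * a)%N%:R < (coord i (gp p) + 1 + 2 ^ j)%N%:R :> R.
  by rewrite !natrD natrM natrX; lra.
by move: q1 q2; rewrite !ltr_nat dn_le; clear; lia.
Qed.

Hypothesis xn : forall i, X i <= n%:R.

Lemma near1_le i j a : (j <= N)%N -> near1 i j a -> (2 ^ j * a <= n)%N.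
Proof.
rewrite /near1 => jN na.
have e0 : 0 < 2 ^+ j :> R by rewrite exprn_gt0.
move: na; rewrite -(ltr_pM2r e0) mul1r -[X in _ * X]gtr0_norm// -normrM mulrBl.
rewrite divfK ?gt_eqF// ltr_norml => /andP[n1 _].
have : (2 ^ j * a)%N%:R < (n + 2 ^ j)%N%:R :> R.
  by rewrite natrD natrM natrX; have := xn i; lra.
rewrite ltr_nat /n (_ : 2 ^ N = 2 ^ j * 2 ^ (N - j))%N; last by rewrite -expnD subnKC.
by rewrite -mulnSr ltn_pmul2l ?leq_pmul2l ?expn_gt0.
Qed.

Lemma near2_dd j a : near2 j a -> (dd (gp p) (lat j a) <= 2 ^ j)%N.
Proof.
move=> /andP[/near1_dn h1 /near1_dn h2].
by move: h1 h2; rewrite dd_le !dn_le /coord/=; lia.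
Qed.

Lemma sum_near1 i j : \sum_(a < n.+1) ind (near1 i j a) <= 2 :> R.
Proof.
set t := X i / 2 ^+ j.
have t0 : 0 <= t.
  have /andP[h _] := px i; rewrite divr_ge0 ?exprn_ge0//; exact: le_trans h.
pose f := Num.truncn t.
have /andP[f1 f2] : f%:R <= t < f.+1%:R by rewrite /f; have /andP[-> ->] := truncn_itv t0.
have one (e : nat) : \sum_(a < n.+1) ind (nat_of_ord a == e) <= 1 :> R.
  have [le|gt] := ltnP e n.+1.
    rewrite (bigD1 (Ordinal le))//= eqxx big1 ?addr0// => a ane.
    by case: eqP => // ae; case/eqP: ane; apply/val_inj.
  by rewrite big1// => a _; case: eqP => // ae; have := ltn_ord a; rewrite ae ltnNge gt.
apply: (@le_trans _ _ (\sum_(a < n.+1) ind (nat_of_ord a == f) + \sum_(a < n.+1) ind (nat_of_ord a == f.+1))).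
  rewrite -big_split/=; apply: ler_sum => a _.
  rewrite /near1 -/t; case: ltP => /= na; last by rewrite addr_ge0.
  move: na; rewrite ltr_norml => /andP[n1 n2].
  have : f%:R < (a + 1)%N%:R :> R by rewrite natrD; lra.
  have : a%:R < (f.+1 + 1)%N%:R :> R by rewrite natrD; lra.
  rewrite !ltr_nat => g1 g2.
  have : (nat_of_ord a == f) || (nat_of_ord a == f.+1) by move: g1 g2; clear; lia.
  by case/orP => -> /=; case: (_ == _); rewrite /= ?addr0 ?add0r ?lerDl ?lerDr.
by apply: le_trans (lerD (one f) (one f.+1)) _; lra.
Qed.

Lemma sum_near2 j : \sum_(a : G) ind (near2 j a) <= 4 :> R.
Proof.
have -> : \sum_(a : G) ind (near2 j a) =
   (\sum_(a < n.+1) ind (near1 ord0 j a)) * (\sum_(a < n.+1) ind (near1 ord_max j a)) :> R.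
  rewrite big_distrlr/= pair_bigA/=; apply: eq_bigr => a _.
  by rewrite /near2; do 2!case: (near1 _ _ _); rewrite ?mulr0 ?mulr1.
rewrite (_ : 4 = 2 * 2 :> R); last by ring.
by apply: ler_pM; rewrite ?sum_near1 ?sumr_ge0.
Qed.

Definition chi j (a : G) : R :=
  hat (X ord0 / 2 ^+ j - (a.1 : nat)%:R) * hat (X ord_max / 2 ^+ j - (a.2 : nat)%:R).

Lemma chi_ge0 j a : 0 <= chi j a.
Proof. by rewrite mulr_ge0// hat_ge0. Qed.

Lemma chi_out j a : ~~ near2 j a -> chi j a = 0.
Proof.
by rewrite /near2 negb_and -!leNgt /chi => /orP[] h; rewrite (hat_eq0 h) ?mul0r ?mulr0.
Qed.

Lemma chi_sum j : \sum_(a : G) chi j a = 1.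
Proof.
have hs i : \sum_(a < n.+1) hat (X i / 2 ^+ j - a%:R) = 1.
  have /andP[h _] := px i.
  have e1 : 1 <= 2 ^+ j :> R by apply: exprn_ege1; lra.
  apply: hat_sum; apply/andP; split.
    by rewrite divr_ge0 ?exprn_ge0//; exact: le_trans h.
  rewrite ler_pdivrMr ?exprn_gt0//; apply: le_trans (xn i) _.
  by rewrite ler_peMr.
have <- : (\sum_(a < n.+1) hat (X ord0 / 2 ^+ j - a%:R)) *
          (\sum_(a < n.+1) hat (X ord_max / 2 ^+ j - a%:R)) = 1.
  by rewrite !hs mulr1.
by rewrite big_distrlr/= pair_bigA.
Qed.

Definition act k j a a' : bool := [&& good k j a, ~~ good k j.+1 a', near2 j a & near2 j.+1 a'].

Lemma good_near k j a q : good k j a -> near2 j a ->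
  (dd (gp q) (gp p) <= 9 * 2 ^ j)%N -> Lam k q.
Proof.
move=> /and3P[_ _ /forallP /(_ q) /implyP ga] /near2_dd na qp; apply: ga.
by have := dd_trans (gp q) (gp p) (lat j a); lia.
Qed.

Lemma bad_near k j a : (j <= N)%N -> ~~ good k j a -> near2 j a ->
  exists2 q, ~~ Lam k q & (dd (gp q) (gp p) <= 11 * 2 ^ j)%N.
Proof.
move=> jN + na; have nd := near2_dd na.
move: na => /andP[na1 na2].
rewrite /good !(near1_le jN na1) !(near1_le jN na2)/= => /forallPn[q].
rewrite negb_imply => /andP[qa Lq]; exists q => //.
by have := dd_trans (gp q) (lat j a) (gp p); rewrite (ddC (lat j a)); lia.
Qed.

(** Around [x], the neighbourhood of a square of scale [j] reaches at most [11 * 2 ^ j], while a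
    good square of scale [j + 1] guarantees [Lam k] up to [18 * 2 ^ j]. *)
Lemma good_finer k j a a' : (j < N)%N -> good k j.+1 a' -> near2 j.+1 a' -> near2 j a ->
  good k j a.
Proof.
move=> jN ga na' na; have nd := near2_dd na.
case/andP: (na) => na1 na2.
apply/and3P; split; [exact: near1_le (ltnW jN) na1|exact: near1_le (ltnW jN) na2|].
apply/forallP => q; apply/implyP => qa; apply: (good_near ga na').
by move: (dd_trans (gp q) (lat j a) (gp p)) qa nd; rewrite (ddC (lat j a)) expnS; clear; lia.
Qed.

Lemma bad_coarsest k a : ~~ good k N a.
Proof.
apply/negP => /and3P[a1 a2 /forallP ga].
have := ga (ord0, ord0); rewrite (_ : (_ <= _)%N).
  by rewrite implyTb => /Lam_in[/andP[] //=].
by move: a1 a2; rewrite dd_le /lat /gp /n/=; lia.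
Qed.

Definition goodsum k j : R := \sum_(a : G | good k j a) chi j a.

(** If some square of scale [j + 1] near [x] is good, all those of scale [j] near [x] are good and
    their weights sum to 1; otherwise the sum at scale [j + 1] is 0. This turns
    [goodsum j * (1 - goodsum j.+1)] into a difference. *)
Lemma goodsum_prod k j : (j < N)%N -> goodsum k j * goodsum k j.+1 = goodsum k j.+1.
Proof.
move=> jN; have [/existsP[a' /andP[ga' na']]|] := boolP [exists a', good k j.+1 a' && near2 j.+1 a'].
  suff -> : goodsum k j = 1 by rewrite mul1r.
  rewrite -(chi_sum j) /goodsum [RHS](bigID (good k j))/= [X in _ + X]big1 ?addr0// => a ga.
  by apply: chi_out; apply: contra ga; exact: good_finer ga' na'.
rewrite negb_exists => /forallP h.
have -> : goodsum k j.+1 = 0; last by rewrite mulr0.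
by apply: big1 => a ga; apply: chi_out; have := h a; rewrite ga.
Qed.

(** The sum telescopes in [j], and no square of the coarsest scale is good. What remains is 1 unless
    a square of the finest scale near [x] fails to be good. *)
Lemma sum_weights k : \sum_(j < N) \sum_(a : G | good k j a) \sum_(a' : G | ~~ good k j.+1 a')
   chi j a * chi j.+1 a' = goodsum k 0.
Proof.
have -> : \sum_(j < N) \sum_(a : G | good k j a) \sum_(a' : G | ~~ good k j.+1 a')
   chi j a * chi j.+1 a' = \sum_(j < N) (goodsum k j - goodsum k j.+1).
  apply: eq_bigr => j _; rewrite -(goodsum_prod k (ltn_ord j)).
  have -> : goodsum k j - goodsum k j * goodsum k j.+1 = goodsum k j * (1 - goodsum k j.+1) by ring.
  have E : \sum_(a' : G | ~~ good k j.+1 a') chi j.+1 a' = 1 - goodsum k j.+1.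
    by have := chi_sum j.+1; rewrite (bigID (good k j.+1))/= -/(goodsum k j.+1) => <-; ring.
  rewrite -E /goodsum mulr_suml.
  by apply: eq_bigr => a _; rewrite mulr_sumr.
rewrite -(big_mkord xpredT (fun j => goodsum k j - goodsum k j.+1)).
under eq_bigr do rewrite -opprB; rewrite sumrN telescope_sumr// opprB.
rewrite [X in _ - X](_ : _ = 0) ?subr0//.
by apply: big1 => a; rewrite (negbTE (bad_coarsest k a)).
Qed.

Definition actj k j : bool := [exists a : G, exists a' : G, act k j a a'].

(** An active scale [j'] puts a point outside [Lam k] within [22 * 2 ^ j'] of [p], whereas an active
    scale [j] fills [Lam k] up to [9 * 2 ^ j]: so [j >= j' + 2] is impossible, and each level has at
    most two active scales. *)
Lemma actj_close k j j' : (j < N)%N -> (j' < N)%N -> actj k j -> actj k j' -> (j <= j'.+1)%N.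
Proof.
move=> jN j'N /existsP[a /existsP[a' /and4P[ga _ na _]]] /existsP[c /existsP[c' /and4P[_ bc' _ nc']]].
have [q Lq qp] := bad_near j'N bc' nc'.
rewrite leqNgt; apply/negP => jj.
suff : Lam k q by apply/negP.
apply: (good_near ga na); apply: leq_trans qp _.
rewrite -(subnKC jj) expnD expnS.
have : (0 < 2 ^ (j - j'.+2))%N by rewrite expn_gt0.
have : (0 < 2 ^ j')%N by rewrite expn_gt0.
rewrite !expnS; clear; nia.
Qed.

Lemma actj_count k : \sum_(j < N) ind (actj k j) <= 2 :> R.
Proof.
have [/existsP[j1 a1]|] := boolP [exists j : 'I_N, actj k j]; last first.
  rewrite negb_exists => /forallP h; rewrite big1// => j _.
  by rewrite (negbTE (h j)).
have exj : exists j, (j < N)%N && actj k j by exists j1; rewrite ltn_ord.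
case: (ex_minnP exj) => j0 /andP[j0N aj0] jmin.
have one (e : nat) : \sum_(j < N) ind (nat_of_ord j == e) <= 1 :> R.
  have [le|gt] := ltnP e N.
    rewrite (bigD1 (Ordinal le))//= eqxx big1 ?addr0// => j jne.
    by case: eqP => // je; case/eqP: jne; apply/val_inj.
  by rewrite big1// => j _; case: eqP => // je; have := ltn_ord j; rewrite je ltnNge gt.
apply: (@le_trans _ _ (\sum_(j < N) ind (nat_of_ord j == j0) + \sum_(j < N) ind (nat_of_ord j == j0.+1))).
  rewrite -big_split/=; apply: ler_sum => j _.
  case: (boolP (actj k j)) => /= aj; last by rewrite addr_ge0.
  have j1' := actj_close (ltn_ord j) j0N aj aj0.
  have j2' : (j0 <= j)%N by apply: jmin; rewrite ltn_ord.
  have : (nat_of_ord j == j0) || (nat_of_ord j == j0.+1) by lia.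
  by case/orP => -> /=; case: (_ == _); rewrite /= ?addr0 ?add0r ?lerDl ?lerDr.
by apply: le_trans (lerD (one j0) (one j0.+1)) _; lra.
Qed.

Definition pdist (c : G) : nat := dd (gp c) (gp p).

(** [b] vanishes at a point within [22 * 2 ^ j] of [p], which is within [2 ^ j] of the node, itself
    within [8 * 2 ^ j] of [c]: the Lipschitz constant [6 A t_k] is multiplied by 31. *)
Lemma act_b k j a a' i c : (j < N)%N -> act k j a a' -> cball j a c ->
  `|b i k c| <= 186 * A * lev tau k * 2 ^+ j.
Proof.
move=> jN /and4P[ga ba' na na'] ca.
have [q Lq qp] := bad_near jN ba' na'.
have := b_lip i k c q; rewrite (b_out i Lq) subr0 => /le_trans; apply.
have -> : 186 * A * lev tau k * 2 ^+ j = 6 * A * lev tau k * (31 * 2 ^+ j) by ring.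
rewrite ler_wpM2l ?coef_ge0//.
rewrite -natrX -(natrM _ 31) ler_nat.
move: (dd_trans (gp c) (lat j a) (gp q)) (dd_trans (lat j a) (gp p) (gp q)) (near2_dd na).
rewrite (ddC (lat j a) (gp p)) (ddC (gp p) (gp q)).
by move: qp ca; rewrite /cball expnS; clear; lia.
Qed.

(** The ball of a good square lies in [Lam k], where [m] exceeds the level, and it contains a full
    block of [2 ^ j] by [2 ^ j] grid points. *)
Lemma act_mass k j a a' : (j < N)%N -> act k j a a' ->
  lev tau k ^+ 2 * 4 ^+ j <= \sum_(c | cball j a c) nu c.
Proof.
move=> jN /and4P[ga _ na _].
case/and3P: (ga) => a1 a2 /forallP gq.
(* Half-open, so as to count exactly [2 ^ j] indices. *)
pose I1 (z : nat) (c : nat) := (z - 2 ^ j <= c < z)%N.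
have cnt z : (2 ^ j <= z <= n)%N -> 2 ^+ j <= \sum_(c < n.+1) ind (I1 z c) :> R.
  move=> /andP[z1 z2].
  rewrite -(big_mkord xpredT (fun c => ind (I1 z c))).
  have z3 : (z - 2 ^ j <= n.+1)%N by lia.
  rewrite (@big_cat_nat _ _ _ (z - 2 ^ j)%N)//=.
  rewrite [X in _ + X](@big_cat_nat _ _ _ z)/=; [|lia|exact: leqW].
  rewrite ler_wpDl ?sumr_ge0// ler_wpDr ?sumr_ge0//.
  rewrite (@eq_big_nat _ _ _ _ _ _ (fun=> 1)); last by move=> c cz; rewrite /I1 cz.
  rewrite big_const_nat iter_addr addr0 -natrX.
  by rewrite (_ : (z - (z - 2 ^ j) = 2 ^ j)%N)//; lia.
have [/andP[b1 _] /andP[b2 _]] := good_interior ga.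
have bb : 4 ^+ j <= \sum_(c : G) ind (I1 (2 ^ j * a.1)%N c.1 && I1 (2 ^ j * a.2)%N c.2) :> R.
  have -> : \sum_(c : G) ind (I1 (2 ^ j * a.1)%N c.1 && I1 (2 ^ j * a.2)%N c.2) =
     (\sum_(c < n.+1) ind (I1 (2 ^ j * a.1)%N c)) * (\sum_(c < n.+1) ind (I1 (2 ^ j * a.2)%N c)) :> R.
    rewrite big_distrlr/= pair_bigA/=; apply: eq_bigr => c _.
    by do 2!case: (I1 _ _); rewrite ?mulr0 ?mulr1.
  rewrite (_ : 4 = 2 * 2 :> R) ?exprMn; last by ring.
  apply: ler_pM; rewrite ?exprn_ge0//; apply: cnt; apply/andP; split => //.
    by move: b1; clear; lia.
  by move: b2; clear; lia.
apply: (@le_trans _ _ (lev tau k ^+ 2 * \sum_(c : G) ind (I1 (2 ^ j * a.1)%N c.1 && I1 (2 ^ j * a.2)%N c.2))).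
  by rewrite ler_wpM2l ?sqr_ge0.
rewrite mulr_sumr [leRHS]big_mkcond/=; apply: ler_sum => c _.
case: (boolP (_ && _)) => [/andP[]|_]; last by rewrite mulr0; case: ifP.
rewrite /I1 => i1 i2; rewrite mulr1.
have cb : cball j a c by rewrite /cball dd_le /lat /gp/=; lia.
rewrite cb /nu lerXn2r// ?nnegrE ?(ltW (lev_gt0 _ tau0))// ltW//.
apply: Lam_m; move: (gq c) => /implyP; apply; move: cb; rewrite /cball; lia.
Qed.

Lemma act_pdist k j a a' c : act k j a a' -> cball j a c -> (pdist c <= 9 * 2 ^ j)%N.
Proof.
move=> /and4P[_ _ na _]; have := near2_dd na; rewrite /cball /pdist.
by have := dd_trans (gp c) (lat j a) (gp p); rewrite (ddC (lat j a)); lia.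
Qed.

Definition avgdist j a : R :=
  (\sum_(c | cball j a c) (pdist c).+1%:R * nu c) / \sum_(c | cball j a c) nu c.

(** The ball about the node is replaced by a ball about [p], so that all the squares and levels at
    [x] are compared with one and the same cumulative mass. *)
Lemma act_avgdist k j a a' : (j < N)%N -> act k j a a' ->
  avgdist j a <= 2 * ((\sum_(c | (pdist c <= 9 * 2 ^ j)%N) (pdist c).+1%:R * nu c) /
     \sum_(c | (pdist c <= 9 * 2 ^ j)%N) nu c) /\
  lev tau k ^+ 2 * 4 ^+ j <= \sum_(c | (pdist c <= 9 * 2 ^ j)%N) nu c.
Proof.
move=> jN ac; have mass := act_mass jN ac.
have sub c : cball j a c -> (pdist c <= 9 * 2 ^ j)%N by exact: act_pdist ac.
have M0 : 0 < lev tau k ^+ 2 * 4 ^+ j by rewrite mulr_gt0 ?exprn_gt0 ?lev_gt0.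
have V0 : 0 < \sum_(c | cball j a c) nu c by exact: lt_le_trans mass.
have VO : \sum_(c | cball j a c) nu c <= \sum_(c | (pdist c <= 9 * 2 ^ j)%N) nu c.
  rewrite big_mkcond [leRHS]big_mkcond/=; apply: ler_sum => c _.
  by case: ifP => [/sub -> //|_]; case: ifP.
split; last exact: le_trans VO.
have O0 : 0 < \sum_(c | (pdist c <= 9 * 2 ^ j)%N) nu c by exact: lt_le_trans VO.
rewrite /avgdist ler_pdivrMr// mulrA mulrAC ler_pdivlMr//.
case/and4P: (ac) => _ _ na _; have nd := near2_dd na.
(* In the ball about the node [pdist + 1 <= 9 * 2 ^ j + 1 <= 10 * 2 ^ j]; outside it [pdist] is at
   least [7 * 2 ^ j], more than half of that. *)
apply: (average_enlarge (S := 10 * 2 ^+ j)) => //.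
- move=> c /sub h; rewrite -natrX -(natrM _ 10) ler_nat.
  have e0 : (0 < 2 ^ j)%N by rewrite expn_gt0.
  by move: h e0; clear; lia.
- move=> c _; rewrite /cball -ltnNge => h.
  rewrite (_ : 10 * 2 ^+ j / 2 = 5 * 2 ^+ j); last by field.
  rewrite -natrX -(natrM _ 5) ler_nat /pdist.
  by move: (dd_trans (gp c) (gp p) (lat j a)) h nd; clear; lia.
Qed.

Lemma pdist_coord i c : `|X i - (coord i (gp c))%:R| <= (pdist c).+1%:R.
Proof.
have /andP[h1 h2] := px i.
have : (dn (coord i (gp c)) (coord i (gp p)) <= pdist c)%N.
  by rewrite /pdist /dd /coord; case: ifP => _; rewrite leq_max leqnn ?orbT.
rewrite dn_le => /andP[h3 h4]; rewrite ler_norml.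
have e1 : (coord i (gp c))%:R <= (coord i (gp p) + pdist c)%N%:R :> R by rewrite ler_nat; lia.
have e2 : (coord i (gp p))%:R <= (coord i (gp c) + pdist c)%N%:R :> R by rewrite ler_nat; lia.
rewrite -natr1; move: e1 e2; rewrite !natrD; lra.
Qed.

Lemma linpartE i k j a : linpart i k j a (coord i x) =
  delta * ((\sum_(c | cball j a c) nu c * b i k c * (X i - (coord i (gp c))%:R)) /
     \sum_(c | cball j a c) nu c).
Proof.
rewrite /linpart /slope /offset mulrAC -mulrBl mulrA; congr (_ / _).
rewrite mulr_suml -sumrB mulr_sumr; apply: eq_bigr => c _.
rewrite -mulrBr mulrCA; congr (_ * _).
rewrite /X mulrBr mulrCA mulfV ?gt_eqF// mulr1; ring.
Qed.

Lemma act_linpart i k j a a' : (j < N)%N -> act k j a a' ->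
  `|linpart i k j a (coord i x)| <= 186 * A * lev tau k * scale j * avgdist j a.
Proof.
move=> jN ac; have mass := act_mass jN ac.
have M0 : 0 < lev tau k ^+ 2 * 4 ^+ j by rewrite mulr_gt0 ?exprn_gt0 ?lev_gt0.
have V0 : 0 < \sum_(c | cball j a c) nu c by exact: lt_le_trans mass.
rewrite linpartE normrM gtr0_norm// /scale normrM (gtr0_norm (x := _^-1)) ?invr_gt0//.
rewrite /avgdist (_ : 186 * A * lev tau k * (delta * 2 ^+ j) *
  ((\sum_(c | cball j a c) (pdist c).+1%:R * nu c) / \sum_(c | cball j a c) nu c) =
  delta * ((186 * A * lev tau k * 2 ^+ j * (\sum_(c | cball j a c) (pdist c).+1%:R * nu c)) /
     \sum_(c | cball j a c) nu c)); last by ring.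
rewrite ler_pM2l// ler_pM2r ?invr_gt0//.
apply: le_trans (ler_norm_sum _ _ _) _; rewrite mulr_sumr; apply: ler_sum => c ca.
rewrite normrM [`|nu c * _|]normrM (ger0_norm (nu0 c)) -mulrA mulrC mulrA ler_wpM2r//.
by apply: ler_pM => //; [exact: act_b ac ca|exact: pdist_coord].
Qed.

Lemma act_slope i k j a a' : (j < N)%N -> act k j a a' ->
  `|slope i k j a - b i k p| <= 6 * A * lev tau k * avgdist j a.
Proof.
move=> jN ac; have mass := act_mass jN ac.
have M0 : 0 < lev tau k ^+ 2 * 4 ^+ j by rewrite mulr_gt0 ?exprn_gt0 ?lev_gt0.
have V0 : 0 < \sum_(c | cball j a c) nu c by exact: lt_le_trans mass.
have -> : slope i k j a - b i k p =
   (\sum_(c | cball j a c) nu c * (b i k c - b i k p)) / \sum_(c | cball j a c) nu c.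
  rewrite /slope -[b i k p in LHS](mulfK (lt0r_neq0 V0)) -mulrBl; congr (_ / _).
  rewrite mulr_sumr -sumrB; apply: eq_bigr => c _; ring.
rewrite normrM (gtr0_norm (x := _^-1)) ?invr_gt0// /avgdist mulrA ler_pM2r ?invr_gt0//.
apply: le_trans (ler_norm_sum _ _ _) _; rewrite mulr_sumr; apply: ler_sum => c ca.
rewrite normrM (ger0_norm (nu0 c)) mulrC mulrA ler_wpM2r//.
apply: le_trans (b_lip _ _ _ _) _.
rewrite ler_wpM2l ?coef_ge0//.
by rewrite ler_nat /pdist; lia.
Qed.

Lemma avgdist_le k j a a' : (j < N)%N -> act k j a a' -> avgdist j a <= 10 * 2 ^+ j.
Proof.
move=> jN ac; have mass := act_mass jN ac.
have M0 : 0 < lev tau k ^+ 2 * 4 ^+ j by rewrite mulr_gt0 ?exprn_gt0 ?lev_gt0.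
have V0 : 0 < \sum_(c | cball j a c) nu c by exact: lt_le_trans mass.
rewrite /avgdist ler_pdivrMr// mulr_sumr; apply: ler_sum => c ca.
rewrite ler_wpM2r// -natrX -(natrM _ 10) ler_nat.
have e0 : (0 < 2 ^ j)%N by rewrite expn_gt0.
by move: (act_pdist ac ca) e0; clear; lia.
Qed.

(** Measured at a finer scale [j'] because a weight multiplies bumps of two consecutive scales. The
    bound is 0 off the support, the derivatives of [hat] vanishing up to its edge. *)
Lemma jet_bump1 i j j' a : (j' <= j)%N ->
  jet (bump1 (coord i o) (scale j) a) (coord i x) (scale j') (if near1 i j a then H else 0).
Proof.
move=> jj; have ll : scale j' <= scale j.
  by rewrite /scale ler_pM2l// ler_weXn2l//; lra.
case: ifP => [_|/negbT na].
  exact: (jet_affine _ _ (@smooth1_hat R) (scale_gt0 j') ll hatH).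
move=> e e2; rewrite derive1n_affine; last exact: smooth1_hat.
rewrite mul0r derive1n_hat_eq0 ?mulr0 ?normr0//.
have -> : (scale j)^-1 * coord i x + (- (coord i o / scale j) - a%:R) = X i / 2 ^+ j - a%:R.
  have e0 : 2 ^+ j != 0 :> R by rewrite expf_neq0.
  have d0 : delta != 0 by rewrite gt_eqF.
  by rewrite /scale /X; move: e0; set e1 := 2 ^+ j => e0; field; rewrite e0.
by move: na; rewrite /near1 -leNgt.
Qed.

Lemma jet_weight i j a a' :
  jet (weight (coord i o) j a a') (coord i x) (scale j)
    (if near1 i j a && near1 i j.+1 a' then 4 * H * H else 0).
Proof.
have := jetM (smooth1_bump1 _ _ _) (smooth1_bump1 _ _ _) (scale_gt0 j)
  (@jet_bump1 i j j a (leqnn j)) (@jet_bump1 i j.+1 j a' (leqnSn j)).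
by case: (near1 i j a); case: (near1 i j.+1 a'); rewrite /= ?mulr0 ?mul0r.
Qed.

Lemma tens_jet s u v (l B B' : R) : smooth1 u -> smooth1 v -> 0 < l -> (size s <= 2)%N ->
  jet u x.1 l B -> jet v x.2 l B' -> `|iter_partial s (tens u v) x| <= B * B' / l ^+ size s.
Proof.
move=> su sv l0 s2 ju jv; rewrite iter_partial_tens// /tens normrM.
have cs : (count (fun i : 'I_2 => val i == 0%N) s + count (fun i : 'I_2 => val i != 0%N) s = size s)%N.
  exact: count_predC.
set e := count _ s in cs *; set e' := count _ s in cs *.
rewrite -cs exprD invfM mulrACA.
by apply: ler_pM => //; [apply: ju|apply: jv]; move: cs s2; clear; lia.
Qed.

(** Some factor has jet bound 0, and the product bounds carry this over to all derivatives of order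
    at most two at once. *)
Lemma term_out s k j a a' : (size s <= 2)%N -> ~~ (near2 j a && near2 j.+1 a') ->
  iter_partial s (term k j a a') x = 0.
Proof.
move=> s2 na; have l0 := scale_gt0 j.
have sw := smooth1_weight; have sl := smooth1_linpart.
rewrite /term iter_partialD; [|by apply: smooth_tens => //; exact: smooth1M..].
have jl i : jet (linpart i k j a) (coord i x) (scale j)
    (`|linpart i k j a (coord i x)| + `|slope i k j a| * scale j).
  apply: jet_lin => //; first by rewrite lerDl mulr_ge0// ltW.
  by rewrite ler_pdivlMr// lerDr.
have jwl i (e e' : nat) := jetM (sw (coord i o) j e e') (sl i k j a) l0
  (@jet_weight i j e e') (jl i).
have t1 := tens_jet (smooth1M (sw o.1 j a.1 a'.1) (sl ord0 k j a)) (sw o.2 j a.2 a'.2) l0 s2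
  (jwl ord0 a.1 a'.1) (@jet_weight ord_max j a.2 a'.2).
have t2 := tens_jet (sw o.1 j a.1 a'.1) (smooth1M (sw o.2 j a.2 a'.2) (sl ord_max k j a)) l0 s2
  (@jet_weight ord0 j a.1 a'.1) (jwl ord_max a.2 a'.2).
pose P1 := near1 ord0 j a.1 && near1 ord0 j.+1 a'.1.
pose P2 := near1 ord_max j a.2 && near1 ord_max j.+1 a'.2.
have P12 : P1 && P2 = false.
  apply/negbTE; move: na; rewrite /near2 /P1 /P2.
  by do 4!case: (near1 _ _ _).
have z1 c d e : 4 * (if P1 then c else 0) * e * (if P2 then d else 0) = 0 :> R.
  by move: P12; case: (P1); case: (P2); rewrite ?(mulr0, mul0r).
have z2 c d e : (if P1 then c else 0) * (4 * (if P2 then d else 0) * e) = 0 :> R.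
  by move: P12; case: (P1); case: (P2); rewrite ?(mulr0, mul0r).
rewrite z1 mul0r in t1; rewrite z2 mul0r in t2.
apply/eqP; rewrite -normr_le0; apply: le_trans (le_trans (ler_normD _ _) (lerD t1 t2)) _.
by rewrite addr0.
Qed.

Lemma act_slope_abs i k j a a' : (j < N)%N -> act k j a a' ->
  `|slope i k j a| <= 186 * A * lev tau k * 2 ^+ j.
Proof.
move=> jN ac; have mass := act_mass jN ac.
have M0 : 0 < lev tau k ^+ 2 * 4 ^+ j by rewrite mulr_gt0 ?exprn_gt0 ?lev_gt0.
have V0 : 0 < \sum_(c | cball j a c) nu c by exact: lt_le_trans mass.
rewrite /slope normrM (gtr0_norm (x := _^-1)) ?invr_gt0// ler_pdivrMr//.
apply: le_trans (ler_norm_sum _ _ _) _; rewrite mulr_sumr; apply: ler_sum => c ca.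
by rewrite normrM (ger0_norm (nu0 c)) mulrC ler_wpM2r//; exact: act_b ac ca.
Qed.

(** Two tensor products, each with weights of jet bound [4 H^2] in both variables and one factor 4
    from a product: [2 * 4 * 4 * 4 = 128]. The factor 10 bounds the average distance in units of
    [2 ^ j]. *)
Lemma term_bound s k j a a' : (j < N)%N -> (size s <= 2)%N -> act k j a a' ->
  `|iter_partial s (term k j a a') x| <=
  128 * (10 * (186 * (H ^+ 4 * A))) * (lev tau k * 2 ^+ j * scale j / scale j ^+ size s).
Proof.
move=> jN s2 ac; have l0 := scale_gt0 j.
have sw := smooth1_weight; have sl := smooth1_linpart.
rewrite /term iter_partialD; [|by apply: smooth_tens => //; exact: smooth1M..].
pose S := 10 * (186 * A * lev tau k * 2 ^+ j * scale j).
have e0 : 0 < 2 ^+ j :> R by rewrite exprn_gt0.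
have t0 := lev_gt0 k tau0.
have S0 : 0 <= S by do !apply: mulr_ge0; rewrite ?ler0n//; exact: ltW.
have jl i : jet (linpart i k j a) (coord i x) (scale j) S.
  apply: jet_lin => //.
    apply: le_trans (act_linpart i jN ac) _.
    have -> : S = 186 * A * lev tau k * scale j * (10 * 2 ^+ j) by rewrite /S; ring.
    by rewrite ler_wpM2l ?(avgdist_le jN ac)//; do !apply: mulr_ge0; rewrite ?ler0n//; exact: ltW.
  apply: le_trans (act_slope_abs i jN ac) _.
  rewrite /S mulrA mulfK ?gt_eqF//.
  by rewrite ler_peMl ?ler1n//; do !apply: mulr_ge0; rewrite ?ler0n//; exact: ltW.
have H0 : 0 <= H by apply: le_trans H1.
have jw i e e' : jet (weight (coord i o) j e e') (coord i x) (scale j) (4 * H * H).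
  apply: (jetW l0 _ (@jet_weight i j e e')).
  by case: ifP => // _; rewrite !mulr_ge0.
have jwl i (e e' : nat) := jetM (sw (coord i o) j e e') (sl i k j a) l0 (jw i e e') (jl i).
have tr1 := tens_jet (smooth1M (sw o.1 j a.1 a'.1) (sl ord0 k j a)) (sw o.2 j a.2 a'.2) l0 s2
  (jwl ord0 a.1 a'.1) (jw ord_max a.2 a'.2).
have tr2 := tens_jet (sw o.1 j a.1 a'.1) (smooth1M (sw o.2 j a.2 a'.2) (sl ord_max k j a)) l0 s2
  (jw ord0 a.1 a'.1) (jwl ord_max a.2 a'.2).
apply: le_trans (le_trans (ler_normD _ _) (lerD tr1 tr2)) _.
rewrite le_eqVlt; apply/orP; left; apply/eqP; rewrite /S.
set q := _^-1; ring.
Qed.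

Lemma weight_chi j (a a' : G) :
  weight o.1 j a.1 a'.1 x.1 * weight o.2 j a.2 a'.2 x.2 = chi j a * chi j.+1 a'.
Proof.
rewrite /weight (@bump1E ord0 j) (@bump1E ord0 j.+1) (@bump1E ord_max j) (@bump1E ord_max j.+1).
by rewrite /chi; ring.
Qed.

Lemma derive1_linpart i k j a : derive1 (linpart i k j a) = cst (slope i k j a).
Proof.
apply/funext => y; rewrite derive1E.
by have d := is_derive_affine (slope i k j a) (- offset i k j a) y; rewrite derive_val.
Qed.

(** Both errors carry the average distance: the slope differs from [b(p)] by the Lipschitz constant
    times it, and where the derivative falls on the weight, the affine function is itself an average
    of [<b(c), x - c>], the factor [1 / scale j] cancelling the size of [b]. The constant is
    [6 + 4 * 372], with [372 = 2 * 186]. *)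
Lemma grad_term i k j a a' : (j < N)%N -> act k j a a' ->
  `|iter_partial [:: i] (term k j a a') x - chi j a * chi j.+1 a' * b i k p| <=
  1494 * H ^+ 2 * A * (lev tau k * avgdist j a).
Proof.
move=> jN ac; have l0 := scale_gt0 j.
have sw := smooth1_weight; have sl := smooth1_linpart.
have st u v : smooth1 u -> smooth1 v -> smooth (tens u v) by exact: smooth_tens.
have t0 := lev_gt0 k tau0.
have av0 : 0 <= avgdist j a.
  by rewrite divr_ge0 ?sumr_ge0// => c _; rewrite mulr_ge0.
have H0 : 0 <= H by apply: le_trans H1.
have H2 : 1 <= H ^+ 2 by rewrite exprn_ege1.
have wle (c : R) e e' y : `|weight c j e e' y| <= 1.
  rewrite /weight /bump1 normrM !ger0_norm ?hat_ge0//.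
  by rewrite -[leRHS]mulr1 ler_pM ?hat_ge0 ?hat_le1.
have dw ii e e' : `|derive1 (weight (coord ii o) j e e') (coord ii x)| <= 4 * H * H / scale j.
  have := @jet_weight ii j e e' 1%N isT; rewrite derive1n1 expr1 => /le_trans; apply.
  rewrite ler_pM2r ?invr_gt0//; case: ifP => // _; by rewrite !mulr_ge0.
pose D (ii : 'I_2) := if val ii == 0%N then
  derive1 (weight o.1 j a.1 a'.1) x.1 * weight o.2 j a.2 a'.2 x.2 else
  weight o.1 j a.1 a'.1 x.1 * derive1 (weight o.2 j a.2 a'.2) x.2.
have Dle : `|D i| <= 4 * H * H / scale j.
  rewrite /D; case: ifP => _; rewrite normrM -[leRHS]mulr1; last rewrite mulrC.
    by apply: ler_pM => //; exact: (dw ord0).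
  by apply: ler_pM => //; exact: (dw ord_max).
have -> : iter_partial [:: i] (term k j a a') x = chi j a * chi j.+1 a' * slope i k j a +
   D i * (linpart ord0 k j a x.1 + linpart ord_max k j a x.2).
  rewrite -weight_chi /term iter_partialD; [|by apply: st => //; exact: smooth1M..].
  rewrite /= !partial_tens//; [|exact: smooth1M..].
  rewrite /D; have [i0|i1] := eqVneq (val i) 0%N.
    rewrite (derive1M (sw _ _ _ _) (sl _ _ _ _)) derive1_linpart /tens /=.
    by rewrite (_ : i = ord0); [ring|apply/val_inj].
  rewrite (derive1M (sw _ _ _ _) (sl _ _ _ _)) derive1_linpart /tens /=.
  rewrite (_ : i = ord_max); first by ring.
  by apply/val_inj; move: i1; case: (i) => -[|[|]].
set L := linpart _ _ _ _ _ + _.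
have Lle : `|L| <= 372 * A * lev tau k * scale j * avgdist j a.
  apply: le_trans (ler_normD _ _) _.
  have := lerD (act_linpart ord0 jN ac) (act_linpart ord_max jN ac).
  by move=> /le_trans; apply; rewrite le_eqVlt; apply/orP; left; apply/eqP; ring.
rewrite (_ : _ - _ = chi j a * chi j.+1 a' * (slope i k j a - b i k p) + D i * L); last by ring.
apply: le_trans (ler_normD _ _) _.
have c1 : `|chi j a * chi j.+1 a'| <= 1.
  by rewrite -weight_chi normrM -[leRHS]mulr1 ler_pM.
have q1 : `|chi j a * chi j.+1 a' * (slope i k j a - b i k p)| <= 6 * A * lev tau k * avgdist j a.
  by rewrite normrM -[leRHS]mul1r ler_pM ?(act_slope i jN ac).
have q2 : `|D i * L| <= 4 * H * H / scale j * (372 * A * lev tau k * scale j * avgdist j a).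
  by rewrite normrM ler_pM.
apply: le_trans (lerD q1 q2) _.
have -> : 4 * H * H / scale j * (372 * A * lev tau k * scale j * avgdist j a) =
    H ^+ 2 * (1488 * (A * lev tau k * avgdist j a)).
  by field; rewrite gt_eqF.
rewrite (_ : 6 * A * lev tau k * avgdist j a = 6 * (A * lev tau k * avgdist j a)); last by ring.
rewrite (_ : 1494 * H ^+ 2 * A * (lev tau k * avgdist j a) =
  H ^+ 2 * (1494 * (A * lev tau k * avgdist j a))); last by ring.
have : 0 <= A * lev tau k * avgdist j a by exact: mulr_ge0 (mulr_ge0 (ltW A0) (ltW t0)) av0.
move: H2; set h := H ^+ 2; set y := A * _ * _ => h1 y0.
have hy : y <= h * y by rewrite ler_peMl.
lra.
Qed.

(** At most four squares of each of the scales [j] and [j + 1] are near [x], hence the factor 16. *)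
Lemma sum_act (F : nat -> nat -> G -> G -> R) (M : nat -> nat -> R) :
  (forall k j, 0 <= M k j) ->
  (forall k j a a', (j < N)%N -> good k j a -> ~~ good k j.+1 a' ->
     ~~ (near2 j a && near2 j.+1 a') -> F k j a a' = 0) ->
  (forall k j a a', (j < N)%N -> act k j a a' -> `|F k j a a'| <= M k j) ->
  `|\sum_(k < K) \sum_(j < N) \sum_(a : G | good k j a) \sum_(a' : G | ~~ good k j.+1 a')
    F k j a a'| <= 16 * \sum_(k < K) \sum_(j < N) ind (actj k j) * M k j.
Proof.
move=> M0 Fout Fact; rewrite mulr_sumr.
apply: le_trans (ler_norm_sum _ _ _) _; apply: ler_sum => k _; rewrite mulr_sumr.
apply: le_trans (ler_norm_sum _ _ _) _; apply: ler_sum => j _.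
apply: (@le_trans _ _ (\sum_(a : G) ind (near2 j a) *
   \sum_(a' : G) ind (near2 j.+1 a') * (ind (actj k j) * M k j))); last first.
  rewrite -mulr_suml -[X in _ * X]mulr_suml mulrA; apply: ler_wpM2r; first by rewrite mulr_ge0.
  rewrite (_ : 16 = 4 * 4 :> R); last by ring.
  by apply: ler_pM; rewrite ?sum_near2 ?sumr_ge0.
apply: le_trans (ler_norm_sum _ _ _) _; rewrite big_mkcond/=; apply: ler_sum => a _.
have S0 : 0 <= \sum_(a' : G) ind (near2 j.+1 a') * (ind (actj k j) * M k j).
  by apply: sumr_ge0 => a' _; rewrite !mulr_ge0.
case: (boolP (good k j a)) => ga; last by rewrite mulr_ge0.
apply: le_trans (ler_norm_sum _ _ _) _; rewrite big_mkcond/= mulr_sumr; apply: ler_sum => a' _.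
case: (boolP (good k j.+1 a')) => ba /=; first by rewrite !mulr_ge0.
case: (boolP (near2 j a && near2 j.+1 a')) => [/andP[na na']|nn]; last first.
  by rewrite Fout// normr0 !mulr_ge0.
have ac : act k j a a' by rewrite /act ga ba na na'.
have -> : actj k j by apply/existsP; exists a; apply/existsP; exists a'.
by rewrite na na' !mul1r; exact: Fact.
Qed.

Lemma actj_lev k j : actj k j -> lev tau k < m p.
Proof.
move=> /existsP[a /existsP[a' /and4P[ga _ na _]]]; apply: Lam_m.
by apply: (good_near ga na); rewrite ddxx.
Qed.

(** At order two the scale drops out and [1 / delta] is left; the lower orders are bounded crudely
    through the width [scale N] of the whole grid. *)
Lemma scale_ratio j e : (j <= N)%N -> (e <= 2)%N ->
  2 ^+ j * scale j / scale j ^+ e <= (1 + scale N) ^+ 2 / delta.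
Proof.
move=> jN e2; have l0 := scale_gt0 j.
have lN : scale j <= scale N by rewrite /scale ler_pM2l// ler_weXn2l//; lra.
have -> : 2 ^+ j * scale j / scale j ^+ e = (scale j ^+ 2 / scale j ^+ e) / delta.
  have -> : 2 ^+ j = scale j / delta by rewrite /scale mulrAC mulfV ?mul1r// gt_eqF.
  by rewrite expr2; ring.
rewrite ler_pM2r ?invr_gt0//.
case: e e2 => [|[|[|//]]] _.
- rewrite expr0 divr1 lerXn2r ?nnegrE//; lra.
- rewrite expr1 expr2 mulfK ?gt_eqF//; nra.
- rewrite mulfV ?expf_neq0 ?gt_eqF// exprn_ege1//; lra.
Qed.

Lemma potential_bound s : (size s <= 2)%N ->
  `|iter_partial s potential x| <=
  16 * (128 * (10 * (186 * (H ^+ 4 * A)))) * ((1 + scale N) ^+ 2 / delta) * (4 * m p).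
Proof.
move=> s2; rewrite iter_partial_potential.
set C := 128 * _.
have H0 : 0 <= H by apply: le_trans H1.
have C0 : 0 <= C.
  have HA : 0 <= H ^+ 4 * A by rewrite mulr_ge0 ?exprn_ge0 ?(ltW A0).
  apply: mulr_ge0 (ler0n _ _) (mulr_ge0 (ler0n _ _) (mulr_ge0 (ler0n _ _) HA)).
pose Z := (1 + scale N) ^+ 2 / delta.
have Z0 : 0 <= Z by rewrite divr_ge0 ?sqr_ge0 ?(ltW delta0).
apply: le_trans (@sum_act (fun k j a a' => iter_partial s (term k j a a') x)
   (fun k j => C * (lev tau k * Z)) _ _ _) _.
- by move=> k j; exact: mulr_ge0 C0 (mulr_ge0 (ltW (lev_gt0 _ tau0)) Z0).
- by move=> k j a a' jN _ _ nn; exact: term_out.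
- move=> k j a a' jN ac; apply: le_trans (term_bound jN s2 ac) _.
  apply: ler_wpM2l => //.
  have -> : lev tau k * 2 ^+ j * scale j / scale j ^+ size s =
    lev tau k * (2 ^+ j * scale j / scale j ^+ size s) by rewrite !mulrA.
  apply: ler_wpM2l; [by rewrite ltW// lev_gt0|exact: scale_ratio (ltnW jN) s2].
rewrite -/Z -(mulrA 16) -(mulrA 16); apply: ler_wpM2l => //.
apply: (@le_trans _ _ (\sum_(k < K) C * Z * (2 * (ind (lev tau k < m p) * lev tau k)))).
  apply: ler_sum => k _.
  have -> : \sum_(j < N) ind (actj k j) * (C * (lev tau k * Z)) =
     \sum_(j < N) C * Z * (ind (actj k j) * (ind (lev tau k < m p) * lev tau k)).
    apply: eq_bigr => j _; case: (boolP (actj k j)) => [/actj_lev -> /=|_]; last by rewrite !mul0r mulr0.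
    by rewrite !mul1r; ring.
  rewrite -mulr_sumr -mulr_suml; apply: ler_wpM2l; first exact: mulr_ge0.
  by apply: ler_wpM2r (actj_count k); rewrite mulr_ge0// ltW// lev_gt0.
rewrite -!mulr_sumr; apply: ler_wpM2l; first exact: mulr_ge0.
(* One factor 2 for the active scales of a level, the other for the geometric sum of the levels
   below [m p]. *)
rewrite (_ : 4 * m p = 2 * (2 * m p)); last by ring.
apply: ler_wpM2l => //; apply: (@geom_sum_lt _ (lev tau) (fun k => lev tau k < m p)) => //.
- by move=> k; rewrite ltW// lev_gt0.
- by move=> k; rewrite levS.
- by move=> k /ltW.
Qed.

(** The weights of a level miss 1 only if a square of the finest scale near [x] is not good; then a
    point outside [Lam k] lies within 11 mesh widths and [|b| <= 66 A t_k]. These residues sum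
    geometrically to the top level. *)
Lemma potential_grad i :
  `|iter_partial [:: i] potential x - \sum_(k < K) b i k p| <=
  16 * (1494 * H ^+ 2 * A) * 2 * (160 * Num.sqrt (\sum_c m c ^+ 2)) +
  66 * A * lev tau K.
Proof.
rewrite iter_partial_potential /=.
have E k : b i k p = \sum_(j < N) \sum_(a : G | good k j a) \sum_(a' : G | ~~ good k j.+1 a')
   chi j a * chi j.+1 a' * b i k p + (1 - goodsum k 0) * b i k p.
  rewrite -sum_weights mulrBl mul1r addrC -addrA [X in _ = _ + X](_ : _ = 0) ?addr0//.
  rewrite mulr_suml -sumrN -big_split/= big1// => j _.
  rewrite mulr_suml -sumrN -big_split/= big1// => a _.
  rewrite mulr_suml -sumrN -big_split/= big1// => a' _.
  by rewrite addNr.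
under [X in _ - X]eq_bigr => k _ do rewrite E.
rewrite big_split/= opprD addrA.
apply: le_trans (ler_normB _ _) _; apply: lerD.
  rewrite -sumrB.
  have -> : \sum_(k < K) (\sum_(j < N) \sum_(a : G | good k j a) \sum_(a' : G | ~~ good k j.+1 a')
      partial i (term k j a a') x - \sum_(j < N) \sum_(a : G | good k j a)
      \sum_(a' : G | ~~ good k j.+1 a') chi j a * chi j.+1 a' * b i k p) =
    \sum_(k < K) \sum_(j < N) \sum_(a : G | good k j a) \sum_(a' : G | ~~ good k j.+1 a')
      (partial i (term k j a a') x - chi j a * chi j.+1 a' * b i k p).
    apply: eq_bigr => k _; rewrite -sumrB; apply: eq_bigr => j _; rewrite -sumrB.
    by apply: eq_bigr => a _; rewrite -sumrB.
  set C := 1494 * _ * _.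
  have C0 : 0 <= C by apply: mulr_ge0 (mulr_ge0 (ler0n _ _) (sqr_ge0 _)) (ltW A0).
  pose Q k j := lev tau k * (\sum_(c | (pdist c <= 9 * 2 ^ j)%N) (pdist c).+1%:R * nu c) /
        \sum_(c | (pdist c <= 9 * 2 ^ j)%N) nu c.
  have Q0 k j : 0 <= Q k j.
    apply: divr_ge0; last exact: sumr_ge0.
    apply: mulr_ge0; first by rewrite ltW// lev_gt0.
    by apply: sumr_ge0 => c _; exact: mulr_ge0.
  apply: le_trans (@sum_act (fun k j a a' => partial i (term k j a a') x - chi j a * chi j.+1 a' * b i k p)
     (fun k j => C * (2 * Q k j)) _ _ _) _.
  - by move=> k j; exact: mulr_ge0 C0 (mulr_ge0 (ler0n _ 2) (Q0 _ _)).
  - move=> k j a a' jN _ _ nn; have -> : partial i (term k j a a') x = 0 := @term_out [:: i] k j a a' isT nn.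
    by case/nandP: nn => /chi_out ->; rewrite ?mul0r ?mulr0 ?mul0r subrr.
  - move=> k j a a' jN ac; apply: le_trans (grad_term i jN ac) _.
    rewrite ler_wpM2l// /Q -mulrA (mulrCA 2); apply: ler_wpM2l; first by rewrite ltW// lev_gt0.
    by have [] := act_avgdist jN ac.
  rewrite -(mulrA 16) -(mulrA 16) -(mulrA C); apply: ler_wpM2l => //.
  have -> : \sum_(k < K) \sum_(j < N) ind (actj k j) * (C * (2 * Q k j)) =
    C * (2 * \sum_(k < K) \sum_(j < N) ind (actj k j) * Q k j).
    rewrite !mulr_sumr; apply: eq_bigr => k _; rewrite !mulr_sumr; apply: eq_bigr => j _; ring.
  apply: ler_wpM2l => //; apply: ler_wpM2l => //.
  have -> : \sum_(k < K) \sum_(j < N) ind (actj k j) * Q k j =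
    \sum_(k < K) \sum_(j < N) ind ((j < N)%N && actj k j) * Q k j.
    by apply: eq_bigr => k _; apply: eq_bigr => j _; rewrite ltn_ord.
  apply: (@weighted_distance_sum R G pdist nu tau (fun k j => (j < N)%N && actj k j) K N nu0 tau0).
  - by move=> k j /andP[jN /existsP[a /existsP[a' ac]]]; have [] := act_avgdist jN ac.
  - by move=> k; under eq_bigr do rewrite ltn_ord; exact: actj_count.
apply: (@le_trans _ _ (\sum_(k < K) 66 * A * lev tau k)).
  apply: le_trans (ler_norm_sum _ _ _) _; apply: ler_sum => k _.
  have g1 : goodsum k 0 <= 1.
    rewrite -(chi_sum 0) /goodsum [leRHS](bigID (good k 0))/= lerDl.
    by apply: sumr_ge0 => a _; exact: chi_ge0.
  have g0 : 0 <= goodsum k 0 by apply: sumr_ge0 => a _; exact: chi_ge0.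
  have c0 : 0 <= 66 * A * lev tau k.
    exact: mulr_ge0 (mulr_ge0 (ler0n _ 66) (ltW A0)) (ltW (lev_gt0 _ tau0)).
  have [/existsP[a /andP[ba na]]|] := boolP [exists a, ~~ good k 0 a && near2 0 a].
    have [q Lq qp] := bad_near (leq0n N) ba na.
    have bb := b_lip i k p q; rewrite (b_out i Lq) subr0 in bb.
    have {}bb : `|b i k p| <= 66 * A * lev tau k.
      apply: le_trans bb _; rewrite (_ : 66 * A * lev tau k = 6 * A * lev tau k * 11%:R); last by ring.
      by rewrite ler_wpM2l// ler_nat ddC; apply: leq_trans qp _; rewrite expn0 muln1.
    rewrite normrM -[leRHS]mul1r; apply: ler_pM => //; rewrite ger0_norm; lra.
  rewrite negb_exists => /forallP h.
  suff -> : goodsum k 0 = 1 by rewrite subrr mul0r normr0.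
  rewrite -(chi_sum 0) /goodsum [RHS](bigID (good k 0))/= [X in _ + X]big1 ?addr0// => a ba.
  by apply: chi_out; have := h a; rewrite ba.
rewrite -mulr_sumr ler_wpM2l ?mulr_ge0 ?ler0n ?(ltW A0)//.
case: (K) => [|K']; first by rewrite big_ord0 ltW// lev_gt0.
rewrite levS; apply: geom_sum => k; first by rewrite ltW// lev_gt0.
by rewrite levS.
Qed.

End AtPoint.

(** A term is supported in the closed square of half-side [2 ^ j] about its node, and the margin
    [10 * 2 ^ j] of a good square provides, within one mesh width of each of its points, a grid
    point of [Lam k]. *)
Lemma Cc_inf_potential (D : set T) :
  (forall k q y, Lam k q ->
     (forall i, `|(coord i y - coord i o) / delta - (coord i (gp q))%:R| <= 1) -> D y) ->
  Cc_inf D potential.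
Proof.
move=> LD; do 2![apply: Cc_inf_sum => ? _].
apply: Cc_inf_sum => a; set k := nat_of_ord _; set j := nat_of_ord _ => ga.
apply: Cc_inf_sum => a' _.
split; first exact: smooth_term.
pose I c e := `[c + (2 ^ j * e)%N%:R * delta - scale j, c + (2 ^ j * e)%N%:R * delta + scale j]%classic : set R.
have l0 := scale_gt0 j.
have d0 : delta != 0 by rewrite gt_eqF.
exists (I o.1 a.1 `*` I o.2 a.2); split.
- by apply: compact_setX; exact: segment_compact.
- move=> y [y1 y2].
  have [/andP[b1 t1] /andP[b2 t2]] := good_interior ga.
  have key c e z : I c e z -> (10 * 2 ^ j < 2 ^ j * e < n - 10 * 2 ^ j)%N ->
      exists q : nat, [/\ (q <= n)%N, (dn q (2 ^ j * e) <= 10 * 2 ^ j)%N & `|(z - c) / delta - q%:R| <= 1].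
    rewrite /I /= in_itv /= => /andP[z1 z2] /andP[e1 e2].
    have w1 : (2 ^ j * e)%N%:R - 2 ^+ j <= (z - c) / delta.
      by rewrite ler_pdivlMr//; move: z1; rewrite /scale; lra.
    have w2 : (z - c) / delta <= (2 ^ j * e)%N%:R + 2 ^+ j.
      by rewrite ler_pdivrMr//; move: z2; rewrite /scale; lra.
    have p0 : (0 < 2 ^ j)%N by rewrite expn_gt0.
    have w0 : 0 <= (z - c) / delta.
      apply: le_trans w1; rewrite subr_ge0 -natrX ler_nat; move: e1; clear; lia.
    have /andP[f1 f2] := truncn_itv w0; set f := Num.truncn _ in f1 f2.
    have g1 : (f <= 2 ^ j * e + 2 ^ j)%N.
      by rewrite -(ler_nat R) natrD natrX; apply: le_trans f1 w2.
    have g2 : (2 ^ j * e < f + 1 + 2 ^ j)%N.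
      rewrite -(ltr_nat R) natrD natrX -ltrBlDr.
      by apply: le_lt_trans w1 _; rewrite addn1.
    exists f; split; last by rewrite ler_norml; move: f2; rewrite -natr1; lra.
      by move: g1 e2 p0; clear; lia.
    by rewrite dn_le; move: g1 g2 p0; clear; lia.
  have [q1 [q1n q1d q1y]] := key _ _ _ y1 (introT andP (conj b1 t1)).
  have [q2 [q2n q2d q2y]] := key _ _ _ y2 (introT andP (conj b2 t2)).
  have q1' : (q1 < n.+1)%N by rewrite ltnS.
  have q2' : (q2 < n.+1)%N by rewrite ltnS.
  apply: (LD k (Ordinal q1', Ordinal q2')).
    case/and3P: ga => _ _ /forallP /(_ (Ordinal q1', Ordinal q2')) /implyP; apply.
    by rewrite /dd geq_max q1d q2d.
  by move=> i; rewrite /coord; case: ifP.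
- move=> y yI.
  have out c e e' z : ~ I c e z -> weight c j e e' z = 0.
    move=> nz; rewrite /weight /bump1 hat_eq0 ?mul0r//.
    rewrite leNgt; apply/negP => h; apply: nz; rewrite /I /= in_itv /=.
    have E : (scale j)^-1 * z + (- (c / scale j) - e%:R) = (z - c - (2 ^ j * e)%N%:R * delta) / scale j.
      rewrite natrM natrX /scale; have e0 : 2 ^+ j != 0 :> R by rewrite expf_neq0.
      by move: e0; set t := 2 ^+ j => e0; field; rewrite e0.
    move: h; rewrite E normrM (gtr0_norm (x := _^-1)) ?invr_gt0// ltr_pdivrMr// mul1r ltr_norml.
    by move=> /andP[h1 h2]; apply/andP; split; lra.
  have [y1|y1] := pselect (I o.1 a.1 y.1).
    have y2 : ~ I o.2 a.2 y.2 by move=> y2; apply: yI.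
    by rewrite /term /tens !(out _ _ _ _ y2) mul0r !mulr0 addr0.
  by rewrite /term /tens !(out _ _ _ _ y1) !mul0r addr0.
Qed.

End Construction.

(** * Decomposition of grid data into a gradient and a bounded remainder *)

Section GridDecomposition.
Variable R : realType.
Notation T := (R * R)%type.

Lemma lev_bracket (t z : R) : 0 < t -> 0 <= z -> exists K, z <= lev t K /\ lev t K <= t + 2 * z.
Proof.
move=> t0 z0; have exK : exists K, z <= lev t K by exact: lev_large.
case: (ex_minnP exK) => -[|K] zK Kmin.
  by exists 0%N; split => //; rewrite /lev expr0 mulr1; lra.
exists K.+1; split => //; rewrite levS.
have : lev t K < z by rewrite ltNge; apply/negP => /Kmin; rewrite ltnn.
lra.
Qed.

Definition in_cell N (o : T) (delta : R) (x : T) (p : grid N) := forall i,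
  (coord i (gp p))%:R <= (coord i x - coord i o) / delta < (coord i (gp p))%:R + 1.

(** As [m] stays below the top level, the last extension is [phi] itself, and the [b] sum to [phi]
    minus the first extension. The latter is [2 A tau]-Lipschitz and vanishes at a corner, so it is
    bounded by [2 A tau] times the width of the grid. *)
Lemma grid_decomposition (A : R) : 0 < A -> exists C : R, 0 < C /\
  forall (N : nat) (o : T) (delta tau : R) (K : nat) (m : grid N -> R) (Om : pred (grid N))
    (phi : 'I_2 -> grid N -> R),
  0 < delta -> 0 < tau -> (forall p, 0 <= m p <= lev tau K) ->
  (forall p, Om p -> (0 < p.1 < 2 ^ N)%N /\ (0 < p.2 < 2 ^ N)%N) ->
  (forall i p q, Om p -> Om q ->
     `|phi i p - phi i q| <= A * (m p + m q) * (dd (gp p) (gp q))%:R) ->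
  (forall i p q, Om p -> ~~ Om q -> `|phi i p| <= A * m p * (dd (gp p) (gp q))%:R) ->
  (forall i q, ~~ Om q -> phi i q = 0) ->
  exists h : T -> R,
    (forall D : set T, (forall q y, Om q ->
       (forall i, `|(coord i y - coord i o) / delta - (coord i (gp q))%:R| <= 1) -> D y) ->
       Cc_inf D h) /\
    (forall x p, in_cell o delta x p -> (forall i, (coord i x - coord i o) / delta <= (2 ^ N)%N%:R) ->
       (forall i, `|iter_partial [:: i] h x - phi i p| <=
          C * (Num.sqrt (\sum_c m c ^+ 2) + tau * (2 ^ N)%N%:R + lev tau K)) /\
       (forall s, (size s <= 2)%N -> `|iter_partial s h x| <=
          C * ((1 + delta * 2 ^+ N) ^+ 2 / delta) * m p)).
Proof.
move=> A0; have [H [H1 hatH]] := hat_derivs R.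
have H0 : 0 < H by apply: lt_le_trans H1.
pose C1 := 16 * (1494 * H ^+ 2 * A) * 2 * 160.
pose C2 := 16 * (128 * (10 * (186 * (H ^+ 4 * A)))) * 4.
have C10 : 0 < C1.
  apply: mulr_gt0 (ltr0Sn R 159); apply: mulr_gt0 (ltr0Sn R 1); apply: mulr_gt0 (ltr0Sn R 15) _.
  exact: mulr_gt0 (mulr_gt0 (ltr0Sn R 1493) (exprn_gt0 2 H0)) A0.
have C20 : 0 < C2.
  apply: mulr_gt0 (ltr0Sn R 3); apply: mulr_gt0 (ltr0Sn R 15) _.
  apply: mulr_gt0 (ltr0Sn R 127) (mulr_gt0 (ltr0Sn R 9) (mulr_gt0 (ltr0Sn R 185) _)).
  exact: mulr_gt0 (exprn_gt0 4 H0) A0.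
have C60 : 0 < 66 * A by exact: mulr_gt0 (ltr0Sn R 65) A0.
have A20 : 0 < 2 * A by exact: mulr_gt0 (ltr0Sn R 1) A0.
exists (C1 + C2 + 66 * A + 2 * A); split.
  exact: addr_gt0 (addr_gt0 (addr_gt0 C10 C20) C60) A20.
move=> N o delta tau K m Om phi d0 tau0 mK Om_in phi1 phi2 phi3.
pose Lam k (p : grid N) := Om p && (lev tau k < m p).
have lev0 k : 0 < lev tau k by exact: lev_gt0.
have m0 p : 0 <= m p by case/andP: (mK p).
(* A corner of the grid, outside [Om] and hence outside every [Lam k]: the base point of all the
   extensions. *)
pose s0 : grid N := (ord0, ord0).
have s0Om : ~~ Om s0 by apply/negP => /Om_in[].
have s0L k : ~~ Lam k s0 by rewrite /Lam negb_and s0Om.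
have lip i k p q : ~~ Lam k p -> ~~ Lam k q ->
    `|phi i p - phi i q| <= 2 * A * lev tau k * (dd (gp p) (gp q))%:R.
  have side p' q' : Om p' -> ~~ Lam k p' -> ~~ Om q' ->
     `|phi i p' - phi i q'| <= 2 * A * lev tau k * (dd (gp p') (gp q'))%:R.
    move=> Op Lp Oq; rewrite (phi3 _ _ Oq) subr0; apply: le_trans (phi2 _ _ _ Op Oq) _.
    rewrite ler_wpM2r//; move: Lp; rewrite /Lam Op /= -leNgt => mp.
    rewrite (mulrC 2 A) -(mulrA A 2) ler_pM2l//; have := lev0 k; lra.
  move=> Lp Lq; have [Op|Op] := boolP (Om p); have [Oq|Oq] := boolP (Om q).
  - apply: le_trans (phi1 _ _ _ Op Oq) _; rewrite ler_wpM2r//.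
    move: Lp Lq; rewrite /Lam Op Oq /= -!leNgt => mp mq.
    rewrite (mulrC 2 A) -(mulrA A 2) ler_pM2l//; lra.
  - exact: side.
  - by rewrite distrC ddC; exact: side.
  - by rewrite !phi3// subrr normr0 !mulr_ge0// ltW.
have ext (ik : 'I_2 * nat) : exists psi : grid N -> R,
    (forall p, ~~ Lam ik.2 p -> psi p = phi ik.1 p) /\
    (forall p q, `|psi p - psi q| <= 2 * A * lev tau ik.2 * (dd (gp p) (gp q))%:R).
  apply: (@mcshane R (grid N) (fun p q => dd (gp p) (gp q)) (fun p => ~~ Lam ik.2 p) (phi ik.1) _ s0).
  - by move=> p; rewrite ddxx.
  - by move=> p q; rewrite ddC.
  - by move=> p q r; exact: dd_trans.
  - exact: mulr_ge0 (mulr_ge0 (ler0n _ 2) (ltW A0)) (ltW (lev0 _)).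
  - exact: s0L.
  - by move=> p q; exact: lip.
have [psi psiP] := boolp.choice ext.
pose b i k p := psi (i, k.+1) p - psi (i, k) p.
have Lsub k p : ~~ Lam k p -> ~~ Lam k.+1 p.
  rewrite /Lam !negb_and => /orP[->//|]; rewrite -!leNgt => h; apply/orP; right.
  by apply: le_trans h _; rewrite levS; have := lev0 k; lra.
have b_out i k p : ~~ Lam k p -> b i k p = 0.
  move=> Lp; have [e1 _] := psiP (i, k); have [e2 _] := psiP (i, k.+1).
  by rewrite /b e1// e2 ?subrr//; exact: Lsub.
(* The extension at level [k + 1] has constant [4 A t_k], the one at level [k] has [2 A t_k]: hence
   6. *)
have b_lip i k p q : `|b i k p - b i k q| <= 6 * A * lev tau k * (dd (gp p) (gp q))%:R.
  have [_ e1] := psiP (i, k); have [_ e2] := psiP (i, k.+1).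
  have -> : b i k p - b i k q = (psi (i, k.+1) p - psi (i, k.+1) q) - (psi (i, k) p - psi (i, k) q).
    by rewrite /b; ring.
  apply: le_trans (ler_normB _ _) _; apply: le_trans (lerD (e2 p q) (e1 p q)) _.
  by rewrite /= levS le_eqVlt; apply/orP; left; apply/eqP; ring.
have Lam_m k p : Lam k p -> lev tau k < m p by case/andP.
have Lam_in k p : Lam k p -> (0 < p.1 < 2 ^ N)%N /\ (0 < p.2 < 2 ^ N)%N by case/andP => /Om_in.
exists (@potential R N K o delta m Lam b); split.
  move=> D HD; apply: (Cc_inf_potential K m b d0 Lam_in) => k q y /andP[Oq _].
  exact: HD.
move=> x p px xn; split=> [i|s s2]; last first.
  have := potential_bound K d0 A0 tau0 m0 H1 hatH Lam_m Lam_in b_out b_lip px xn s2.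
  move=> /le_trans; apply; rewrite /scale.
  have Z0 : 0 <= (1 + delta * 2 ^+ N) ^+ 2 / delta by rewrite divr_ge0 ?sqr_ge0 ?(ltW d0).
  have -> : 16 * (128 * (10 * (186 * (H ^+ 4 * A)))) * ((1 + delta * 2 ^+ N) ^+ 2 / delta) * (4 * m p) =
     C2 * ((1 + delta * 2 ^+ N) ^+ 2 / delta) * m p by rewrite /C2; ring.
  rewrite ler_wpM2r// ler_wpM2r//; move: C10 C20 C60 A20.
  by move: C1 C2 (66 * A) (2 * A) => c1 c2 c3 c4; lra.
have := potential_grad K d0 A0 tau0 m0 H1 hatH Lam_m Lam_in b_out b_lip px xn i.
set h := potential _ _ _ _ _ _ => g.
have sb : \sum_(k < K) b i k p = phi i p - psi (i, 0%N) p.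
  rewrite -(big_mkord xpredT (fun k => b i k p)) telescope_sumr//; congr (_ - _).
  have [e _] := psiP (i, K); apply: e.
  by rewrite /Lam negb_and -leNgt; case/andP: (mK p) => _ ->; rewrite orbT.
have p0 : `|psi (i, 0%N) p| <= 2 * A * (tau * (2 ^ N)%N%:R).
  have [e1 e2] := psiP (i, 0%N).
  have := e2 p s0; rewrite (e1 s0 (s0L _)) /= (phi3 _ _ s0Om) subr0 => /le_trans; apply.
  rewrite /lev expr0 mulr1 -mulrA ler_wpM2l ?mulr_ge0 ?ler0n ?(ltW A0)//.
  rewrite ler_wpM2l ?(ltW tau0)// ler_nat dd_le /s0 /gp /= !add0n !leq0n.
  by rewrite (leq_ord p.1) (leq_ord p.2).
have -> : iter_partial [:: i] h x - phi i p =
    (iter_partial [:: i] h x - \sum_(k < K) b i k p) - psi (i, 0%N) p by rewrite sb; ring.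
apply: le_trans (ler_normB _ _) _; apply: le_trans (lerD g p0) _.
set E := Num.sqrt _; have E0 : 0 <= E by exact: sqrtr_ge0.
set W := tau * _; have W0 : 0 <= W by rewrite mulr_ge0// ltW.
have l0 := ltW (lev0 K); set l := lev tau K in l0 *.
rewrite (_ : 16 * (1494 * H ^+ 2 * A) * 2 * (160 * E) = C1 * E); last by rewrite /C1; ring.
have := mulr_ge0 (ltW C10) W0; have := mulr_ge0 (ltW C10) l0.
have := mulr_ge0 (ltW C20) W0; have := mulr_ge0 (ltW C20) l0; have := mulr_ge0 (ltW C20) E0.
have := mulr_ge0 (ltW A0) W0; have := mulr_ge0 (ltW A0) l0; have := mulr_ge0 (ltW A0) E0.
move: C1 C2 {C10 C20} => c1 c2; lra.
Qed.

End GridDecomposition.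

(** * Thickness of the complement of a Lipschitz domain *)

Section ExteriorCondition.
Variable R : realType.
Notation T := (R * R)%type.
Implicit Types (O : set T) (x y z w : T).

(** An exterior corkscrew condition at [y] and scale [s]: a square of proportional size outside [O],
    at distance at most [s] from [y]. *)
Definition exterior_square O y (k s : R) := exists z,
  (forall w, `|w.1 - z.1| < k * s -> `|w.2 - z.2| < k * s -> ~ O w) /\
  `|z.1 - y.1| <= s /\ `|z.2 - y.2| <= s.

Lemma exterior_squareW O y (k k' s : R) : k' <= k -> 0 <= s ->
  exterior_square O y k s -> exterior_square O y k' s.
Proof.
move=> kk s0 [z [zO zy]]; exists z; split => // w w1 w2.
by apply: zO; [apply: lt_le_trans w1 _|apply: lt_le_trans w2 _]; rewrite ler_wpM2r.
Qed.

(** [(sin th, cos th)] is the vertical direction of the rotated frame. Moving from [y] by [s / 2]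
    downwards leaves room for a square below the graph, whose slope is at most [|L|]. *)
Lemma exterior_square_local O x0 : lipschitz_boundary O -> closure O x0 -> ~ O x0 ->
  exists r : R, 0 < r /\ forall y, ball x0 r y -> ~ O y -> forall s, 0 < s <= r ->
    exterior_square O y r s.
Proof.
move=> lO cx nx; have [U [th [gam [L [oU Ux gL HU]]]]] := lO x0 cx nx.
have /nbhs_ballP[e /= e0 eU] : nbhs x0 U by exact: open_nbhs_nbhs.
(* A displacement of at most [k s] per coordinate becomes at most [2 k s] after rotation, and this
   choice gives [2 k s (1 + |L|) = s / 2], exactly the depth gained. *)
pose k : R := (4 * (1 + `|L|))^-1.
have kp : 0 < k by rewrite invr_gt0 mulr_gt0// ltr_pwDl.
have kL : k * (1 + `|L|) = 4^-1.
  by rewrite /k invfM -mulrA mulVf ?mulr1// gt_eqF// ltr_pwDl.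
have k1 : k <= 4^-1.
  by rewrite -kL ler_peMr ?(ltW kp)// lerDl.
exists (Num.min (e / 2) k); split; first by rewrite lt_min kp divr_gt0.
move=> y xy Oy s /andP[s0 sr].
have se : s <= e / 2 by apply: le_trans sr _; rewrite ge_min lexx.
apply: (@exterior_squareW _ _ k); [by rewrite ge_min lexx orbT|exact: ltW|].
have {xy}/ballT[xy1 xy2] : ball x0 (e / 2) y.
  by apply: le_ball xy; rewrite ge_min lexx.
have c1 := cos_le1 th; have c2 := cos_geN1 th; have s1 := sin_le1 th; have s2 := sin_geN1 th.
have cs := cos2Dsin2 th; move: cs; rewrite !expr2 => cs.
have Uy : U y by apply: eU; apply/ballT; split; lra.
exists (y.1 - s / 2 * sin th, y.2 - s / 2 * cos th); split; last first.
  by split; rewrite /= ler_norml; apply/andP; split; nra.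
move=> w /= w1 w2 Ow.
set t1 := w.1 - _ in w1; set t2 := w.2 - _ in w2.
have ks : 0 < k * s by rewrite mulr_gt0.
have ks4 : k * s <= s / 4 by rewrite mulrC ler_pM2l.
have Uw : U w.
  apply: eU; apply/ballT; move: w1 w2 xy1 xy2; rewrite /t1 /t2 !ltr_norml.
  move=> /andP[a1 a2] /andP[b1 b2] /andP[p1 p2] /andP[q1 q2].
  by split; apply/andP; split; nra.
have Hw := (HU w Uw).1 Ow.
have Hy : (Defs.rot th (y - x0)).2 <= gam (Defs.rot th (y - x0)).1.
  by rewrite leNgt; apply/negP => /(HU y Uy).2.
have gyw := gL (Defs.rot th (w - x0)).1 (Defs.rot th (y - x0)).1.
have E1 : (Defs.rot th (w - x0)).1 - (Defs.rot th (y - x0)).1 = cos th * t1 - sin th * t2.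
  rewrite /t1 /t2 /Defs.rot /=; ring.
have E2 : (Defs.rot th (w - x0)).2 - (Defs.rot th (y - x0)).2 = sin th * t1 + cos th * t2 - s / 2.
  transitivity (sin th * t1 + cos th * t2 - s / 2 * (cos th * cos th + sin th * sin th)).
    by rewrite /t1 /t2 /Defs.rot /=; ring.
  by rewrite cs mulr1.
have n1 : `|cos th * t1 - sin th * t2| <= 2 * (k * s).
  apply: le_trans (ler_normB _ _) _; rewrite !normrM.
  have := ler_pM (normr_ge0 _) (normr_ge0 _) (_ : `|cos th| <= 1) (ltW w1).
  have := ler_pM (normr_ge0 _) (normr_ge0 _) (_ : `|sin th| <= 1) (ltW w2).
  rewrite !ler_norml s1 s2 c1 c2 => /(_ isT) h1 /(_ isT) h2; lra.
have n2 : `|sin th * t1 + cos th * t2| <= 2 * (k * s).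
  apply: le_trans (ler_normD _ _) _; rewrite !normrM.
  have := ler_pM (normr_ge0 _) (normr_ge0 _) (_ : `|sin th| <= 1) (ltW w1).
  have := ler_pM (normr_ge0 _) (normr_ge0 _) (_ : `|cos th| <= 1) (ltW w2).
  rewrite !ler_norml s1 s2 c1 c2 => /(_ isT) h1 /(_ isT) h2; lra.
rewrite E1 in gyw.
have gyw' : `|gam (Defs.rot th (y - x0)).1 - gam (Defs.rot th (w - x0)).1| <= `|L| * (2 * (k * s)).
  rewrite distrC; apply: le_trans gyw _.
  apply: (@le_trans _ _ (`|L| * `|cos th * t1 - sin th * t2|)).
    by rewrite ler_wpM2r// ler_norm.
  by rewrite ler_wpM2l.
have kLs : `|L| * (k * s) + k * s = s / 4.
  have -> : `|L| * (k * s) + k * s = k * (1 + `|L|) * s by ring.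
  by rewrite kL mulrC.
move: gyw' n2; rewrite !ler_norml => /andP[g1 g2] /andP[m1 m2].
move: Hw Hy E2 g1 g2; set a := (Defs.rot th (w - x0)).2; set b := (Defs.rot th (y - x0)).2.
set g := gam _; set g' := gam _ => Hw Hy E2 g1 g2.
lra.
Qed.

Lemma normT_le (x : T) (e : R) : `|x| <= e <-> `|x.1| <= e /\ `|x.2| <= e.
Proof.
rewrite /Num.norm /= /ProdNormedZmodule.norm ge_max.
by split => [/andP|/andP].
Qed.

Lemma bounded_box O : bounded_set O -> exists M : R, 0 < M /\
  forall x, O x -> `|x.1| < M /\ `|x.2| < M.
Proof.
move=> [M [_ MO]]; exists (`|M| + 2); split; first by rewrite ltr_wpDl.
move=> x Ox; have /normT_le[h1 h2] : `|x| <= `|M| + 1.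
  by apply: MO Ox; rewrite ltr_pwDr// ler_norm.
lra.
Qed.

Lemma boundary_compact O : bounded_set O -> open O -> compact (closure O `&` ~` O).
Proof.
move=> /bounded_box[M [M0 MO]] oO.
have cB : compact ((`[- M, M]%classic : set R) `*` (`[- M, M]%classic : set R)).
  by apply: compact_setX; exact: segment_compact.
apply: (subclosed_compact _ cB).
  by apply: closedI; [exact: closed_closure|exact: open_closedC].
move=> x [cx _].
have clB : closed ((`[- M, M]%classic : set R) `*` (`[- M, M]%classic : set R)).
  exact: (compact_closed (@hausdorffT R)).
suff : closure ((`[- M, M]%classic : set R) `*` (`[- M, M]%classic : set R)) x.
  by apply: clB.
apply: closure_subset cx => y /MO[]; rewrite !ltr_norml => /andP[a b] /andP[c d].
by split; rewrite /= in_itv/=; apply/andP; split; exact: ltW.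
Qed.

(** The boundary is compact: points at which the constants [1 / (n + 1)] fail would cluster at a
    boundary point, where the local condition holds with some [r]. *)
Lemma exterior_square_uniform O : bounded_set O -> open O -> lipschitz_boundary O ->
  exists r : R, 0 < r /\ forall y, closure O y -> ~ O y -> forall s, 0 < s <= r ->
    exterior_square O y r s.
Proof.
move=> bO oO lO; apply/not_existsP => bad.
have r0 n : 0 < (n.+1%:R)^-1 :> R by rewrite invr_gt0 ltr0n.
have /boolp.choice[u uP] : forall n : nat, exists y, (closure O y /\ ~ O y) /\
    ~ (forall s, 0 < s <= (n.+1%:R)^-1 -> exterior_square O y (n.+1%:R)^-1 s).
  move=> n; apply/not_existsP => H; apply: (bad (n.+1%:R)^-1); split => // y cy oy.
  by apply: contrapT => h; apply: (H y).
have [p [[cp op] clp]] : ((closure O `&` ~` O) `&` cluster (u @ \oo)) !=set0.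
  by apply: (boundary_compact bO oO); exists 0%N => // n _; exact: (uP n).1.
have [r [rp rH]] := exterior_square_local lO cp op.
have [n nr] : exists n : nat, (n.+1%:R)^-1 < r :> R.
  exists (Num.truncn r^-1); rewrite invf_plt ?posrE//; exact: truncnS_gt.
have [|y [[m nm <-]]] := clp (u @` [set m | (n <= m)%N]) (ball p r) _ (nbhsx_ballx p r rp).
  by exists n => //= m nm; exists m.
move=> pm; have [[_ om]] := uP m; apply => s /andP[s0 sm].
have mr : (m.+1%:R)^-1 <= r :> R.
  apply: le_trans (ltW nr); rewrite lef_pV2 ?posrE ?ltr0n// ler_nat ltnS//.
apply: (@exterior_squareW _ _ r) => //; first exact: ltW.
apply: rH => //; rewrite s0; exact: le_trans mr.
Qed.

(** The first exit point of the segment, as the infimum of the parameters outside [O]. *)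
Lemma segment_boundary O x y : open O -> O x -> ~ O y ->
  exists y', [/\ closure O y', ~ O y', `|y'.1 - x.1| <= `|y.1 - x.1| & `|y'.2 - x.2| <= `|y.2 - x.2|].
Proof.
move=> oO Ox Oy.
pose f (t : R) : T := (x.1 + t * (y.1 - x.1), x.2 + t * (y.2 - x.2)).
pose D := `|y.1 - x.1| + `|y.2 - x.2| + 1.
have D0 : 0 < D by rewrite /D ltr_wpDl ?addr_ge0.
have fD (t t' e : R) : `|t - t'| < e / D -> ball (f t) e (f t').
  move=> tt; have tD : `|t - t'| * D < e by rewrite -ltr_pdivlMr.
  have tn := normr_ge0 (t - t').
  have n1 := normr_ge0 (y.1 - x.1); have n2 := normr_ge0 (y.2 - x.2).
  apply/ballT; rewrite /f /=; split.
    rewrite (_ : _ - _ = (t - t') * (y.1 - x.1)); last by ring.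
    rewrite normrM; apply: le_lt_trans tD; rewrite ler_wpM2l// /D; lra.
  rewrite (_ : _ - _ = (t - t') * (y.2 - x.2)); last by ring.
  rewrite normrM; apply: le_lt_trans tD; rewrite ler_wpM2l// /D; lra.
have opn (t : R) : O (f t) -> exists2 e : R, 0 < e & forall t', `|t - t'| < e -> O (f t').
  move=> Ot; have /nbhs_ballP[e /= e0 eO] : nbhs (f t) O by exact: open_nbhs_nbhs.
  by exists (e / D); [rewrite divr_gt0|move=> t' /fD /eO].
pose S := [set t : R | 0 <= t <= 1 /\ ~ O (f t)].
have S1 : S 1.
  split; first by rewrite ler01 lexx.
  have -> // : f 1 = y.
  by rewrite /f !mul1r [x.1 + _]addrC [x.2 + _]addrC !subrK -surjective_pairing.
have lS : has_lbound S by exists 0 => t [/andP[t0 _] _].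
have iS : has_inf S by split => //; exists (1 : R).
set t0 := inf S.
have t01 : t0 <= 1 by apply: ge_inf.
have t00 : 0 <= t0 by apply: lb_le_inf; [exists 1|move=> t [/andP[]]].
have nO : ~ O (f t0).
  move=> /opn[e e0 eO].
  have [t St te] := inf_adherent e0 iS.
  have tt0 : t0 <= t by exact: ge_inf.
  apply: St.2; apply: eO.
  by rewrite distrC ger0_norm ?subr_ge0//; move: te; rewrite -/t0; lra.
have f0 : O (f 0) by rewrite /f !mul0r !addr0 -surjective_pairing.
have t0p : 0 < t0 by rewrite lt_neqAle t00 andbT; apply/eqP => h; apply: nO; rewrite -h.
exists (f t0); split => //.
- move=> B /nbhs_ballP[e /= e0 eB].
  pose t := Num.max 0 (t0 - e / D / 2).
  have eD : 0 < e / D by rewrite divr_gt0.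
  have tt : t < t0 by rewrite /t gt_max t0p/=; lra.
  have t0' : 0 <= t by rewrite /t le_max lexx.
  have te : t0 - e / D / 2 <= t by rewrite /t le_max lexx orbT.
  exists (f t); split.
    apply: contrapT => nt; have St : S t by split => //; rewrite t0'/=; lra.
    by have : t0 <= t by [exact: ge_inf]; rewrite leNgt tt.
  by apply: eB; apply: fD; rewrite ger0_norm ?subr_ge0 ?(ltW tt)//; lra.
- by rewrite /f/= addrC addKr normrM ger0_norm// ler_piMl.
- by rewrite /f/= addrC addKr normrM ger0_norm// ler_piMl.
Qed.

(* The square is scaled down so as to stay in the box [-2M, 2M]^2. *)
Lemma exterior_square_box O (M : R) : bounded_set O -> open O -> lipschitz_boundary O ->
  0 < M -> (forall x, O x -> `|x.1| < M /\ `|x.2| < M) ->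
  exists k : R, 0 < k <= 1 /\ forall x y s, O x -> ~ O y -> 0 < s <= 16 * M ->
    `|y.1 - x.1| <= s -> `|y.2 - x.2| <= s ->
    exists z, [/\ forall w, `|w.1 - z.1| < k * s -> `|w.2 - z.2| < k * s -> ~ O w,
      `|z.1 - x.1| <= 2 * s, `|z.2 - x.2| <= 2 * s,
      `|z.1| + k * s <= 2 * M & `|z.2| + k * s <= 2 * M].
Proof.
move=> bO oO lO M0 MO; have [r [r0 rH]] := exterior_square_uniform bO oO lO.
(* For [s <= 16 M], the bound [c s <= r] makes the uniform condition available at size [c s], and
   the bound 1/64 keeps both the displacement and the half-side below [M / 4]. *)
pose c := Num.min (64^-1) (Num.min (r / (16 * M)) 1).
have c0 : 0 < c by rewrite !lt_min invr_gt0 ltr0n ltr01 divr_gt0 ?mulr_gt0.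
have c1 : c <= 64^-1 by rewrite /c ge_min lexx.
have c2 : c * (16 * M) <= r.
  by rewrite -ler_pdivlMr ?mulr_gt0// /c !ge_min lexx orbT.
pose k := Num.min r 1 * c.
have m0 : 0 < Num.min r 1 by rewrite lt_min r0/=.
have k0 : 0 < k by rewrite mulr_gt0.
have kc : k <= c by rewrite ler_piMl ?(ltW c0)// ge_min lexx orbT.
exists k; split; first by rewrite k0/=; lra.
move=> x y s Ox Oy /andP[s0 sM] y1 y2.
have [y' [cy' ny' y1' y2']] := segment_boundary oO Ox Oy.
have sc0 : 0 < c * s by rewrite mulr_gt0.
have cs : c * s <= c * (16 * M) by rewrite ler_pM2l.
have cs' : c * s <= 64^-1 * s by rewrite ler_pM2r.
have [|z [zO [z1 z2]]] := rH y' cy' ny' (c * s).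
  by rewrite sc0/=; exact: le_trans c2.
have kr : k * s <= r * (c * s).
  by rewrite /k -mulrA ler_wpM2r ?(ltW sc0)// ge_min lexx.
have ks : k * s <= c * s by rewrite ler_pM2r.
have bM : `|y'.1| <= M /\ `|y'.2| <= M.
  have cB : compact ((`[- M, M]%classic : set R) `*` (`[- M, M]%classic : set R)).
    by apply: compact_setX; exact: segment_compact.
  have clB := compact_closed (@hausdorffT R) cB.
  have : closure ((`[- M, M]%classic : set R) `*` (`[- M, M]%classic : set R)) y'.
    apply: closure_subset cy' => w /MO[]; rewrite !ltr_norml => /andP[a b] /andP[a' b'].
    by split; rewrite /= in_itv/=; apply/andP; split; exact: ltW.
  by move=> /clB[]; rewrite /= !in_itv/= -!ler_norml.
exists z; split.
- by move=> w w1 w2; apply: zO; [exact: lt_le_trans kr|exact: lt_le_trans kr].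
- by rewrite (_ : z.1 - x.1 = (z.1 - y'.1) + (y'.1 - x.1)); [apply: le_trans (ler_normD _ _) _; lra|ring].
- by rewrite (_ : z.2 - x.2 = (z.2 - y'.2) + (y'.2 - x.2)); [apply: le_trans (ler_normD _ _) _; lra|ring].
- have := ler_normD (z.1 - y'.1) y'.1; rewrite subrK; lra.
- have := ler_normD (z.2 - y'.2) y'.2; rewrite subrK; lra.
Qed.

End ExteriorCondition.

(** * Increments along the axes, and integrals compared with sums over cells *)

Section PlaneAnalysis.
Variable R : realType.
Notation T := (R * R)%type.
Implicit Types (O D : set T) (x y : T) (u : T -> R).

Lemma is_derive_row u (c t : R) : smooth u ->
  is_derive c (1 : R) (fun a : R => u (a, t)) (partial ord0 u (c, t)).
Proof.
move=> su; have d : derivable u (c, t) (dir R ord0) by apply: diff_derivable; exact: (su [::]).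
have E : (fun h : R => h^-1 *: (((fun a : R => u (a, t)) \o shift c) (h *: 1) - u (c, t))) =
  (fun h : R => h^-1 *: ((u \o shift (c, t)) (h *: dir R ord0) - u (c, t))).
  apply/funext => h /=; congr (_ *: (u _ - _)).
  have -> : h *: dir R ord0 + (c, t) = (h * 1 + c, h * 0 + t) by [].
  by rewrite mulr0 add0r.
by apply: DeriveDef; rewrite /derivable /derive /partial /derive E.
Qed.

Lemma is_derive_col u (c t : R) : smooth u ->
  is_derive c (1 : R) (fun a : R => u (t, a)) (partial ord_max u (t, c)).
Proof.
move=> su; have d : derivable u (t, c) (dir R ord_max) by apply: diff_derivable; exact: (su [::]).
have E : (fun h : R => h^-1 *: (((fun a : R => u (t, a)) \o shift c) (h *: 1) - u (t, c))) =
  (fun h : R => h^-1 *: ((u \o shift (t, c)) (h *: dir R ord_max) - u (t, c))).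
  apply/funext => h /=; congr (_ *: (u _ - _)).
  have -> : h *: dir R ord_max + (t, c) = (h * 0 + t, h * 1 + c) by [].
  by rewrite mulr0 add0r.
by apply: DeriveDef; rewrite /derivable /derive /partial /derive E.
Qed.

Lemma increment_le (f df : R -> R) (a b B : R) :
  (forall c, is_derive c (1 : R) f (df c)) -> a <= b ->
  (forall c, a <= c <= b -> `|df c| <= B) -> `|f b - f a| <= B * (b - a).
Proof.
move=> fd; rewrite le_eqVlt => /predU1P[-> _|ab dB]; first by rewrite !subrr normr0 mulr0.
have cf : {within `[a, b], continuous f}.
  apply: continuous_subspaceT => c; apply/differentiable_continuous/derivable1_diffP.
  by have d := fd c; exact: ex_derive.
have [c] := MVT ab (fun c _ => fd c) cf.
rewrite in_itv/= => /andP[ac cb] ->; rewrite normrM (gtr0_norm (x := b - a)) ?subr_gt0//.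
by rewrite ler_wpM2r ?subr_ge0 ?(ltW ab)// dB// (ltW ac) (ltW cb).
Qed.

Lemma row_increment u (a b t B : R) : smooth u -> a <= b ->
  (forall c, a <= c <= b -> `|partial ord0 u (c, t)| <= B) ->
  `|u (b, t) - u (a, t)| <= B * (b - a).
Proof.
by move=> su ab H; apply: (@increment_le (fun c => u (c, t)) _ a b B (fun c => is_derive_row c t su)).
Qed.

Lemma col_increment u (a b t B : R) : smooth u -> a <= b ->
  (forall c, a <= c <= b -> `|partial ord_max u (t, c)| <= B) ->
  `|u (t, b) - u (t, a)| <= B * (b - a).
Proof.
by move=> su ab H; apply: (@increment_le (fun c => u (t, c)) _ a b B (fun c => is_derive_col c t su)).
Qed.

Lemma Cc_inf_bounded D u : Cc_inf D u -> exists B : R, 0 <= B /\ forall x, `|u x| <= B.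
Proof.
move=> [su [K [cK _ Ku]]].
have cu := smooth_continuous su.
have /compact_bounded[M [_ MK]] : compact (u @` K).
  by apply: continuous_compact => //; exact: continuous_subspaceT.
exists (`|M| + 1); split; first by rewrite addr_ge0.
move=> x; have [Kx|Kx] := pselect (K x); last by rewrite Ku// normr0 addr_ge0.
by apply: (MK (`|M| + 1)); [rewrite ltr_pwDr// ler_norm|exists x].
Qed.

Lemma compact_in_open D (K : set T) : compact K -> open D -> K `<=` D ->
  exists r : R, 0 < r /\ forall x y, K x -> `|x.1 - y.1| < r -> `|x.2 - y.2| < r -> D y.
Proof.
move=> cK oD KD; apply/not_existsP => bad.
have r0 n : 0 < (n.+1%:R)^-1 :> R by rewrite invr_gt0 ltr0n.
have /boolp.choice[u uP] : forall n : nat, exists xy : T * T, K xy.1 /\ ball xy.1 (n.+1%:R)^-1 xy.2 /\ ~ D xy.2.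
  move=> n; apply/not_existsP => H; apply: (bad (n.+1%:R)^-1); split => // x y Kx h1 h2.
  by apply: contrapT => h; apply: (H (x, y)).
have [p [Kp clp]] : (K `&` cluster ((fun n => (u n).1) @ \oo)) !=set0.
  by apply: cK; exists 0%N => // n _; exact: (uP n).1.
have /nbhs_ballP[r /= rp rD] : nbhs p D by apply: open_nbhs_nbhs; split => //; exact: KD.
have r2 : 0 < r / 2 by rewrite divr_gt0.
have [n nr] : exists n : nat, (n.+1%:R)^-1 < r / 2 :> R.
  exists (Num.truncn (r / 2)^-1); rewrite invf_plt ?posrE//; exact: truncnS_gt.
have [|y [[m nm <-]]] := clp ((fun n => (u n).1) @` [set m | (n <= m)%N]) (ball p (r / 2)) _ (nbhsx_ballx p _ r2).
  by exists n => //= m nm; exists m.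
move=> pm; have [_ [bm]] := uP m; apply; apply: rD.
have mr : (m.+1%:R)^-1 <= r / 2 :> R.
  by apply: le_trans (ltW nr); rewrite lef_pV2 ?posrE ?ltr0n// ler_nat ltnS.
by rewrite (splitr r); apply: ball_triangle pm _; apply: le_ball bm.
Qed.

Definition cell N (o : T) (delta : R) (p : grid N) : set T :=
  `[o.1 + delta * p.1%:R, o.1 + delta * (p.1%:R + 1)[%classic `*`
  `[o.2 + delta * p.2%:R, o.2 + delta * (p.2%:R + 1)[%classic.

Lemma cellP N o (delta : R) (p : grid N) x : 0 < delta ->
  cell o delta p x <-> in_cell o delta x p.
Proof.
move=> d0; have E (c z e : R) : (c + delta * e <= z) = (e <= (z - c) / delta).
  by rewrite ler_pdivlMr// lerBrDl mulrC.
have E' (c z e : R) : (z < c + delta * e) = ((z - c) / delta < e).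
  by rewrite ltr_pdivrMr// ltrBlDl mulrC.
split => [[]|H].
  rewrite /= !in_itv/= !E !E' => h1 h2 i; rewrite /coord; case: ifP => _ //.
by split; rewrite /= in_itv/= E E'; [exact: (H ord0)|exact: (H ord_max)].
Qed.

Lemma in_cell_uniq N o (delta : R) (p p' : grid N) x :
  in_cell o delta x p -> in_cell o delta x p' -> p = p'.
Proof.
move=> h h'; have E i : coord i (gp p) = coord i (gp p').
  have /andP[a b] := h i; have /andP[c d] := h' i.
  have := le_lt_trans a d; have := le_lt_trans c b.
  by rewrite !natr1 !ltr_nat; lia.
case: p p' {h h'} E => [p1 p2] [q1 q2] E.
by congr (_, _); apply/val_inj; [exact: (E ord0)|exact: (E ord_max)].
Qed.

Lemma measurable_cell N o (delta : R) (p : grid N) : measurable (cell o delta p).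
Proof. by apply: measurableX; exact: measurable_itv. Qed.

Lemma leb2_rect (a b c d : R) : a <= b -> c <= d ->
  leb2 (`[a, b[%classic `*` `[c, d[%classic) = ((b - a) * (d - c))%:E.
Proof.
move=> ab cd.
have L (z t : R) : z <= t -> lebesgue_measure (`[z, t[%classic : set R) = (t - z)%:E.
  move=> zt; rewrite lebesgue_measure_itv/= lte_fin; move: zt; rewrite le_eqVlt.
  by move=> /predU1P[->|->]; [rewrite ltxx subrr|rewrite -EFinB].
rewrite /leb2; transitivity ((b - a)%:E * (d - c)%:E)%E; last by rewrite -EFinM.
rewrite -(L _ _ ab) -(L _ _ cd).
by apply: product_measure1E; exact: measurable_itv.
Qed.

Lemma leb2_cell N o (delta : R) (p : grid N) : 0 < delta -> leb2 (cell o delta p) = (delta ^+ 2)%:E.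
Proof.
move=> d0; rewrite /cell leb2_rect.
- by congr EFin; ring.
- by rewrite lerD2l ler_pM2l// lerDl.
- by rewrite lerD2l ler_pM2l// lerDl.
Qed.

Definition stepfun N o (delta : R) (w : grid N -> R) (x : T) : R :=
  \sum_p w p * \1_(cell o delta p) x.

Lemma integral_stepfun N o (delta : R) (w : grid N -> R) : 0 < delta -> (forall p, 0 <= w p) ->
  (\int[@leb2 R]_(x in setT) (stepfun o delta w x)%:E = (\sum_p w p * delta ^+ 2)%:E)%E.
Proof.
move=> d0 w0; rewrite /stepfun; under eq_integral do rewrite -sumEFin.
rewrite ge0_integral_sum//; last 2 first.
- move=> p; apply/measurable_EFinP; apply: measurable_funM => //.
  exact: measurable_indic (measurable_cell o delta p).
- by move=> p x _; rewrite lee_fin mulr_ge0.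
rewrite -sumEFin; apply: eq_bigr => p _.
under eq_integral do rewrite EFinM.
rewrite ge0_integralZl_EFin//; last first.
  by apply/measurable_EFinP; exact: measurable_indic (measurable_cell o delta p).
rewrite integral_indic//; last exact: measurable_cell.
by rewrite setIT EFinM; congr (_ * _)%E; exact: leb2_cell.
Qed.

Lemma measurable_stepfun N o (delta : R) (w : grid N -> R) D : measurable_fun D (stepfun o delta w).
Proof.
apply: measurable_sum => p; apply: measurable_funM => //.
apply: (measurable_funS measurableT) => //.
exact: measurable_indic (measurable_cell o delta p).
Qed.

Lemma stepfun_in N o (delta : R) (w : grid N -> R) p x : 0 < delta -> in_cell o delta x p ->
  stepfun o delta w x = w p.
Proof.
move=> d0 px; rewrite /stepfun (bigD1 p)//= big1 ?addr0.
  by rewrite indicE mem_set ?mulr1//; exact/cellP.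
move=> q qp; rewrite indicE memNset ?mulr0// => /(cellP _ _ _ d0) qx.
by case/eqP: qp; exact: in_cell_uniq qx px.
Qed.

Lemma stepfun_out N o (delta : R) (w : grid N -> R) x : 0 < delta ->
  (forall p : grid N, ~ in_cell o delta x p) -> stepfun o delta w x = 0.
Proof.
move=> d0 px; rewrite /stepfun big1// => q _; rewrite indicE memNset ?mulr0//.
by move=> /(cellP _ _ _ d0); exact: px.
Qed.

Lemma integral_le_cells N o (delta : R) (w : grid N -> R) D (G : T -> R) :
  0 < delta -> (forall p, 0 <= w p) -> measurable D -> measurable_fun D G ->
  (forall x, 0 <= G x) ->
  (forall x, D x -> exists2 p : grid N, in_cell o delta x p & G x <= w p) ->
  (\int[@leb2 R]_(x in D) (G x)%:E <= (\sum_p w p * delta ^+ 2)%:E)%E.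
Proof.
move=> d0 w0 mD mG G0 H; rewrite -(integral_stepfun o d0 w0).
have s0 x : 0 <= stepfun o delta w x by apply: sumr_ge0 => p _; rewrite mulr_ge0.
apply: (@le_trans _ _ (\int[@leb2 R]_(x in D) (stepfun o delta w x)%:E)%E); last first.
  apply: ge0_subset_integral => //.
  - by apply/measurable_EFinP; exact: measurable_stepfun.
  - by move=> x _; rewrite lee_fin; exact: s0.
apply: (@ge0_le_integral _ _ _ (@leb2 R) D mD (EFin \o G) (EFin \o stepfun o delta w)) => //.
- by move=> x _; rewrite lee_fin.
- exact/measurable_EFinP.
- by apply/measurable_EFinP; exact: measurable_stepfun.
- move=> x Dx; rewrite lee_fin; have [p px] := H x Dx.
  by rewrite (stepfun_in w d0 px).
Qed.

Lemma cells_le_integral N o (delta : R) (w : grid N -> R) D (G : T -> R) :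
  0 < delta -> (forall p, 0 <= w p) -> measurable D -> measurable_fun setT G ->
  (forall x, 0 <= G x) ->
  (forall x (p : grid N), in_cell o delta x p -> D x /\ w p <= G x) ->
  ((\sum_p w p * delta ^+ 2)%:E <= \int[@leb2 R]_(x in D) (G x)%:E)%E.
Proof.
move=> d0 w0 mD mG G0 H; rewrite -(integral_stepfun o d0 w0).
have s0 x : 0 <= stepfun o delta w x by apply: sumr_ge0 => p _; rewrite mulr_ge0.
rewrite [leRHS]integral_mkcond.
apply: (@ge0_le_integral _ _ _ (@leb2 R) setT measurableT (EFin \o stepfun o delta w) ((EFin \o G) \_ D)) => //.
- by move=> x _; rewrite lee_fin.
- by apply/measurable_EFinP; exact: measurable_stepfun.
- apply/(measurable_restrictT _ mD); apply/measurable_EFinP.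
  by apply: (measurable_funS measurableT).
- move=> x _ /=; have [[p px]|nx] := pselect (exists p : grid N, in_cell o delta x p).
    have [Dx wG] := H _ _ px.
    by rewrite (stepfun_in w d0 px) /patch mem_set// lee_fin.
  rewrite (stepfun_out w d0); last by move=> p px; apply: nx; exists p.
  by rewrite /patch; case: ifP => _; rewrite lee_fin.
Qed.

End PlaneAnalysis.

Lemma dist_le (R : realDomainType) (a b d : R) : a <= b + d -> b <= a + d -> `|a - b| <= d.
Proof. by rewrite ler_norml; lra. Qed.

(** * Sampling a smooth field on the grid of the box [[-2M, 2M]^2] *)

Section Discretisation.
Variable R : realType.
Notation T := (R * R)%type.
Variables (O : set T) (M k : R).
Hypothesis M0 : 0 < M.
Hypothesis k01 : 0 < k <= 1.
Hypothesis OM : forall x, O x -> `|x.1| < M /\ `|x.2| < M.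
Hypothesis extk : forall (x y : T) s, O x -> ~ O y -> 0 < s <= 16 * M ->
  `|y.1 - x.1| <= s -> `|y.2 - x.2| <= s ->
  exists z, [/\ forall w, `|w.1 - z.1| < k * s -> `|w.2 - z.2| < k * s -> ~ O w,
    `|z.1 - x.1| <= 2 * s, `|z.2 - x.2| <= 2 * s,
    `|z.1| + k * s <= 2 * M & `|z.2| + k * s <= 2 * M].

Definition gradsum (u : 'I_2 -> T -> R) (x : T) : R := \sum_i \sum_j `|partial j (u i) x|.

Lemma gradsum_ge0 u x : 0 <= gradsum u x.
Proof. by apply: sumr_ge0 => i _; apply: sumr_ge0. Qed.

Lemma partial_le_gradsum u i j x : `|partial j (u i) x| <= gradsum u x.
Proof.
rewrite /gradsum (bigD1 i)//= (bigD1 j)//= -addrA lerDl addr_ge0// ?sumr_ge0// => l _.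
exact: sumr_ge0.
Qed.

Variable N : nat.
Local Notation n := (2 ^ N)%N.
Let delta : R := 4 * M / n%:R.
Let o : T := (- (2 * M), - (2 * M)).

Let n0 : 0 < n%:R :> R. Proof. by rewrite ltr0n expn_gt0. Qed.
Let delta0 : 0 < delta. Proof. by rewrite divr_gt0// mulr_gt0. Qed.
Let deltan : delta * n%:R = 4 * M. Proof. by rewrite mulfVK// gt_eqF. Qed.

Definition pt (a b : nat) : T := (o.1 + delta * a%:R, o.2 + delta * b%:R).

(* A margin of [4 / k] mesh widths makes an exterior square found near a point that is not [inner] contain whole grid cells. *)
Definition inner (p : grid N) : bool :=
  `[< forall y : T, `|y.1 - (pt p.1 p.2).1| < 4 / k * delta ->
                    `|y.2 - (pt p.1 p.2).2| < 4 / k * delta -> O y >].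

Variables (u : 'I_2 -> T -> R) (eps : R).
Hypothesis su : forall i, smooth (u i).
Hypothesis eps0 : 0 < eps.
Hypothesis u_out : forall i x, ~ O x -> u i x = 0.
Hypothesis osc : forall x y, `|x.1 - y.1| <= delta -> `|x.2 - y.2| <= delta ->
  gradsum u x <= gradsum u y + eps.
Hypothesis fine_mesh : 4 / k * delta <= M.

(** [eps] covers the oscillation of the gradient over one mesh width, so the gradient at a single
    node bounds the increments of [u] across the whole cell. *)
Definition slopes (a b : nat) : R := delta * (gradsum u (pt a b) + eps).

Lemma slopes_ge0 a b : 0 <= slopes a b.
Proof. by rewrite mulr_ge0 ?(ltW delta0)// addr_ge0 ?gradsum_ge0// ltW. Qed.

Lemma partial_le_slopes i j x a b : `|x.1 - (pt a b).1| <= delta -> `|x.2 - (pt a b).2| <= delta ->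
  `|partial j (u i) x| <= gradsum u (pt a b) + eps.
Proof. by move=> h1 h2; apply: le_trans (partial_le_gradsum _ _ _ _) (osc h1 h2). Qed.

Lemma row_step i a b t t' : 0 <= t <= delta -> 0 <= t' <= delta ->
  `|u i ((pt a b).1 + t, (pt a b).2 + t') - u i ((pt a b).1, (pt a b).2 + t')| <= slopes a b.
Proof.
move=> /andP[t0 td] /andP[t0' td'].
apply: le_trans (row_increment (B := gradsum u (pt a b) + eps) (su i) _ _) _; first by rewrite lerDl.
- move=> c /andP[c1 c2]; apply: partial_le_slopes; last by rewrite [_.2]/= addrAC subrr add0r ger0_norm.
  by rewrite [X in `|X - _|]/= ger0_norm ?subr_ge0// lerBlDl (le_trans c2)// lerD2l.
- rewrite [X in _ * X]addrAC subrr add0r /slopes mulrC ler_wpM2r//.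
  by rewrite addr_ge0 ?gradsum_ge0// ltW.
Qed.

Lemma col_step i a b t t' : 0 <= t <= delta -> 0 <= t' <= delta ->
  `|u i ((pt a b).1 + t', (pt a b).2 + t) - u i ((pt a b).1 + t', (pt a b).2)| <= slopes a b.
Proof.
move=> /andP[t0 td] /andP[t0' td'].
apply: le_trans (col_increment (B := gradsum u (pt a b) + eps) (su i) _ _) _; first by rewrite lerDl.
- move=> c /andP[c1 c2]; apply: partial_le_slopes; first by rewrite [_.1]/= addrAC subrr add0r ger0_norm.
  by rewrite [X in `|X - _|]/= ger0_norm ?subr_ge0// lerBlDl (le_trans c2)// lerD2l.
- rewrite [X in _ * X]addrAC subrr add0r /slopes mulrC ler_wpM2r//.
  by rewrite addr_ge0 ?gradsum_ge0// ltW.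
Qed.

Let step_0 : (0 : R) <= 0 <= delta. Proof. by rewrite lexx ltW. Qed.
Let step_delta : 0 <= delta <= delta. Proof. by rewrite lexx ltW. Qed.

Let phi i (a b : nat) : R := u i (pt a b).

Let phi_row i a b : `|phi i a.+1 b - phi i a b| <= slopes a b.
Proof.
have := @row_step i a b delta 0 step_delta step_0; rewrite !addr0.
rewrite -surjective_pairing; congr (`|u i _ - _| <= _).
by rewrite /pt -natr1 mulrDr mulr1 addrA.
Qed.

Let phi_col i a b : `|phi i a b.+1 - phi i a b| <= slopes a b.
Proof.
have := @col_step i a b delta 0 step_delta step_0; rewrite !addr0.
rewrite -surjective_pairing; congr (`|u i _ - _| <= _).
by rewrite /pt -natr1 mulrDr mulr1 addrA.
Qed.

Lemma cell_oscillation i (p : grid N) x : in_cell o delta x p ->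
  `|u i x - u i (pt p.1 p.2)| <= 2 * slopes p.1 p.2.
Proof.
move=> px; have h1 := px ord0; have h2 := px ord_max.
have E (c z : R) (e : nat) : e%:R <= (z - c) / delta < e%:R + 1 -> 0 <= z - (c + delta * e%:R) <= delta.
  rewrite ler_pdivlMr// ltr_pdivrMr// mulrDl mul1r [e%:R * _]mulrC; lra.
have {}h1 : 0 <= x.1 - (pt p.1 p.2).1 <= delta by apply: E; exact: h1.
have {}h2 : 0 <= x.2 - (pt p.1 p.2).2 <= delta by apply: E; exact: h2.
have := @row_step i p.1 p.2 _ _ h1 h2; have := @col_step i p.1 p.2 _ 0 h2 step_0.
rewrite !addr0.
rewrite ![_ + (_ - _)]addrC !subrK -!surjective_pairing => H1 H2.
have := ler_distD (u i ((pt p.1 p.2).1, x.2)) (u i x) (u i (pt p.1 p.2)); lra.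
Qed.

Let m (p : grid N) : R := gridmax n slopes p.1 p.2.

Let grid_le (p : grid N) : (p.1 <= n)%N /\ (p.2 <= n)%N.
Proof. by split; rewrite -ltnS; exact: ltn_ord. Qed.

Lemma inner_increment i (p q : grid N) :
  `|u i (pt p.1 p.2) - u i (pt q.1 q.2)| <= 6 * (m p + m q) * (dd (gp p) (gp q))%:R.
Proof.
have [p1 p2] := grid_le p; have [q1 q2] := grid_le q.
have [d0|d0] := posnP (dd (gp p) (gp q)).
  have : (dd (gp p) (gp q) <= 0)%N by rewrite d0.
  rewrite dd_le /= !addn0 => /and4P[a1 a2 a3 a4].
  rewrite (_ : q.1 = p.1 :> nat); last by apply/eqP; rewrite eqn_leq a2.
  rewrite (_ : q.2 = p.2 :> nat); last by apply/eqP; rewrite eqn_leq a4.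
  by rewrite subrr normr0 mulr_ge0 ?ler0n// mulr_ge0 ?ler0n// addr_ge0 ?gridmax_ge0.
have := leqnn (dd (gp p) (gp q)); rewrite {1}/dd geq_max => /andP[h1 h2].
rewrite [leRHS]mulrC; apply: le_trans (two_point (phi := phi i) slopes_ge0 _ _ p1 p2 q1 q2 _ h1 h2) _ => //.
- by rewrite d0 dd_le /= !(leq_trans _ (leq_addl _ _)).
Qed.

Lemma inner_in (p : grid N) y : inner p ->
  `|y.1 - (pt p.1 p.2).1| <= delta -> `|y.2 - (pt p.1 p.2).2| <= delta -> O y.
Proof.
move=> /asboolP H h1 h2; have [k0 k1] := andP k01.
have k4 : delta < 4 / k * delta.
  by rewrite ltr_pMl// ltr_pdivlMr// mul1r (le_lt_trans k1)// ltrDl.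
by apply: H; [apply: le_lt_trans h1 _|apply: le_lt_trans h2 _].
Qed.

Lemma inner_range (p : grid N) : inner p -> (0 < p.1 < n)%N /\ (0 < p.2 < n)%N.
Proof.
move=> /inner_in H; have /OM[] : O (pt p.1 p.2) by apply: H; rewrite subrr normr0 ltW.
have E (e : nat) : `|- (2 * M) + delta * e%:R| < M -> (0 < e < n)%N.
  rewrite ltr_norml => /andP[h1 h2]; apply/andP; split.
    rewrite lt0n; apply/eqP => e0; by move: h1 M0; rewrite e0 mulr0 addr0 => a b; suff : M < M; [rewrite ltxx|lra].
  by rewrite -(ltr_nat R) -(ltr_pM2l delta0) deltan; have := M0; lra.
by move=> /E h1 /E h2.
Qed.

(** Near [q] there is a point outside [O], hence an exterior square whose size and distance are
    comparable to [r0 = d + 4 / k] mesh widths. The nodes in that square are zeros of [u], found in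
    a fixed proportion of the columns at distance [3 r0], so [columns_zero] applies with ratio
    [3 / k]; and [r0 <= (1 + 4 / k) d] since [d >= 1]. *)
Lemma inner_decay i (p q : grid N) : inner p -> ~~ inner q ->
  `|u i (pt p.1 p.2)| <= 3 * (1 + 4 / k) * (2 + 8 * (3 / k)) * m p * (dd (gp p) (gp q))%:R.
Proof.
move=> ip iq; have [k0 k1] := andP k01.
have [p1 p2] := grid_le p; have [q1 q2] := grid_le q.
set d := dd _ _.
have d0 : (0 < d)%N.
  rewrite lt0n; apply/eqP => /eqP; rewrite -leqn0 /d dd_le /= !addn0 => /and4P[a1 a2 a3 a4].
  move: iq; rewrite (_ : q = p) ?ip// [LHS]surjective_pairing [RHS]surjective_pairing.
  by congr (_, _); apply/val_inj/eqP; rewrite /= eqn_leq ?a2 ?a4.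
have dn_ : (d <= n)%N by rewrite /d dd_le /= !(leq_trans _ (leq_addl _ _)).
have d1 : 1 <= d%:R :> R by rewrite ler1n.
have [d1' d2'] : `|p.1%:R - q.1%:R : R| <= d%:R /\ `|p.2%:R - q.2%:R : R| <= d%:R.
  have := leqnn d; rewrite {1}/d dd_le /= => /and4P[].
  rewrite -!(ler_nat R) !natrD => a1 a2 a3 a4.
  by split; apply: dist_le.
clearbody d.
move: iq => /asboolPn/existsNP[y /not_implyP[y1 /not_implyP[y2 Oy]]].
have k4 : 0 < 4 / k :> R by rewrite divr_gt0.
set s := (d%:R + 4 / k) * delta.
have s0 : 0 < s by rewrite mulr_gt0// addr_gt0// ltr0n.
have s16 : s <= 16 * M.
  rewrite /s mulrDl; have : d%:R * delta <= 4 * M by rewrite -deltan mulrC ler_pM2l// ler_nat.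
  by move: fine_mesh M0; lra.
have ptd a b (z : R) : `|z - (o.1 + delta * b)| < 4 / k * delta -> `|a - b| <= d%:R ->
    `|z - (o.1 + delta * a)| <= s.
  move=> h1 h2; have : `|delta * a - delta * b| <= d%:R * delta.
    by rewrite -mulrBr normrM gtr0_norm// mulrC ler_pM2r.
  move: h1 h2; rewrite /s mulrDl ltr_norml !ler_norml; lra.
have Op : O (pt p.1 p.2) by apply: (inner_in ip); rewrite subrr normr0 ltW.
set r0 := d%:R + 4 / k; set kap := k * r0.
have kapE : k * s = delta * kap by rewrite /kap /s -/r0; ring.
have [|||z [zO z1 z2 zM1 zM2]] := extk (x := pt p.1 p.2) (y := y) (s := s) Op Oy.
- by rewrite s0.
- exact: ptd y1 d1'.
- exact: ptd y2 d2'.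
have Zspec (e : nat) (c : R) : `|c - (- (2 * M) + delta * e%:R)| <= 2 * s -> `|c| + k * s <= 2 * M ->
    exists Z : R, [/\ c = - (2 * M) + delta * Z, kap <= Z, Z + kap <= n%:R & `|e%:R - Z| <= 2 * r0].
  move=> h1 h2; pose Z := (c + 2 * M) / delta.
  have cZ : c = - (2 * M) + delta * Z by rewrite /Z [delta * _]mulrC mulfVK ?gt_eqF//; ring.
  clearbody Z.
  have := h2; rewrite -lerBrDr ler_norml => /andP[h3 h4].
  exists Z; split => //.
  - rewrite -(ler_pM2l delta0) -kapE; move: h3; rewrite cZ; lra.
  - rewrite -(ler_pM2l delta0) mulrDr deltan -kapE; move: h4; rewrite cZ; lra.
  - have hE : c - (- (2 * M) + delta * e%:R) = - (delta * (e%:R - Z)) by rewrite cZ; ring.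
    move: h1; rewrite hE normrN normrM (gtr0_norm delta0) (_ : 2 * s = delta * (2 * r0)).
      by rewrite (ler_pM2l delta0).
    by rewrite /s -/r0; ring.
have [Z1 [z1E Z1l Z1r Z1p]] := Zspec _ _ z1 zM1.
have [Z2 [z2E Z2l Z2r Z2p]] := Zspec _ _ z2 zM2.
(* The margin [4 / k] of [inner] gives the exterior square a half-side of at least four mesh widths,
   so that it contains nodes. *)
have kap4 : 4 <= kap.
  by rewrite /kap mulrDr [k * (4 / k)]mulrC mulfVK ?gt_eqF// lerDr mulr_ge0 ?ler0n// ltW.
have kapr : kap <= r0 by rewrite ler_piMl// addr_ge0 ?ler0n// ltW.
(* The successor makes [c] lie strictly to the right of [Z1 - kap]; the columns [c..c+w] then end at
   most at [Z1 + 1], inside the square. The radius [3 r0] is the distance [2 r0] to the centre plus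
   a half-side at most [r0]. *)
pose c := (Num.truncn (Z1 - kap)).+1; pose w := Num.truncn kap.
pose t := Num.truncn Z2; pose r := Num.truncn (3 * r0).
have [w1 w2] : w%:R <= kap /\ kap < w%:R + 1.
  by apply/andP; rewrite natr1; apply: truncn_itv; lra.
have [c1 c2] : c%:R <= Z1 - kap + 1 /\ Z1 - kap < c%:R.
  have /andP[] := @truncn_itv R (Z1 - kap) ltac:(by rewrite subr_ge0).
  by rewrite -/c /c -natr1; split => //; rewrite lerD2r.
have [t1 t2] : t%:R <= Z2 /\ Z2 < t%:R + 1.
  by apply/andP; rewrite natr1; apply: truncn_itv; lra.
have [r1 r2] : r%:R <= 3 * r0 /\ 3 * r0 < r%:R + 1.
  by apply/andP; rewrite natr1; apply: truncn_itv; lra.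
have nat_le (a b : nat) : a%:R <= b%:R + 3 * r0 -> (a <= b + r)%N.
  by move=> ab; rewrite -ltnS -(ltr_nat R) -natr1 natrD; lra.
have near_nat (a b : nat) (Z e : R) : `|a%:R - Z| <= 2 * r0 -> `|b%:R - Z| <= e -> e <= r0 -> (dn a b <= r)%N.
  rewrite !ler_norml dn_le => /andP[h1 h2] /andP[h3 h4] h5.
  by apply/andP; split; apply: nat_le; lra.
have Z1s (l : nat) : (c <= l <= c + w)%N -> `|l%:R - Z1| < kap.
  rewrite -!(ler_nat R) natrD => /andP[h1 h2]; rewrite ltr_norml; apply/andP; split; lra.
have := @columns_zero R n slopes (phi i) slopes_ge0 (fun a b _ _ => phi_row i a b)
  (fun a b _ _ => phi_col i a b) p.1 p.2 r c w (3 / k) p1 p2.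
move=> /(_ _ _ _ _)/le_trans; apply.
- rewrite -(ler_nat R) natrD; lra.
- rewrite -(ltr_nat R); lra.
- apply: le_trans r1 _; rewrite (_ : 3 * r0 = 3 / k * kap); last by rewrite /kap; field; rewrite gt_eqF.
  by rewrite ler_pM2l ?divr_gt0// -natr1 ltW.
- move=> l /Z1s lZ; split; first exact: near_nat Z1p (ltW lZ) kapr.
  have tZ : `|t%:R - Z2| <= 1 by apply: dist_le; lra.
  exists t; split.
  + rewrite -(ler_nat R); lra.
  + apply: near_nat Z2p tZ _; lra.
  + apply: u_out; apply: zO; rewrite kapE.
      rewrite z1E [_.1]/= opprD addrACA subrr add0r -mulrBr normrM gtr0_norm//.
      by rewrite ltr_pM2l.
    rewrite z2E [_.2]/= opprD addrACA subrr add0r -mulrBr normrM gtr0_norm//.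
    rewrite ltr_pM2l//; lra.
rewrite -/(m p) [leRHS]mulrAC mulrA ler_wpM2r ?gridmax_ge0//.
rewrite [leRHS]mulrAC ler_wpM2r//.
  by rewrite addr_ge0// mulr_ge0// divr_ge0// ltW.
apply: le_trans r1 _; rewrite -mulrA ler_pM2l// (_ : _ * d%:R = d%:R + 4 / k * d%:R); last by ring.
by rewrite /r0 lerD2l ler_peMr// ltW.
Qed.

End Discretisation.

(** * Decomposition of a smooth field on a given fine mesh *)

Section SmoothDecomposition.
Variable R : realType.
Notation T := (R * R)%type.
Variables (O : set T) (M k : R).
Hypothesis M0 : 0 < M.
Hypothesis k01 : 0 < k <= 1.
Hypothesis OM : forall x, O x -> `|x.1| < M /\ `|x.2| < M.
Hypothesis extk : forall (x y : T) s, O x -> ~ O y -> 0 < s <= 16 * M ->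
  `|y.1 - x.1| <= s -> `|y.2 - x.2| <= s ->
  exists z, [/\ forall w, `|w.1 - z.1| < k * s -> `|w.2 - z.2| < k * s -> ~ O w,
    `|z.1 - x.1| <= 2 * s, `|z.2 - x.2| <= 2 * s,
    `|z.1| + k * s <= 2 * M & `|z.2| + k * s <= 2 * M].

Definition corner : T := (- (2 * M), - (2 * M)).
Definition mesh (N : nat) : R := 4 * M / (2 ^ N)%:R.

Lemma mesh_gt0 N : 0 < mesh N.
Proof. by rewrite divr_gt0 ?mulr_gt0// ltr0n expn_gt0. Qed.

Lemma corner_cell N x : O x -> (forall i, (coord i x - coord i corner) / mesh N <= (2 ^ N)%:R) /\
  exists p : grid N, in_cell corner (mesh N) x p.
Proof.
move=> /OM[x1 x2]; have d0 := mesh_gt0 N; have m0 := M0.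
have dn : mesh N * (2 ^ N)%:R = 4 * M by rewrite mulfVK// gt_eqF// ltr0n expn_gt0.
have Z (c : R) : `|c| < M -> 0 <= (c - - (2 * M)) / mesh N < (2 ^ N)%:R.
  rewrite ltr_norml => /andP[h1 h2]; rewrite divr_ge0 ?(ltW d0)//=; last lra.
  rewrite ltr_pdivrMr// [ltRHS]mulrC dn; lra.
have Zi i : 0 <= (coord i x - coord i corner) / mesh N < (2 ^ N)%:R.
  by rewrite /coord; case: ifP => _; exact: Z.
split=> [i|]; first by have /andP[_ /ltW] := Zi i.
have K i : (Num.truncn ((coord i x - coord i corner) / mesh N) < (2 ^ N).+1)%N.
  by have /andP[h1 h2] := Zi i; rewrite ltnS ltnW// -(ltr_nat R) (le_lt_trans _ h2)//
    truncn_le.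
exists (Ordinal (K ord0), Ordinal (K ord_max)) => i.
have /andP[h1 _] := Zi i; rewrite natr1.
have := truncn_itv h1.
by rewrite {1 4}/coord/=; have := Zi i; rewrite /coord; case: ifP.
Qed.

Lemma grid_sum N (f : nat -> nat -> R) :
  \sum_(p : grid N) f p.1 p.2 = \sum_(a < (2 ^ N).+1) \sum_(b < (2 ^ N).+1) f a b.
Proof. by rewrite pair_bigA. Qed.

Lemma mesh_decomposition : exists C : R, 0 < C /\
  forall N (u : 'I_2 -> T -> R) (eps eta : R), (forall i, smooth (u i)) -> 0 < eps -> 0 < eta ->
  (forall i x, ~ O x -> u i x = 0) ->
  (forall x y, `|x.1 - y.1| <= mesh N -> `|x.2 - y.2| <= mesh N ->
     gradsum u x <= gradsum u y + eps) ->
  4 / k * mesh N <= M ->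
  (forall i (p : grid N), ~~ inner O M k p -> u i (pt M N p.1 p.2) = 0) ->
  exists h, Cc_inf O h /\ forall x (p : grid N), O x -> in_cell corner (mesh N) x p ->
    (forall i, `|partial i h x - u i x| <=
       C * (Num.sqrt (\sum_(c : grid N) slopes M N u eps c.1 c.2 ^+ 2) + eta)) /\
    (forall s, (size s <= 2)%N -> `|iter_partial s h x| <=
       C / mesh N * gridmax (2 ^ N) (slopes M N u eps) p.1 p.2).
Proof.
have [k0 k1] := andP k01; have m0 := M0.
(* The constants of [inner_increment] and of [inner_decay], added so that one [A] serves both. *)
pose A := 6 + 3 * (1 + 4 / k) * (2 + 8 * (3 / k)).
have B0 : 0 <= 3 * (1 + 4 / k) * (2 + 8 * (3 / k)).
  have k4 (c : R) : 0 <= c -> 0 <= c / k by move=> c0; rewrite divr_ge0// ltW.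
  apply: mulr_ge0 (mulr_ge0 (ler0n R 3) (addr_ge0 ler01 (k4 4 (ler0n R 4)))) _.
  exact: addr_ge0 (ler0n R 2) (mulr_ge0 (ler0n R 8) (k4 3 (ler0n R 3))).
have A0 : 0 < A by rewrite /A; lra.
have [C [C0 HC]] := grid_decomposition A0.
pose S := Num.sqrt (gridmax_const 2 : R).
have S0 : 0 <= S := sqrtr_ge0 _.
have W0 : 0 < C * (1 + 4 * M) ^+ 2 by rewrite mulr_gt0// exprn_gt0// addr_gt0// mulr_gt0.
have V0 : 0 < C * (5 * S + 2) by rewrite mulr_gt0// ltr_wpDl// mulr_ge0.
exists (C * (5 * S + 2) + 2 + C * (1 + 4 * M) ^+ 2); split; first lra.
move=> N u eps eta su e0 eta0 u_out osc fine uin.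
have d0 := mesh_gt0 N.
pose m (p : grid N) := gridmax (2 ^ N) (slopes M N u eps) p.1 p.2.
pose E := \sum_p m p ^+ 2.
have n0 : 0 < (2 ^ N)%:R :> R by rewrite ltr0n expn_gt0.
(* The lowest level times the width of the grid is comparable to the norm of [m]; [eta] keeps it
   positive when [m] vanishes. *)
pose tau := (Num.sqrt E + eta) / (2 ^ N)%:R.
have tau0 : 0 < tau by rewrite divr_gt0// ltr_wpDl// sqrtr_ge0.
have [K [K1 K2]] := lev_bracket tau0 (sqrtr_ge0 E).
have mE p : m p <= Num.sqrt E.
  rewrite -(ler_pXn2r (n := 2)) ?nnegrE ?sqrtr_ge0 ?gridmax_ge0// sqr_sqrtr.
    by rewrite /E (bigD1 p)//= lerDl sumr_ge0// => q _; rewrite sqr_ge0.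
  by apply: sumr_ge0 => q _; rewrite sqr_ge0.
pose F := \sum_(c : grid N) slopes M N u eps c.1 c.2 ^+ 2.
have F0 : 0 <= F by apply: sumr_ge0 => q _; rewrite sqr_ge0.
have sF (p : grid N) : slopes M N u eps p.1 p.2 <= Num.sqrt F.
  rewrite -(ler_pXn2r (n := 2)) ?nnegrE ?sqrtr_ge0 ?slopes_ge0// sqr_sqrtr//.
  by rewrite /F (bigD1 p)//= lerDl sumr_ge0// => q _; rewrite sqr_ge0.
have EF : Num.sqrt E <= S * Num.sqrt F.
  rewrite -sqrtrM; last by rewrite mulr_ge0 ?powR_ge0// addr_ge0 ?sqr_ge0 ?mulr_ge0 ?powR_ge0.
  rewrite ler_wsqrtr// /E /F /m (grid_sum N (fun a b => gridmax (2 ^ N) (slopes M N u eps) a b ^+ 2)).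
  rewrite (grid_sum N (fun a b => slopes M N u eps a b ^+ 2)).
  have := gridmax_Lp (2 ^ N) (lexx 2) (fun a b => slopes_ge0 M0 N u e0 a b).
  under eq_bigr do under eq_bigr do rewrite powR_mulrn ?gridmax_ge0//.
  by under [in leRHS]eq_bigr do under eq_bigr do rewrite powR_mulrn ?slopes_ge0//.
have [|||||h [Ch hb]] := HC N corner (mesh N) tau K m (inner O M k (N := N))
    (fun i p => u i (pt M N p.1 p.2)) d0 tau0.
- by move=> p; rewrite gridmax_ge0 (le_trans (mE p)).
- by move=> p /(inner_range M0 k01 OM).
- move=> i p q _ _.
  apply: le_trans (inner_increment M0 su e0 osc i p q) _.
  apply: ler_wpM2r; first exact: ler0n.
  apply: ler_wpM2r; first by apply: addr_ge0; exact: gridmax_ge0.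
  by rewrite lerDl.
- move=> i p q ip iq.
  apply: le_trans (inner_decay M0 k01 extk su e0 u_out osc fine i ip iq) _.
  apply: ler_wpM2r; first exact: ler0n.
  apply: ler_wpM2r; first exact: gridmax_ge0.
  by rewrite lerDr.
- by move=> i q /uin ->.
have scaled (z c : R) (e : nat) : `|(z - c) / mesh N - e%:R| <= 1 -> `|z - (c + mesh N * e%:R)| <= mesh N.
  have -> : z - (c + mesh N * e%:R) = mesh N * ((z - c) / mesh N - e%:R) by field; rewrite gt_eqF.
  by rewrite normrM (gtr0_norm d0) ger_pMr.
exists h; split.
  apply: Ch => q y iq H; apply: (inner_in M0 k01 iq).
    exact: scaled (H ord0).
  exact: scaled (H ord_max).
move=> x p Ox px; have [xn _] := corner_cell N Ox.
have [hb1 hb2] := hb x p px xn; split=> [i|s s2].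
  have h1 := hb1 i; have h2 := cell_oscillation M0 su e0 osc i px.
  rewrite -/F; move: h1; rewrite mulfVK ?gt_eqF//.
  have tle : tau <= Num.sqrt E + eta.
    by rewrite ler_pdivrMr// ler_peMr ?ler1n ?expn_gt0// addr_ge0 ?sqrtr_ge0// ltW.
  have {}h2 := le_trans h2 (ler_wpM2l (ler0n R 2) (sF p)).
  have := ler_distD (u i (pt M N p.1 p.2)) (partial i h x) (u i x).
  rewrite [`|u i (pt M N p.1 p.2) - _|]distrC => h3 h1.
  (* Here [lev tau K <= tau + 2 sqrt E] and [tau <= sqrt E + eta]: five times [sqrt E] and twice
     [eta] in all. *)
  have CE : C * (Num.sqrt E + (Num.sqrt E + eta) + lev tau K) <=
      C * (5 * S + 2) * (Num.sqrt F + eta).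
    rewrite -mulrA ler_pM2l//.
    apply: (@le_trans _ _ (5 * Num.sqrt E + 2 * eta)); first lra.
    rewrite mulrDr lerD//.
      apply: (@le_trans _ _ (5 * (S * Num.sqrt F))); first by rewrite ler_pM2l.
      by rewrite mulrA ler_wpM2r ?sqrtr_ge0// lerDl.
    by rewrite ler_pM2r// lerDr mulr_ge0.
  have Fe : 0 <= Num.sqrt F + eta by rewrite addr_ge0 ?sqrtr_ge0// ltW.
  have := mulr_ge0 (ltW W0) Fe; rewrite !mulrDl.
  move: CE h1 h2 h3; rewrite !mulrDl /=; lra.
apply: le_trans (hb2 s s2) _; rewrite ler_wpM2r ?gridmax_ge0//.
rewrite mulrA ler_pM2r ?invr_gt0// -natrX /mesh mulfVK ?gt_eqF//.
by rewrite lerDr; lra.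
Qed.

End SmoothDecomposition.

(** * Integrals of nonnegative functions on subsets of the plane *)

Section PlaneIntegrals.
Variable R : realType.
Notation T := (R * R)%type.
Implicit Types (D : set T) (f g : T -> R).

Definition intr D f : \bar R := (\int[@leb2 R]_(x in D) (f x)%:E)%E.

Lemma measurable_powRf D f r : measurable_fun D f -> measurable_fun D (fun x => f x `^ r).
Proof. by move=> mf; apply: (measurableT_comp (measurable_powR r)). Qed.

Lemma intr_ge0 D f : (forall x, 0 <= f x) -> (0 <= intr D f)%E.
Proof. by move=> f0; apply: integral_ge0 => x _; rewrite lee_fin. Qed.

Lemma intr_le D f g : measurable D -> measurable_fun D f -> measurable_fun D g ->
  (forall x, 0 <= f x) -> (forall x, D x -> f x <= g x) -> (intr D f <= intr D g)%E.
Proof.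
move=> mD mf mg f0 fg.
apply: (@ge0_le_integral _ _ _ (@leb2 R) D mD (EFin \o f) (EFin \o g)) => //.
- by move=> x _; rewrite lee_fin.
- exact/measurable_EFinP.
- exact/measurable_EFinP.
Qed.

Lemma intrD D f g : measurable D -> measurable_fun D f -> measurable_fun D g ->
  (forall x, 0 <= f x) -> (forall x, 0 <= g x) ->
  intr D (fun x => f x + g x) = (intr D f + intr D g)%E.
Proof.
move=> mD mf mg f0 g0; rewrite /intr.
apply: (@ge0_integralD _ _ _ (@leb2 R) D mD (EFin \o f) (EFin \o g)) => //.
- by move=> x _; rewrite lee_fin.
- exact/measurable_EFinP.
- by move=> x _; rewrite lee_fin.
- exact/measurable_EFinP.
Qed.

Lemma intrZ D c f : measurable D -> measurable_fun D f -> 0 <= c ->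
  (forall x, 0 <= f x) -> intr D (fun x => c * f x) = (c%:E * intr D f)%E.
Proof.
move=> mD mf c0 f0; rewrite /intr.
apply: (@ge0_integralZl_EFin _ _ _ (@leb2 R) D mD (EFin \o f)) => //.
- by move=> x _; rewrite lee_fin.
- exact/measurable_EFinP.
Qed.

Lemma intr_cst D c : measurable D -> intr D (fun=> c) = (c%:E * leb2 D)%E.
Proof. by move=> mD; exact: integral_cst. Qed.

Lemma intr_subset D D' f : measurable D -> measurable D' -> measurable_fun D' f ->
  (forall x, 0 <= f x) -> D `<=` D' -> (intr D f <= intr D' f)%E.
Proof.
move=> mD mD' mf f0 DD'; apply: ge0_subset_integral => //.
- exact/measurable_EFinP.
- by move=> x _; rewrite lee_fin.
Qed.

Lemma intr_support D f : (forall x, ~ D x -> f x = 0) -> intr setT f = intr D f.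
Proof.
move=> f0; rewrite /intr [RHS]integral_mkcond; apply: eq_integral => x _.
by rewrite /patch; case: ifPn => // /negP; rewrite in_setE => /f0 ->.
Qed.

End PlaneIntegrals.

(** * Choice of the mesh, and the potential of a smooth field *)

Section SmoothPotential.
Variable R : realType.
Notation T := (R * R)%type.

Lemma lipschitz_of_partial (v : T -> R) (B : R) x y : smooth v -> (forall i z, `|partial i v z| <= B) ->
  `|v x - v y| <= B * (`|x.1 - y.1| + `|x.2 - y.2|).
Proof.
move=> sv vB.
have row a b t : `|v (a, t) - v (b, t)| <= B * `|a - b|.
  wlog ab : a b / b <= a.
    by move=> H; case: (leP b a) => [/H//|/ltW /H]; rewrite distrC (distrC b).
  rewrite (ger0_norm (x := a - b)) ?subr_ge0//.
  by apply: row_increment.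
have col a b t : `|v (t, a) - v (t, b)| <= B * `|a - b|.
  wlog ab : a b / b <= a.
    by move=> H; case: (leP b a) => [/H//|/ltW /H]; rewrite distrC (distrC b).
  rewrite (ger0_norm (x := a - b)) ?subr_ge0//.
  by apply: col_increment.
have := ler_distD (v (y.1, x.2)) (v x) (v y).
have := row x.1 y.1 x.2; have := col x.2 y.2 y.1.
rewrite -!surjective_pairing mulrDr; lra.
Qed.

(** The second derivatives are bounded, so the first ones are Lipschitz; each of the four gets a
    quarter of [eps]. *)
Lemma gradsum_osc (O : set T) (u : 'I_2 -> T -> R) (eps : R) : (forall i, Cc_inf O (u i)) -> 0 < eps ->
  exists r : R, 0 < r /\ forall x y, `|x.1 - y.1| <= r -> `|x.2 - y.2| <= r ->
  gradsum u x <= gradsum u y + eps.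
Proof.
move=> cu e0.
have [B [B0 HB]] : exists B : R, 0 <= B /\ forall i j l x, `|partial l (partial j (u i)) x| <= B.
  have /boolp.choice[b bP] : forall t : 'I_2 * 'I_2 * 'I_2, exists B : R, 0 <= B /\
      forall x, `|partial t.2 (partial t.1.2 (u t.1.1)) x| <= B.
    by move=> t; have := Cc_inf_bounded (Cc_inf_iter_partial [:: t.2; t.1.2] (cu t.1.1)).
  exists (\sum_t b t); split; first by apply: sumr_ge0 => t _; exact: (bP t).1.
  move=> i j l x; apply: le_trans ((bP (i, j, l)).2 x) _.
  by rewrite (bigD1 (i, j, l))//= lerDl sumr_ge0// => t _; exact: (bP t).1.
exists (eps / (8 * (B + 1))); split; first by rewrite divr_gt0// mulr_gt0// ltr_wpDl.
move=> x y h1 h2.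
have step i j : `|partial j (u i) x| <= `|partial j (u i) y| + eps / 4.
  have := @lipschitz_of_partial (partial j (u i)) B x y (smooth_iter_partial [:: j] (cu i).1)
    (HB i j).
  have h : B * (`|x.1 - y.1| + `|x.2 - y.2|) <= eps / 4.
    apply: (@le_trans _ _ ((B + 1) * (eps / (8 * (B + 1)) + eps / (8 * (B + 1))))).
      by apply: ler_pM; rewrite ?addr_ge0//; [rewrite lerDl|exact: lerD].
    by rewrite le_eqVlt; apply/orP; left; apply/eqP; field; rewrite gt_eqF// ltr_wpDl.
  have := ler_distD 0 (partial j (u i) x) (partial j (u i) y); rewrite subr0.
  have := lerB_dist (partial j (u i) x) (partial j (u i) y); lra.
apply: (@le_trans _ _ (\sum_i \sum_j (`|partial j (u i) y| + eps / 4))).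
  by apply: ler_sum => i _; apply: ler_sum => j _; exact: step.
rewrite /gradsum !big_ord_recl !big_ord0 /=; lra.
Qed.

(** The supports stay at a positive distance from the complement of [O]; once the margin of [inner]
    is below that distance, the nodes that are not inner carry no value. *)
Lemma inner_support (O : set T) (M k : R) (u : 'I_2 -> T -> R) : open O -> (forall i, Cc_inf O (u i)) ->
  exists r : R, 0 < r /\ forall N, 4 / k * mesh M N < r ->
  forall i (p : grid N), ~~ inner O M k p -> u i (pt M N p.1 p.2) = 0.
Proof.
move=> oO cu.
have /boolp.choice[r rP] : forall i, exists r : R, 0 < r /\ forall x y, u i x <> 0 ->
    `|x.1 - y.1| < r -> `|x.2 - y.2| < r -> O y.
  move=> i; have [_ [K [cK KO Ku]]] := cu i.
  have [r [r0 rH]] := compact_in_open cK oO KO; exists r; split => // x y ux.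
  by apply: rH; apply: contrapT => /Ku.
exists (Num.min (r ord0) (r ord_max)); split; first by rewrite lt_min !(rP _).1.
move=> N; rewrite lt_min => /andP[r1 r2] i p ip; apply: contrapT => up.
case/negP: ip; apply/asboolP => y h1 h2.
have ri : 4 / k * mesh M N < r i by have [->|->] : i = ord0 \/ i = ord_max by
  case: i up => -[|[|//]] ? _; [left|right]; exact: val_inj.
by apply: (rP i).2 up _ _; rewrite distrC; [exact: lt_trans h1 ri|exact: lt_trans h2 ri].
Qed.

Lemma mesh_small (M t : R) : 0 < M -> 0 < t -> exists N, mesh M N <= t.
Proof.
move=> M0 t0; pose N := Num.truncn (4 * M / t); exists N.
have N0 : 0 < (2 ^ N)%:R :> R by rewrite ltr0n expn_gt0.
rewrite /mesh ler_pdivrMr// [leRHS]mulrC -ler_pdivrMr//.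
apply: ltW; apply: lt_le_trans (truncnS_gt _) _.
by rewrite ler_nat ltn_expl.
Qed.

Lemma measurable_gradsum (O D : set T) (u : 'I_2 -> T -> R) : measurable D -> (forall i, Cc_inf O (u i)) ->
  measurable_fun D (gradsum u).
Proof.
move=> mD cu; apply: measurable_sum => i; apply: measurable_sum => j.
apply: measurableT_comp => //; apply: continuous_measurable2 => //.
exact: smooth_continuous (smooth_iter_partial [:: j] (cu i).1).
Qed.

Lemma gradsum_out (O : set T) (u : 'I_2 -> T -> R) x : (forall i, Cc_inf O (u i)) -> ~ O x -> gradsum u x = 0.
Proof.
move=> cu Ox; rewrite /gradsum big1// => i _; rewrite big1// => j _.
have [_ [K [cK KO Ku]]] := cu i.
have -> : partial j (u i) x = 0; last by rewrite normr0.
apply: (iter_partial_support [:: j] (compact_closed (@hausdorffT R) cK) Ku).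
by move=> /KO.
Qed.

(** A Riemann sum against an integral: one [eps] comes from [slopes], another from comparing the
    node with the points of its cell. *)
Lemma sum_slopes_le (O : set T) (M : R) N (u : 'I_2 -> T -> R) (eps r L : R) : 0 < M ->
  (forall x, O x -> `|x.1| < M /\ `|x.2| < M) -> (forall i, Cc_inf O (u i)) -> 0 < eps -> 0 < r ->
  mesh M N <= M ->
  (forall x y, `|x.1 - y.1| <= mesh M N -> `|x.2 - y.2| <= mesh M N ->
     gradsum u x <= gradsum u y + eps) ->
  (intr O (fun x => gradsum u x `^ r)%R <= L%:E)%E ->
  \sum_(p : grid N) (gradsum u (pt M N p.1 p.2) + eps) `^ r * mesh M N ^+ 2 <=
  2 `^ r * (L + (2 * eps) `^ r * (36 * M ^+ 2)).
Proof.
move=> M0 OM cu e0 r0 fine osc HL; have d0 := mesh_gt0 M0 N.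
have dn : mesh M N * (2 ^ N)%:R = 4 * M by rewrite mulfVK// gt_eqF// ltr0n expn_gt0.
have g0 x := gradsum_ge0 u x.
have ge x : 0 <= gradsum u x + eps by rewrite addr_ge0// ltW.
have e2 : 0 <= 2 * eps by rewrite mulr_ge0// ltW.
(* The cells of the last nodes stick out of [[-2M, 2M]^2] by one mesh width, at most [M]; the
   enlarged box has area [36 M^2]. *)
pose D : set T := `[- (3 * M), 3 * M[%classic `*` `[- (3 * M), 3 * M[%classic.
have mD : measurable D by apply: measurableX; exact: measurable_itv.
have mg D' : measurable D' -> measurable_fun D' (gradsum u) by move=> mD'; exact: measurable_gradsum mD' cu.
rewrite -lee_fin; apply: (@le_trans _ _ (intr D (fun x => (gradsum u x + 2 * eps) `^ r))).
  apply: (@cells_le_integral R N (corner M) (mesh M N) (fun p => (gradsum u (pt M N p.1 p.2) + eps) `^ r)) => //.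
  - by move=> p; exact: powR_ge0.
  - by apply: measurable_powRf; apply: measurable_funD => //; exact: mg.
  - by move=> x; exact: powR_ge0.
  move=> x p px.
  have E (c : R) (e : nat) : (e <= 2 ^ N)%N -> e%:R <= (c - - (2 * M)) / mesh M N < e%:R + 1 ->
      [/\ `|- (2 * M) + mesh M N * e%:R - c| <= mesh M N, - (3 * M) <= c & c < 3 * M].
    rewrite -(ler_nat R) -(ler_pM2l d0) dn ler_pdivlMr// ltr_pdivrMr// mulrDl mul1r [e%:R * _]mulrC.
    have : 0 <= mesh M N * e%:R by rewrite mulr_ge0// ltW.
    by move=> h1 h2 /andP[h3 h4]; split; rewrite ?ler_norml; lra.
  have [a1 a2 a3] := E _ _ (ltn_ord p.1) (px ord0).
  have [b1 b2 b3] := E _ _ (ltn_ord p.2) (px ord_max).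
  split; first by split; rewrite /= in_itv/= ?a2 ?a3 ?b2 ?b3.
  apply: (ge0_ler_powR (ltW r0)); first by rewrite nnegrE.
    by rewrite nnegrE addr_ge0.
  have := osc (pt M N p.1 p.2) x a1 b1; lra.
apply: (@le_trans _ _ (intr D (fun x => 2 `^ r * (gradsum u x `^ r + (2 * eps) `^ r)))).
  apply: intr_le => //.
  - by apply: measurable_powRf; apply: measurable_funD => //; exact: mg.
  - by apply: measurable_funM => //; apply: measurable_funD => //; apply: measurable_powRf; exact: mg.
  - by move=> x; exact: powR_ge0.
  - by move=> x _; apply: powR_sum2 => //; exact: ltW.
have mr D' : measurable D' -> measurable_fun D' (fun x => gradsum u x `^ r).
  by move=> mD'; apply: measurable_powRf; exact: mg.
have p0 (x y : R) : 0 <= x `^ y := powR_ge0 x y.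
rewrite intrZ//; last 2 first.
- by apply: measurable_funD => //; exact: mr.
- by move=> x; rewrite addr_ge0.
rewrite EFinM; apply: lee_wpmul2l; first by rewrite lee_fin.
rewrite intrD//; last exact: mr.
rewrite EFinD leeD//; last first.
  rewrite intr_cst// [leb2 D]leb2_rect; [|lra..].
  by rewrite -EFinM lee_fin le_eqVlt; apply/orP; left; apply/eqP; ring.
apply: le_trans HL; rewrite -[leRHS](intr_support (D := O)).
  apply: intr_subset => //; exact: mr.
by move=> x Ox; rewrite (gradsum_out cu Ox) powR0// gt_eqF.
Qed.

Lemma sum_slopes_bound (O : set T) (M : R) N (u : 'I_2 -> T -> R) (eps eta r L : R) : 0 < M ->
  (forall x, O x -> `|x.1| < M /\ `|x.2| < M) -> (forall i, Cc_inf O (u i)) -> 0 < eps -> 1 <= r ->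
  mesh M N <= M ->
  (forall x y, `|x.1 - y.1| <= mesh M N -> `|x.2 - y.2| <= mesh M N ->
     gradsum u x <= gradsum u y + eps) ->
  2 * eps * (1 + 36 * M ^+ 2) <= eta -> 0 <= L ->
  (intr O (fun x => gradsum u x `^ r)%R <= (L `^ r)%:E)%E ->
  \sum_(p : grid N) (gradsum u (pt M N p.1 p.2) + eps) `^ r * mesh M N ^+ 2 <=
  2 * (2 * (L + eta)) `^ r.
Proof.
move=> M0 OM cu e0 r1 fine osc epsM L0 HL.
have r0 : 0 < r by apply: lt_le_trans r1.
have B0 : 0 <= 36 * M ^+ 2 by rewrite mulr_ge0 ?sqr_ge0.
have eta0 : 0 <= eta by apply: le_trans epsM; rewrite mulr_ge0 ?addr_ge0// mulr_ge0// ltW.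
have e2 : 0 <= 2 * eps by rewrite mulr_ge0// ltW.
apply: le_trans (sum_slopes_le M0 OM cu e0 r0 fine osc HL) _.
rewrite [(2 * (L + eta)) `^ r]powRM ?addr_ge0// [leRHS]mulrCA ler_wpM2l ?powR_ge0//.
have mono (a b : R) : 0 <= a -> a <= b -> a `^ r <= b `^ r.
  by move=> a0 ab; apply: ge0_ler_powR; rewrite ?nnegrE ?(ltW r0)//; exact: le_trans ab.
have -> : 2 * (L + eta) `^ r = (L + eta) `^ r + (L + eta) `^ r by ring.
apply: lerD; first by apply: mono => //; rewrite lerDl.
apply: (@le_trans _ _ ((2 * eps * (1 + 36 * M ^+ 2)) `^ r)); last first.
  apply: mono; first by rewrite mulr_ge0// addr_ge0.
  by apply: le_trans epsM _; rewrite lerDr.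
rewrite [leRHS]powRM ?addr_ge0// ler_wpM2l ?powR_ge0//.
by apply: (@le_trans _ _ (1 + 36 * M ^+ 2)); [rewrite lerDr|apply: le1r_powR => //; rewrite lerDl].
Qed.

(** [h] is chosen before [L] and [r], so one function serves both exponents. The mesh depends on [u]
    but the constant does not: [slopes] carries a factor [mesh], which cancels the [1 / mesh] of the
    second derivatives; and in the sup bound the sum of squares of [slopes] is itself a Riemann sum
    of the squared gradient, by scale invariance in dimension two. *)
Lemma smooth_potential (O : set T) (q : R) : 2 < q -> open O -> bounded_set O -> lipschitz_boundary O ->
  exists C : R, 0 < C /\ forall (u : 'I_2 -> T -> R) (eta : R), (forall i, Cc_inf O (u i)) -> 0 < eta ->
  exists h, [/\ Cc_inf O h,
    forall L x i, 0 <= L -> (intr O (fun x => gradsum u x `^ 2)%R <= (L `^ 2)%:E)%E -> O x ->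
      `|partial i h x - u i x| <= C * (L + eta) &
    forall r L s, r = 2 \/ r = q -> 0 <= L -> (intr O (fun x => gradsum u x `^ r)%R <= (L `^ r)%:E)%E ->
      (size s <= 2)%N -> (intr O (fun x => `|iter_partial s h x| `^ r)%R <= ((C * (L + eta)) `^ r)%:E)%E].
Proof.
move=> q2 oO bO lO; have [M [M0 OM]] := bounded_box bO.
have [k [k01 extk]] := exterior_square_box bO oO lO M0 OM.
have [k0 k1] := andP k01.
have [C [C0 HC]] := mesh_decomposition M0 k01 OM extk.
pose G : R := gridmax_const 2 + gridmax_const q.
have gc0 (r : R) : 0 <= gridmax_const r.
  apply: mulr_ge0 (powR_ge0 _ _) (addr_ge0 _ (sqr_ge0 _)).
  by apply: mulr_ge0 (mulr_ge0 _ (powR_ge0 _ _)) (mulr_ge0 _ (powR_ge0 _ _)).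
have G0 : 0 <= G by exact: addr_ge0 (gc0 2) (gc0 q).
have C20 : 0 < C * 2 * (1 + 2 * G).
  by rewrite mulr_gt0 ?mulr_gt0// ltr_pwDl// mulr_ge0.
exists (C * 4 + C * 2 * (1 + 2 * G)); split; first by rewrite addr_gt0// mulr_gt0.
move=> u eta cu eta0.
have B1 : 0 < 1 + 36 * M ^+ 2 by rewrite ltr_pwDl// mulr_ge0 ?sqr_ge0.
pose eps := eta / (2 * (1 + 36 * M ^+ 2)).
have e0 : 0 < eps by rewrite divr_gt0// mulr_gt0.
have epsM : 2 * eps * (1 + 36 * M ^+ 2) <= eta.
  by rewrite le_eqVlt; apply/orP; left; apply/eqP; rewrite /eps; field; rewrite gt_eqF.
have [r1 [r10 osc']] := gradsum_osc cu e0.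
have [r2 [r20 inn]] := inner_support M k oO cu.
(* Three demands on the mesh: oscillation of the gradient, margin of the support (8 instead of 4
   makes the inequality strict) and room in the box. *)
pose t := Num.min r1 (Num.min (k * r2 / 8) (k * M / 4)).
have t0 : 0 < t.
  by rewrite !lt_min r10 /= (divr_gt0 (mulr_gt0 k0 r20))// (divr_gt0 (mulr_gt0 k0 M0)).
have [N] := mesh_small M0 t0.
rewrite !le_min => /and3P[t1 t2 t3]; have d0 := mesh_gt0 M0 N.
have osc x y : `|x.1 - y.1| <= mesh M N -> `|x.2 - y.2| <= mesh M N -> gradsum u x <= gradsum u y + eps.
  by move=> h1 h2; apply: osc'; [exact: le_trans h1 t1|exact: le_trans h2 t1].
have fine : 4 / k * mesh M N <= M.
  by rewrite mulrAC ler_pdivrMr// mulrC -ler_pdivlMr// [M * k]mulrC.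
have fineM : mesh M N <= M.
  apply: le_trans t3 _; rewrite ler_pdivrMr//.
  by rewrite [leRHS]mulrC ler_wpM2r ?(ltW M0)//; lra.
have uin i (p : grid N) : ~~ inner O M k p -> u i (pt M N p.1 p.2) = 0.
  apply: inn; rewrite mulrAC ltr_pdivrMr// mulrC.
  have : mesh M N * 8 <= k * r2 by rewrite -ler_pdivlMr.
  by have := mulr_gt0 k0 r20; rewrite [r2 * k]mulrC; lra.
have u_out i x : ~ O x -> u i x = 0.
  by move=> Ox; have [_ [K [_ KO]]] := cu i; apply => /KO.
have [h [Ch Hh]] := HC N u eps eta (fun i => (cu i).1) e0 eta0 u_out osc fine uin.
exists h; split => //.
  move=> L x i L0 HL Ox.
  have [_ [p px]] := corner_cell M0 OM N Ox.
  have [+ _] := Hh x p Ox px => /(_ i)/le_trans; apply.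
  have Le : 0 <= L + eta by rewrite addr_ge0// ltW.
  set F := \sum_c _.
  have F3 : Num.sqrt F <= 3 * (L + eta).
    rewrite -[leRHS]ger0_norm ?mulr_ge0// -sqrtr_sqr ler_wsqrtr//.
    have := sum_slopes_bound M0 OM cu e0 (ler1n R 2) fineM osc epsM L0 HL.
    rewrite powR_mulrn ?mulr_ge0// => HF.
    apply: (@le_trans _ _ (2 * (2 * (L + eta)) ^+ 2)).
      apply: le_trans HF; rewrite /F le_eqVlt; apply/orP; left; apply/eqP.
      apply: eq_bigr => c _; rewrite /slopes powR_mulrn ?addr_ge0 ?gradsum_ge0 ?(ltW e0)//.
      by rewrite exprMn mulrC.
    rewrite !exprMn mulrA ler_wpM2r ?sqr_ge0//; lra.
  apply: (@le_trans _ _ (C * 4 * (L + eta))).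
    by rewrite -mulrA ler_pM2l//; lra.
  by rewrite ler_wpM2r// lerDl ltW.
move=> r L s rq L0 HL s2.
have r2' : 2 <= r by case: rq => ->; rewrite ?(ltW q2).
have r00 : 0 < r by apply: lt_le_trans r2'.
have Gr : gridmax_const r <= G by rewrite /G; case: rq => ->; rewrite ?lerDl ?lerDr.
have mO := open_measurable2 oO.
pose m (p : grid N) := gridmax (2 ^ N) (slopes M N u eps) p.1 p.2.
apply: (@le_trans _ _ (\sum_(p : grid N) (C / mesh M N * m p) `^ r * mesh M N ^+ 2)%:E).
  have mpos p : 0 <= C / mesh M N * m p.
    exact: mulr_ge0 (divr_ge0 (ltW C0) (ltW d0)) (gridmax_ge0 _ _ _ _).
  apply: (@integral_le_cells R N (corner M) (mesh M N) (fun p => (C / mesh M N * m p) `^ r)) => //.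
  - by move=> p; exact: powR_ge0.
  - apply: measurable_powRf; apply: measurableT_comp => //.
    by apply: continuous_measurable2 => //; apply: smooth_continuous; exact: smooth_iter_partial Ch.1.
  move=> x Ox; have [_ [p px]] := corner_cell M0 OM N Ox; exists p => //.
  apply: (ge0_ler_powR (ltW r00)); rewrite ?nnegrE//.
  by have [_ +] := Hh x p Ox px; exact.
rewrite lee_fin.
have Le : 0 <= L + eta by rewrite addr_ge0// ltW.
have := sum_slopes_bound M0 OM cu e0 (le_trans (ler1n R 2) r2') fineM osc epsM L0 HL.
set S := \sum_p _ => HS.
have sumE : (\sum_(p : grid N) slopes M N u eps p.1 p.2 `^ r) * mesh M N ^+ 2 = mesh M N `^ r * S.
  rewrite /S big_distrl big_distrr/=; apply: eq_bigr => p _.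
  by rewrite /slopes powRM ?(ltW d0) ?addr_ge0 ?gradsum_ge0 ?(ltW e0)// mulrA.
have gm : \sum_(p : grid N) m p `^ r <= G * \sum_(p : grid N) slopes M N u eps p.1 p.2 `^ r.
  rewrite /m (grid_sum N (fun a b => gridmax (2 ^ N) (slopes M N u eps) a b `^ r)).
  rewrite (grid_sum N (fun a b => slopes M N u eps a b `^ r)).
  apply: le_trans (gridmax_Lp (2 ^ N) r2' (fun a b => slopes_ge0 M0 N u e0 a b)) _.
  rewrite ler_wpM2r//; apply: sumr_ge0 => a _; apply: sumr_ge0 => b _; exact: powR_ge0.
have -> : \sum_p (C / mesh M N * m p) `^ r * mesh M N ^+ 2 =
    (C / mesh M N) `^ r * mesh M N ^+ 2 * \sum_p m p `^ r.
  rewrite big_distrr/=; apply: eq_bigr => p _.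
  by rewrite (powRM _ (divr_ge0 (ltW C0) (ltW d0)) (gridmax_ge0 _ _ _ _)) mulrAC.
apply: (@le_trans _ _ (C `^ r * (G * S))).
  apply: le_trans (ler_wpM2l _ gm) _; first by rewrite mulr_ge0 ?powR_ge0 ?sqr_ge0.
  rewrite le_eqVlt; apply/orP; left; apply/eqP.
  have -> : C `^ r = (C / mesh M N) `^ r * mesh M N `^ r.
    by rewrite -(powRM _ (divr_ge0 (ltW C0) (ltW d0)) (ltW d0)) mulfVK// gt_eqF.
  set P := \sum_p _ in sumE *.
  transitivity ((C / mesh M N) `^ r * G * (P * mesh M N ^+ 2)); first by ring.
  by rewrite sumE; ring.
apply: (@le_trans _ _ ((C * 2 * (1 + 2 * G) * (L + eta)) `^ r)); last first.
  apply: (ge0_ler_powR (ltW r00)); rewrite ?nnegrE.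
  - exact: mulr_ge0 (ltW C20) Le.
  - exact: mulr_ge0 (addr_ge0 (mulr_ge0 (ltW C0) (ler0n R 4)) (ltW C20)) Le.
  - by rewrite ler_wpM2r// lerDr mulr_ge0// ltW.
rewrite (_ : C * 2 * _ * _ = C * ((1 + 2 * G) * (2 * (L + eta)))); last by ring.
have g1 : 0 <= 1 + 2 * G by rewrite addr_ge0// mulr_ge0.
have L2 : 0 <= 2 * (L + eta) by rewrite mulr_ge0.
rewrite [leRHS]powRM ?(ltW C0) ?mulr_ge0// ler_wpM2l ?powR_ge0//.
apply: le_trans (ler_wpM2l G0 HS) _.
rewrite mulrA [leRHS]powRM// ler_wpM2r ?powR_ge0//.
apply: (@le_trans _ _ (1 + 2 * G)); first by rewrite [G * 2]mulrC lerDr.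
by apply: le1r_powR; [rewrite lerDl mulr_ge0|exact: le_trans (ler1n R 2) r2'].
Qed.

End SmoothPotential.

(** * Quantitative L^r bounds on a set of finite measure *)

Section LpBounds.
Variable R : realType.
Notation T := (R * R)%type.
Variable O : set T.
Hypothesis mO : measurable O.
Implicit Types (f g : T -> R) (A B r q : R).

(** A bound on the norm stated through its power: it contains finiteness of the integral and avoids
    taking roots until the end. *)
Definition Lle r f B := measurable_fun O f /\ (intr O (fun x => `|f x| `^ r)%R <= (B `^ r)%:E)%E.

Lemma measurable_normr_powR r f : measurable_fun O f -> measurable_fun O (fun x => `|f x| `^ r).
Proof. by move=> mf; apply: measurable_powRf; apply: measurableT_comp. Qed.

Lemma Lle_inLq r f B : 0 < r -> 0 <= B -> Lle r f B -> inLq r O f /\ Lqnorm r O f <= B.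
Proof.
move=> r0 B0 [mf fB].
have I0 : (0 <= intr O (fun x => (`|f x| `^ r)%R))%E by apply: intr_ge0 => x; exact: powR_ge0.
split.
  split=> //; apply/integrableP; split; first by apply/measurable_EFinP; exact: measurable_normr_powR.
  have -> : (\int[@leb2 R]_(x in O) `|(`|f x| `^ r)%:E| = intr O (fun x => (`|f x| `^ r)%R))%E.
    by apply: eq_integral => x _; rewrite gee0_abs// lee_fin powR_ge0.
  by apply: le_lt_trans fB _; rewrite ltry.
rewrite /Lqnorm -/(intr O (fun x => `|f x| `^ r)).
have fin : intr O (fun x => `|f x| `^ r) \is a fin_num.
  by rewrite ge0_fin_numE//; apply: le_lt_trans fB _; rewrite ltry.
rewrite -[leRHS](powRr1 B0) -(@divff _ r) ?gt_eqF// powRrM.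
apply: ge0_ler_powR; rewrite ?nnegrE ?invr_ge0 ?(ltW r0) ?powR_ge0//; first exact: fine_ge0.
by rewrite -lee_fin fineK.
Qed.

Lemma Lqnorm_ge0 r f : 0 <= Lqnorm r O f.
Proof. exact: powR_ge0. Qed.

Lemma inLq_Lle r f : 0 < r -> inLq r O f -> Lle r f (Lqnorm r O f).
Proof.
move=> r0 [mf /integrableP[_ fi]]; split=> //.
have I0 : (0 <= intr O (fun x => (`|f x| `^ r)%R))%E by apply: intr_ge0 => x; exact: powR_ge0.
have fin : intr O (fun x => `|f x| `^ r) \is a fin_num.
  rewrite ge0_fin_numE//; apply: le_lt_trans fi; rewrite le_eqVlt; apply/orP; left; apply/eqP.
  by apply: eq_integral => x _; rewrite gee0_abs// lee_fin powR_ge0.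
rewrite /Lqnorm -/(intr O (fun x => `|f x| `^ r)) -powRrM mulVf ?gt_eqF//.
by rewrite powRr1 ?fineK//; exact: fine_ge0.
Qed.

Lemma LleW r f A B : 0 <= r -> 0 <= A -> A <= B -> Lle r f A -> Lle r f B.
Proof.
move=> r0 A0 AB [mf fA]; split => //; apply: le_trans fA _; rewrite lee_fin.
by apply: ge0_ler_powR => //; rewrite nnegrE// (le_trans A0).
Qed.

Lemma Lle_le r f g B : 0 <= r -> measurable_fun O f -> (forall x, O x -> `|f x| <= `|g x|) ->
  Lle r g B -> Lle r f B.
Proof.
move=> r0 mf fg [mg gB]; split; first exact: mf.
apply: le_trans gB.
apply: intr_le => //; [exact: measurable_normr_powR|exact: measurable_normr_powR|].
by move=> x Ox; apply: ge0_ler_powR => //; rewrite ?nnegrE//; exact: fg.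
Qed.

Lemma eq_Lle r f g B : f =1 g -> Lle r f B -> Lle r g B.
Proof. by move=> /funext ->. Qed.

(** A crude form of Minkowski's inequality: one factor 2 from [|f + g|^r <= 2^r (|f|^r + |g|^r)],
    another from [A^r + B^r <= 2 (A + B)^r]. *)
Lemma LleD r f g A B : 1 <= r -> 0 <= A -> 0 <= B -> Lle r f A -> Lle r g B ->
  Lle r (fun x => f x + g x) (4 * (A + B)).
Proof.
move=> r1 A0 B0 [mf fA] [mg gB]; have r0 : 0 <= r by apply: le_trans r1.
have p0 (x y : R) : 0 <= x `^ y := powR_ge0 x y.
have m1 := measurable_normr_powR r mf; have m2 := measurable_normr_powR r mg.
split; first exact: measurable_funD.
apply: (@le_trans _ _ (intr O (fun x => 2 `^ r * (`|f x| `^ r + `|g x| `^ r)))).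
  apply: intr_le => //.
  - by apply: measurable_normr_powR; exact: measurable_funD.
  - by apply: measurable_funM => //; exact: measurable_funD.
  - move=> x _; apply: le_trans (powR_sum2 r0 (normr_ge0 _) (normr_ge0 _)).
    by apply: ge0_ler_powR => //; rewrite ?nnegrE ?addr_ge0// ler_normD.
rewrite (intrZ mO (measurable_funD m1 m2) (p0 2 r) (fun x => addr_ge0 (p0 _ _) (p0 _ _))).
rewrite (intrD mO m1 m2 (fun x => p0 _ _) (fun x => p0 _ _)).
apply: (@le_trans _ _ ((2 `^ r)%:E * ((A `^ r)%:E + (B `^ r)%:E))%E).
  by apply: lee_wpmul2l; [rewrite lee_fin|exact: leeD].
rewrite -EFinD -EFinM lee_fin.
have -> : 4 * (A + B) = 2 * (2 * (A + B)) by ring.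
have AB : 0 <= A + B by rewrite addr_ge0.
rewrite (powRM _ (ler0n R 2) (mulr_ge0 (ler0n R 2) AB)) ler_wpM2l//.
apply: (@le_trans _ _ (2 * (A + B) `^ r)).
  have -> : 2 * (A + B) `^ r = (A + B) `^ r + (A + B) `^ r by ring.
  by apply: lerD; apply: ge0_ler_powR; rewrite ?nnegrE// ?lerDl ?lerDr.
rewrite (powRM _ (ler0n R 2) AB) ler_wpM2r//.
by apply: le1r_powR => //; rewrite ler1n.
Qed.

Lemma LleN r f A : Lle r f A -> Lle r (fun x => - f x) A.
Proof.
move=> [mf fA]; split; first exact: measurableT_comp mf.
by under eq_fun do rewrite normrN.
Qed.

Lemma LleB r f g A B : 1 <= r -> 0 <= A -> 0 <= B -> Lle r f A -> Lle r g B ->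
  Lle r (fun x => f x - g x) (4 * (A + B)).
Proof. by move=> r1 A0 B0 fA /LleN gB; exact: LleD. Qed.

Variable V : R.
Hypothesis V0 : 0 <= V.
Hypothesis OV : (leb2 O <= V%:E)%E.

Lemma Lle_bounded r f B : 1 <= r -> measurable_fun O f -> 0 <= B -> (forall x, `|f x| <= B) ->
  Lle r f ((1 + V) * B).
Proof.
move=> r1 mf B0 fB; split => //; have r0 : 0 <= r by apply: le_trans r1.
apply: (@le_trans _ _ (intr O (fun=> B `^ r))).
  apply: intr_le => //; first exact: measurable_normr_powR.
  by move=> x _; apply: ge0_ler_powR; rewrite ?nnegrE.
rewrite intr_cst//; apply: (@le_trans _ _ ((B `^ r)%:E * V%:E)%E).
  by apply: lee_wpmul2l => //; rewrite lee_fin powR_ge0.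
rewrite -EFinM lee_fin powRM ?addr_ge0// mulrC ler_wpM2r ?powR_ge0//.
by apply: (@le_trans _ _ (1 + V)); [rewrite lerDr|apply: le1r_powR => //; rewrite lerDl].
Qed.

(* Instead of Hölder's inequality: [a^2 <= B^2 + B^(2-q) a^q]. *)
Lemma Lle_L2 q f B : 2 < q -> 0 < B -> Lle q f B -> Lle 2 f ((1 + V) * B).
Proof.
move=> q2 B0 [mf fB]; split => //.
have p0 (x y : R) : 0 <= x `^ y := powR_ge0 x y.
apply: (@le_trans _ _ (intr O (fun x => B `^ 2 + B `^ (2 - q) * `|f x| `^ q))).
  apply: intr_le => //; first exact: measurable_normr_powR.
  - apply: measurable_funD => //; apply: measurable_funM => //; exact: measurable_normr_powR.
  - move=> x _; have [h|h] := leP `|f x| B.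
      by rewrite ler_wpDr ?mulr_ge0//; apply: ge0_ler_powR; rewrite ?nnegrE ?(ltW B0).
    have a0 : 0 < `|f x| := lt_trans B0 h.
    have -> : `|f x| `^ 2 = `|f x| `^ (2 - q) * `|f x| `^ q.
      by rewrite -powRD ?(gt_eqF a0) ?implybT// subrK.
    rewrite ler_wpDl// ler_wpM2r// -(opprB q 2) !powRN lef_pV2 ?posrE ?powR_gt0//.
    by apply: ge0_ler_powR; rewrite ?nnegrE ?subr_ge0 ?(ltW q2) ?(ltW B0) ?(ltW a0) ?(ltW h).
have m1 := measurable_normr_powR q mf.
rewrite (intrD mO _ (measurable_funM _ m1) (fun x => p0 _ _) (fun x => mulr_ge0 (p0 _ _) (p0 _ _)))//.
rewrite intr_cst// (intrZ mO m1 (p0 _ _) (fun x => p0 _ _)).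
apply: (@le_trans _ _ ((B `^ 2)%:E * V%:E + (B `^ (2 - q))%:E * (B `^ q)%:E)%E).
  by apply: leeD; apply: lee_wpmul2l; rewrite ?lee_fin.
rewrite -!EFinM -EFinD lee_fin -powRD ?(gt_eqF B0) ?implybT// subrK.
rewrite (powRM _ (addr_ge0 ler01 V0) (ltW B0)).
have -> : B `^ 2 * V + B `^ 2 = (1 + V) * B `^ 2 by ring.
by rewrite ler_wpM2r//; apply: le1r_powR; rewrite ?lerDl// ler1n.
Qed.

Lemma Lle_gradsum r (u : 'I_2 -> T -> R) B : 1 <= r -> 0 <= B ->
  (forall i j, Lle r (partial j (u i)) B) ->
  (intr O (fun x => gradsum u x `^ r)%R <= ((64 * B) `^ r)%:E)%E.
Proof.
move=> r1 B0 H; have r0 : 0 <= r by apply: le_trans r1.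
have N i j : Lle r (fun x => `|partial j (u i) x|) B.
  apply: (Lle_le r0 _ _ (H i j)); first by apply: measurableT_comp (H i j).1.
  by move=> x _; rewrite normr_id.
have B8 : 0 <= 4 * (B + B) by rewrite mulr_ge0// addr_ge0.
have [_] : Lle r (gradsum u) (4 * (4 * (B + B) + 4 * (B + B))).
  apply: (eq_Lle _ (LleD r1 B8 B8 (LleD r1 B0 B0 (N ord0 ord0) (N ord0 ord_max))
    (LleD r1 B0 B0 (N ord_max ord0) (N ord_max ord_max)))).
  move=> x; rewrite /gradsum !big_ord_recl !big_ord0 !addr0.
  by rewrite (_ : lift ord0 ord0 = ord_max)//; exact: val_inj.
have -> : 4 * (4 * (B + B) + 4 * (B + B)) = 64 * B by ring.
by under eq_fun do rewrite (ger0_norm (gradsum_ge0 _ _)).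
Qed.

End LpBounds.

(** * Pointwise limits of rapidly converging series *)

Section RieszFischer.
Variable R : realType.
Notation T := (R * R)%type.

Lemma geometric_limit (b : nat -> R) (W : R) : 0 <= W -> (forall k, `|b k| <= W / 2 ^+ k) ->
  exists l : R, (\sum_(k < n) b k @[n --> \oo] --> l) /\
    forall n, `|l - \sum_(k < n) b k| <= 2 * W / 2 ^+ n.
Proof.
move=> W0 bW; pose s n := \sum_(k < n) b k.
have two n : 0 < 2 ^+ n :> R by exact: exprn_gt0.
have tail n m : `|s (n + m)%N - s n| <= 2 * W / 2 ^+ n - 2 * W / 2 ^+ (n + m).
  elim: m => [|m IH]; first by rewrite addn0 !subrr normr0.
  rewrite addnS {1}/s big_ord_recr/= -/(s _) addrAC.
  apply: le_trans (ler_normD _ _) _; apply: le_trans (lerD IH (bW _)) _.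
  rewrite exprS invfM; lra.
have cs : cvgn s.
  have -> : s = series b by apply/funext => n; rewrite /series /= big_mkord.
  apply: normed_cvg; apply: (@series_le_cvg _ _ (geometric W 2^-1)).
  - by move=> n; exact: normr_ge0.
  - by move=> n; rewrite /geometric /= mulr_ge0// exprn_ge0.
  - by move=> n; rewrite /geometric /= exprVn; exact: bW.
  - by apply: is_cvg_geometric_series; rewrite ger0_norm// invf_lt1// ltr1n.
exists (limn s); split; first exact: cs.
move=> n; have c : `|s m - s n| @[m --> \oo] --> `|limn s - s n|.
  by apply: cvg_norm; apply: cvgB => //; exact: cvg_cst.
apply: (cvgr_to_le c); exists n => // m /= nm.
rewrite -(subnKC nm); apply: le_trans (tail _ _) _.
by rewrite gerBl divr_ge0 ?mulr_ge0// ltW.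
Qed.

(* Junk value at the points where the series diverges. *)
Definition suml (a : nat -> T -> R) (x : T) : R :=
  fine (limn_esup (fun n => (\sum_(k < n) a k x)%:E)).

Lemma sumlE (a : nat -> T -> R) x l : (\sum_(k < n) a k x @[n --> \oo] --> l) -> suml a x = l.
Proof.
move=> c; rewrite /suml.
have : (\sum_(k < n) a k x)%:E @[n --> \oo] --> l%:E by apply: cvg_EFin => //; exact: nearW.
by move=> /cvg_limn_einf_sup[_ ->].
Qed.

Variable O : set T.
Hypothesis mO : measurable O.

Lemma measurable_suml (a : nat -> T -> R) : (forall k, measurable_fun O (a k)) ->
  measurable_fun O (suml a).
Proof.
move=> ma; apply: (measurableT_comp (fine_measurable measurableT)).
apply: measurable_fun_limn_esup => n; apply/measurable_EFinP.
exact: measurable_sum.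
Qed.

(* With [S = sum_k (2^k |a_k|)^r], pointwise [|sum_(k >= n) a_k|^r <= (2 / 2^n)^r S]. *)
Lemma suml_tail (a : nat -> T -> R) (r P : R) n : 1 <= r -> 0 <= P ->
  (forall k, Lle O r (a k) (P / 4 ^+ k)) ->
  Lle O r (fun x => suml a x - \sum_(k < n) a k x) (4 * P / 2 ^+ n).
Proof.
move=> r1 P0 ha; have r0 : 0 < r by apply: lt_le_trans r1.
have ma k : measurable_fun O (a k) := (ha k).1.
have two m : 0 < 2 ^+ m :> R by exact: exprn_gt0.
pose S k x : R := (2 ^+ k * `|a k x|) `^ r.
have S0 k x : 0 <= S k x := powR_ge0 _ _.
have mS k : measurable_fun O (S k).
  by apply: measurable_powRf; apply: measurable_funM => //; exact: measurableT_comp.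
pose c : R := (2 / 2 ^+ n) `^ r.
have c0 : 0 < c by rewrite powR_gt0// divr_gt0.
have mt : measurable_fun O (fun x => suml a x - \sum_(k < n) a k x).
  by apply: measurable_funB; [exact: measurable_suml|exact: measurable_sum].
have pointwise x : ((`|suml a x - \sum_(k < n) a k x| `^ r)%:E <=
    c%:E * \sum_(0 <= k <oo) (S k x)%:E)%E.
  have pos : (0 <= \sum_(0 <= k <oo) (S k x)%:E)%E by apply: nneseries_ge0 => k _ _; rewrite lee_fin.
  case E : (\sum_(0 <= k <oo) (S k x)%:E)%E => [z| |].
  - have z0 : 0 <= z by rewrite -lee_fin -E.
    have Sz k : S k x <= z.
      rewrite -lee_fin -E; apply: le_trans (nneseries_lim_ge k.+1 _); last by move=> ? _ _; rewrite lee_fin.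
      rewrite big_nat_recr//= leeDr// sume_ge0// => ? _; by rewrite lee_fin.
    pose W := z `^ r^-1.
    have aW k : `|a k x| <= W / 2 ^+ k.
      rewrite ler_pdivlMr// mulrC.
      have -> : 2 ^+ k * `|a k x| = (S k x) `^ r^-1.
        by rewrite /S -powRrM divff ?gt_eqF// powRr1// mulr_ge0// ltW.
      by apply: ge0_ler_powR; rewrite ?nnegrE ?invr_ge0 ?(ltW r0).
    have [l [cl lW]] := geometric_limit (powR_ge0 _ _ : 0 <= W) aW.
    rewrite (sumlE cl) -EFinM lee_fin.
    apply: (@le_trans _ _ ((2 / 2 ^+ n * W) `^ r)).
      apply: ge0_ler_powR; rewrite ?nnegrE ?(ltW r0) ?mulr_ge0 ?powR_ge0 ?invr_ge0 ?(ltW (two _))//.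
      by rewrite mulrAC.
    rewrite powRM ?powR_ge0 ?divr_ge0 ?(ltW (two _))// -powRrM mulVf ?gt_eqF//.
    by rewrite powRr1.
  - by rewrite gt0_muley ?lte_fin// leey.
  - by move: pos; rewrite E leeNy_eq.
have mser : measurable_fun O (fun x => \sum_(0 <= k <oo) (S k x)%:E)%E.
  apply: (@ge0_emeasurable_sum _ _ _ O (fun k x => (S k x)%:E) xpredT).
    by move=> k x _ _; rewrite lee_fin.
  by move=> k _; apply/measurable_EFinP.
split => //.
apply: (@le_trans _ _ (\int[@leb2 R]_(x in O) (c%:E * \sum_(0 <= k <oo) (S k x)%:E)%E)%E).
  apply: ge0_le_integral => //.
  - by apply/measurable_EFinP; exact: measurable_normr_powR.
  - by apply: emeasurable_funM => //; exact: mser.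
rewrite ge0_integralZl//; last 2 first.
- by move=> x _; apply: nneseries_ge0 => k _ _; rewrite lee_fin.
- by rewrite lee_fin ltW.
have meS k : measurable_fun O (fun x => (S k x)%:E) by apply/measurable_EFinP; exact: mS.
rewrite (@integral_nneseries _ _ _ (@leb2 R) O mO (fun k x => (S k x)%:E) meS); last first.
  by move=> k x _; rewrite lee_fin.
(* Against the decay [4^-k], the weight [2^k] leaves [2^-k], which survives the power [r >= 1] and
   is summable. *)
have intS k : (intr O (S k) <= (P `^ r / 2 ^+ k)%:E)%E.
  have p2 : 0 <= 2 ^+ k :> R by rewrite ltW.
  have -> : intr O (S k) = intr O (fun x => (2 ^+ k) `^ r * `|a k x| `^ r).
    by apply: eq_integral => x _; rewrite /S powRM.
  rewrite intrZ ?powR_ge0//; last exact: measurable_normr_powR.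
  apply: le_trans (lee_wpmul2l _ (ha k).2) _; first by rewrite lee_fin powR_ge0.
  rewrite -EFinM lee_fin -powRM ?divr_ge0 ?exprn_ge0//.
  have -> : 2 ^+ k * (P / 4 ^+ k) = P / 2 ^+ k.
    rewrite (_ : 4 = 2 * 2 :> R); last by ring.
    by rewrite exprMn; field; rewrite gt_eqF.
  rewrite powRM ?invr_ge0// ler_wpM2l ?powR_ge0//.
  apply: ge1r_powR => //; rewrite invr_gt0 two invf_le1//=.
  by rewrite exprn_ege1// ler1n.
apply: (@le_trans _ _ (c%:E * (2 * P `^ r)%:E)%E).
  apply: lee_wpmul2l; first by rewrite lee_fin ltW.
  apply: lime_le.
    by apply: is_cvg_nneseries => k _ _; apply: intr_ge0.
  apply: nearW => m; apply: (@le_trans _ _ (\sum_(0 <= k < m) (P `^ r / 2 ^+ k)%:E)%E).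
    by apply: lee_sum => k _; exact: intS.
  rewrite sumEFin lee_fin; apply: (@le_trans _ _ (2 * P `^ r - 2 * P `^ r / 2 ^+ m)); last first.
    by rewrite gerBl divr_ge0 ?mulr_ge0 ?powR_ge0 ?(ltW (two _)).
  elim: m => [|m IH]; first by rewrite big_geq// expr0 divr1 subrr.
  by rewrite big_nat_recr//=; apply: le_trans (lerD IH (lexx _)) _; rewrite exprS invfM; lra.
rewrite -EFinM lee_fin.
have -> : 4 * P / 2 ^+ n = 2 / 2 ^+ n * (2 * P) by field; rewrite gt_eqF.
rewrite powRM ?divr_ge0 ?mulr_ge0 ?(ltW (two _))// ler_wpM2l ?powR_ge0//.
rewrite powRM// ler_wpM2r ?powR_ge0//.
by apply: le1r_powR => //; rewrite ler1n.
Qed.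

End RieszFischer.

(** * Sobolev classes: approximation, convergence, and sup bounds in the limit *)

Section SobolevLimits.
Variable R : realType.
Notation T := (R * R)%type.

Lemma mem_multi k (s : seq 'I_2) : (s \in multi k) = (size s <= k)%N.
Proof.
elim: k s => [|k IH] [|i s] //=; rewrite in_cons /=.
apply/allpairsP/idP => [[[j s'] /= [_ s'k [_ ->]]]|sk]; first by rewrite ltnS -IH.
by exists (i, s); rewrite /= mem_enum IH.
Qed.

Lemma le_sum_seq (I : eqType) (l : seq I) (F : I -> R) (B : R) : (forall s, s \in l -> F s <= B) ->
  \sum_(s <- l) F s <= (size l)%:R * B.
Proof.
elim: l => [|s l IH] H; first by rewrite big_nil mul0r.
rewrite big_cons /= -natr1 mulrDl mul1r addrC lerD ?H ?mem_head//.
by apply: IH => s' sl; apply: H; rewrite in_cons sl orbT.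
Qed.

Lemma sum_seq_ge (I : eqType) (l : seq I) (F : I -> R) s : (forall s, 0 <= F s) -> s \in l ->
  F s <= \sum_(s <- l) F s.
Proof. by move=> F0 sl; rewrite (big_rem s sl) /= lerDl sumr_ge0. Qed.

Lemma near_all_seq (I : eqType) (l : seq I) (P : I -> nat -> Prop) :
  (forall s, s \in l -> \forall n \near \oo, P s n) -> \forall n \near \oo, forall s, s \in l -> P s n.
Proof.
elim: l => [|s l IH] H; first by apply: nearW.
have h1 := H s (mem_head _ _).
have h2 : \forall n \near \oo, forall s, s \in l -> P s n.
  by apply: IH => s' sl; apply: H; rewrite in_cons sl orbT.
near=> n => s'; rewrite in_cons => /orP[/eqP ->|]; first by near: n.
by move: s'; near: n.
Unshelve. all: by end_near. Qed.

Variables (O : set T) (V : R).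
Hypothesis mO : measurable O.
Hypothesis V0 : 0 <= V.
Hypothesis OV : (leb2 O <= V%:E)%E.

Lemma Cc_inf_Lle r f : Cc_inf O f -> 1 <= r -> exists B : R, 0 <= B /\ Lle O r f B.
Proof.
move=> cf r1; have [B [B0 HB]] := Cc_inf_bounded cf; exists ((1 + V) * B); split.
  by rewrite mulr_ge0// addr_ge0.
by apply: Lle_bounded => //; apply: continuous_measurable2 => //; exact: smooth_continuous cf.1.
Qed.

(** An approximant in the exponent [q] is also one in the exponent 2, as the measure of [O] is
    finite: the two exponents share one sequence. The tolerance [t / (1 + V)] anticipates the cost
    of this passage. *)
Lemma W0_approx q (phi : seq 'I_2 -> T -> R) t : 2 < q -> inW0 1 q O phi -> 0 < t ->
  exists a, Cc_inf O a /\ forall s r, (size s <= 1)%N -> r = 2 \/ r = q ->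
    Lle O r (fun x => iter_partial s a x - phi s x) t.
Proof.
move=> q2 [Lphi [psi [cpsi lim]]] t0.
have q1 : 1 <= q by rewrite (le_trans _ (ltW q2))// ler1n.
have q0 : 0 < q by apply: lt_le_trans q1.
have V1 : 0 < 1 + V by rewrite ltr_pwDl.
have t'0 : 0 < t / (1 + V) by rewrite divr_gt0.
have [n _ /(_ n (leqnn n)) Hn] : \forall n \near \oo, forall s, s \in multi 1 ->
    Lqnorm q O (fun x => iter_partial s (psi n) x - phi s x) <= t / (1 + V).
  apply: near_all_seq => s s1; have /cvgr_dist_le/(_ _ t'0) := lim s s1.
  by apply: filterS => n; rewrite sub0r normrN ger0_norm// Lqnorm_ge0.
exists (psi n); split => // s r s1.
have Lq : Lle O q (fun x => iter_partial s (psi n) x - phi s x) (t / (1 + V)).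
  have sm : s \in multi 1 by rewrite mem_multi.
  have [B [B0 HB]] := Cc_inf_Lle (Cc_inf_iter_partial s (cpsi n)) q1.
  have Lp := inLq_Lle q0 (Lphi s sm).
  (* [Lqnorm] would send an infinite integral to 0, so integrability of the difference is obtained
     first, from that of its two terms. *)
  have /(Lle_inLq q0 _)[|+ _] := LleB mO q1 B0 (Lqnorm_ge0 _ _ _) HB Lp.
    by rewrite mulr_ge0// addr_ge0// Lqnorm_ge0.
  move=> /(inLq_Lle q0); apply: LleW; rewrite ?(ltW q0) ?Lqnorm_ge0//; exact: Hn.
case=> ->.
  have -> : t = (1 + V) * (t / (1 + V)) by rewrite mulrC mulfVK// gt_eqF.
  exact: (Lle_L2 mO V0 OV q2 t'0 Lq).
apply: LleW Lq; rewrite ?(ltW q0) ?(ltW t'0)//.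
by rewrite ler_pdivrMr// ler_peMr ?(ltW t0)// lerDl.
Qed.

Lemma Lqnorm_cvg0 r (F : nat -> T -> R) (K : R) : 0 < r -> 0 <= K ->
  (forall n, Lle O r (F n) (K / 2 ^+ n)) -> Lqnorm r O (F n) @[n --> \oo] --> (0 : R).
Proof.
move=> r0 K0 H.
have c : (K / 2 ^+ n) @[n --> \oo] --> (0 : R).
  have -> : (fun n => K / 2 ^+ n) = geometric K 2^-1 by apply/funext => n; rewrite /geometric /= exprVn.
  by apply: cvg_geometric; rewrite ger0_norm ?invr_ge0// invf_lt1// ltr1n.
apply: (squeeze_cvgr _ (cvg_cst 0) c); apply: nearW => n; rewrite Lqnorm_ge0 /=.
by have [] := Lle_inLq r0 _ (H n); rewrite // divr_ge0// exprn_ge0.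
Qed.

(* [(|g| - B)^+ <= |w - g|] whenever [|w| <= B]. *)
Lemma Linfnorm_le (g : T -> R) (B : R) : measurable_fun O g -> 0 <= B ->
  (forall t, 0 < t -> exists w, (forall x, O x -> `|w x| <= B) /\ Lle O 2 (fun x => w x - g x) t) ->
  inLinf O g /\ Linfnorm O g <= B.
Proof.
move=> mg B0 H; pose p x := Num.max 0 (`|g x| - B).
have mp : measurable_fun O p.
  apply: measurable_maxr => //; apply: measurable_funB => //; exact: measurableT_comp.
have p0 x : 0 <= p x by rewrite le_max lexx.
have int0 : intr O (fun x => `|p x| `^ 2) = 0%E.
  apply/eqP; rewrite eq_le intr_ge0 ?andbT; last by move=> x; exact: powR_ge0.
  apply/lee_addgt0Pr => e e0; rewrite add0e.
  have s0 : 0 < Num.sqrt e by rewrite sqrtr_gt0.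
  have [w [wB wg]] := H _ s0.
  have [_] : Lle O 2 p (Num.sqrt e).
    apply: (Lle_le mO _ mp _ wg) => // x Ox.
    rewrite (ger0_norm (p0 x)) /p ge_max normr_ge0/=.
    have := wB x Ox; have := lerB_dist (g x) (w x); rewrite [`|g x - _|]distrC; lra.
  by rewrite powR_mulrn ?(ltW s0)// sqr_sqrtr// ltW.
have ae : {ae @leb2 R, forall x, O x -> `|g x| <= B}.
  have m2 : measurable_fun O (fun x => (`|p x| `^ 2)%:E).
    by apply/measurable_EFinP; exact: measurable_normr_powR.
  have /(ae_eq_integral_abs (@leb2 R) mO m2) : (\int[@leb2 R]_(x in O) `|(`|p x| `^ 2)%:E| = 0)%E.
    by rewrite -int0; apply: eq_integral => x _; rewrite gee0_abs// lee_fin powR_ge0.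
  apply: filterS => x px Ox; have := px Ox; move=> /= [] /powR_eq0_eq0/normr0_eq0.
  by rewrite /p => px0; rewrite -subr_le0 -px0 le_max lexx orbT.
have ess : (ess_sup (@leb2 R) (fun x => (`|g x| * \1_O x)%:E) <= B%:E)%E.
  have ae' : {ae @leb2 R, forall x, ((`|g x| * \1_O x)%:E <= B%:E)%E}.
    apply: (@filterS _ _ (ae_filter_ringOfSetsType (@leb2 R)) _ _ _ ae) => x gx; rewrite lee_fin indicE.
    by case: (asboolP (O x)) => Ox; rewrite ?(mem_set Ox) ?(memNset Ox) ?mulr1 ?mulr0//; exact: gx.
  exact/ess_supP.
split; first by split => //; apply: le_lt_trans ess _; rewrite ltry.
rewrite /Linfnorm; move: ess; case: (ess_sup _ _) => [z| |]//=.
Qed.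

End SobolevLimits.

Lemma sum_I2 (R : realType) (F : 'I_2 -> R) : \sum_i F i = F ord0 + F ord_max.
Proof.
rewrite big_ord_recl big_ord_recl big_ord0 addr0.
by rewrite (_ : lift ord0 ord0 = ord_max)//; exact: val_inj.
Qed.

(** * Telescoping, and the decomposition in the limit *)

Section Decomposition.
Variable R : realType.
Notation T := (R * R)%type.
Variables (O : set T) (V C q : R).
Hypothesis mO : measurable O.
Hypothesis V0 : 0 <= V.
Hypothesis OV : (leb2 O <= V%:E)%E.
Hypothesis C0 : 0 < C.
Hypothesis q2 : 2 < q.
Hypothesis potential : forall (u : 'I_2 -> T -> R) (eta : R), (forall i, Cc_inf O (u i)) -> 0 < eta ->
  exists h, [/\ Cc_inf O h,
    forall L x i, 0 <= L -> (intr O (fun x => gradsum u x `^ 2)%R <= (L `^ 2)%:E)%E -> O x ->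
      `|partial i h x - u i x| <= C * (L + eta) &
    forall r L s, r = 2 \/ r = q -> 0 <= L -> (intr O (fun x => gradsum u x `^ r)%R <= (L `^ r)%:E)%E ->
      (size s <= 2)%N -> (intr O (fun x => `|iter_partial s h x| `^ r)%R <= ((C * (L + eta)) `^ r)%:E)%E].

Variable phi : 'I_2 -> seq 'I_2 -> T -> R.
Hypothesis phi2 : forall i, inW0 1 2 O (phi i).
Hypothesis phiq : forall i, inW0 1 q O (phi i).

Definition norm1 r : R := \sum_i W0norm 1 r O (phi i).

(** 64 comes from [Lle_gradsum], 20 from the increments of the approximating sequence, and 1 from
    the tolerance [eta]. *)
Let c3 := C * (64 * 20 + 1).

Let c30 : 0 < c3. Proof. by rewrite mulr_gt0// addr_gt0// mulr_gt0. Qed.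

Let expo r : r = 2 \/ r = q -> 1 <= r /\ 0 < r.
Proof.
move=> H; have r1 : 1 <= r by have := q2; case: H => ->; lra.
by split => //; apply: lt_le_trans r1.
Qed.

Lemma phi_Lle i s r : r = 2 \/ r = q -> (size s <= 1)%N -> Lle O r (phi i s) (norm1 r).
Proof.
move=> rq s1; have [r1 r0] := expo rq.
have sm : s \in multi 1 by rewrite mem_multi.
have Lp : inLq r O (phi i s) by case: rq => ->; [exact: (phi2 i).1|exact: (phiq i).1].
apply: (LleW (ltW r0) (Lqnorm_ge0 _ _ _) _ (inLq_Lle r0 Lp)).
apply: (@le_trans _ _ (W0norm 1 r O (phi i))).
  exact: (@sum_seq_ge R _ (multi 1) (fun s => Lqnorm r O (phi i s)) s (fun s => Lqnorm_ge0 _ _ _) sm).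
rewrite /norm1 (bigD1 i)//= lerDl; apply: sumr_ge0 => j _; apply: sumr_ge0 => l _; exact: Lqnorm_ge0.
Qed.

Section Nontrivial.
Variable mu : R.
Hypothesis mu0 : 0 < mu.
Hypothesis mu_le : forall r, r = 2 \/ r = q -> mu <= norm1 r.

Lemma norm1_gt0 r : r = 2 \/ r = q -> 0 < norm1 r.
Proof. by move=> /mu_le; exact: lt_le_trans. Qed.

(** [mu] lies below both norms, so that errors [mu / 4^k] are small relative to either of them; the
    approximants and their potentials can then be chosen once for the two exponents. *)
Lemma decomposition_pos : exists (h : seq 'I_2 -> T -> R) (g : 'I_2 -> seq 'I_2 -> T -> R),
  [/\ forall i s x, phi i s x = g i s x + h (rcons s i) x,
    forall r, r = 2 \/ r = q -> inW0 2 r O h /\ forall s, (size s <= 2)%N -> Lqnorm r O (h s) <= 4 * c3 * norm1 r,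
    forall r i, r = 2 \/ r = q -> inW0 1 r O (g i) /\ forall s, (size s <= 1)%N ->
      Lqnorm r O (g i s) <= 4 * (1 + 4 * c3) * norm1 r &
    forall i, inLinf O (g i [::]) /\ Linfnorm O (g i [::]) <= 2 * c3 * norm1 2].
Proof.
have four k : 0 < 4 ^+ k :> R by exact: exprn_gt0.
have two k : 0 < 2 ^+ k :> R by exact: exprn_gt0.
have [A HA] : exists A : nat -> 'I_2 -> T -> R, forall k i, Cc_inf O (A k i) /\
    forall s r, (size s <= 1)%N -> r = 2 \/ r = q ->
      Lle O r (fun x => iter_partial s (A k i) x - phi i s x) (mu / 4 ^+ k).
  have /boolp.choice[a aP] : forall ki : nat * 'I_2, exists a, Cc_inf O a /\
      forall s r, (size s <= 1)%N -> r = 2 \/ r = q ->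
      Lle O r (fun x => iter_partial s a x - phi ki.2 s x) (mu / 4 ^+ ki.1).
    by move=> ki; apply: (W0_approx mO V0 OV q2 (phiq _)); rewrite divr_gt0.
  by exists (fun k i => a (k, i)) => k i; exact: (aP (k, i)).
(* Increments of the approximating sequence, of size at most [4 (mu / 4^(k+1) + mu / 4^k) = 20 mu /
   4^(k+1)]; the initial term is not small, only bounded by [8 norm1 r]. *)
pose u k i : T -> R := if k is k'.+1 then (fun x => A k i x - A k' i x) else A 0%N i.
have cA k i : Cc_inf O (A k i) := (HA k i).1.
have cu k i : Cc_inf O (u k i) by case: k => [|k]; [exact: cA|exact: Cc_infB].
have sumu k i x : \sum_(j < k.+1) u j i x = A k i x.
  elim: k => [|k IH]; first by rewrite big_ord1.
  by rewrite big_ord_recr/= IH addrC subrK.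
have uL k r i j : r = 2 \/ r = q -> Lle O r (partial j (u k i)) (20 * norm1 r / 4 ^+ k).
  move=> rq; have [r1 r0] := expo rq; have n0 := norm1_gt0 rq; have mn := mu_le rq.
  case: k => [|k].
    have H := LleD mO r1 (ltW (divr_gt0 mu0 (four 0%N))) (ltW n0) ((HA 0%N i).2 [:: j] r isT rq) (phi_Lle i (s := [:: j]) rq isT).
    apply: (LleW (ltW r0) _ _ (eq_Lle _ H)).
    - by rewrite mulr_ge0// addr_ge0 ?divr_ge0 ?ltW.
    - by rewrite !expr0 !divr1; move: mn n0; lra.
    - by move=> x; rewrite /= subrK.
  have H := LleB mO r1 (ltW (divr_gt0 mu0 (four k.+1))) (ltW (divr_gt0 mu0 (four k)))
    ((HA k.+1 i).2 [:: j] r isT rq) ((HA k i).2 [:: j] r isT rq).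
  apply: (LleW (ltW r0) _ _ (eq_Lle _ H)).
  - by rewrite mulr_ge0// addr_ge0 ?divr_ge0 ?ltW.
  - have -> : 4 * (mu / 4 ^+ k.+1 + mu / 4 ^+ k) = 20 * mu / 4 ^+ k.+1.
      by rewrite exprS; field; rewrite gt_eqF.
    by rewrite ler_pM2r ?invr_gt0// ler_pM2l.
  - move=> x /=; have /= -> := iter_partialB [:: j] (cA k.+1 i).1 (cA k i).1; ring.
have gradu k r : r = 2 \/ r = q ->
    (intr O (fun x => gradsum (u k) x `^ r)%R <= ((64 * 20 * norm1 r / 4 ^+ k) `^ r)%:E)%E.
  move=> rq; have [r1 r0] := expo rq; have n0 := norm1_gt0 rq.
  have -> : 64 * 20 * norm1 r / 4 ^+ k = 64 * (20 * norm1 r / 4 ^+ k) by rewrite -!mulrA.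
  apply: (Lle_gradsum mO r1); first by rewrite divr_ge0 ?mulr_ge0 ?ltW.
  by move=> i j; exact: uL.
have cbound k r : r = 2 \/ r = q -> C * (64 * 20 * norm1 r / 4 ^+ k + mu / 4 ^+ k) <= c3 * norm1 r / 4 ^+ k.
  move=> rq; rewrite -mulrDl mulrA ler_pM2r ?invr_gt0// /c3 -[leRHS]mulrA ler_pM2l//.
  by rewrite [leRHS]mulrDl mul1r lerD2l mu_le.
have /boolp.choice[h hP] : forall k, exists h, [/\ Cc_inf O h,
    forall x i, O x -> `|partial i h x - u k i x| <= c3 * norm1 2 / 4 ^+ k &
    forall r s, r = 2 \/ r = q -> (size s <= 2)%N -> Lle O r (iter_partial s h) (c3 * norm1 r / 4 ^+ k)].
  move=> k; have [h [ch h1 h2]] := potential (cu k) (divr_gt0 mu0 (four k)).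
  have L0 r : r = 2 \/ r = q -> 0 <= 64 * 20 * norm1 r / 4 ^+ k.
    by move=> rq; rewrite divr_ge0 ?mulr_ge0 ?ltW// norm1_gt0.
  exists h; split => //.
    move=> x i Ox; apply: le_trans (cbound k 2 (or_introl erefl)).
    by apply: h1 => //; [apply: L0; left|apply: gradu; left].
  move=> r s rq s2; have [r1 r0] := expo rq.
  apply: LleW (cbound k r rq) _; first exact: ltW.
    by rewrite mulr_ge0 ?ltW// addr_gt0 ?divr_gt0 ?mulr_gt0 ?norm1_gt0.
  split; last exact: h2 _ _ _ rq (L0 r rq) (gradu k r rq) s2.
  by apply: continuous_measurable2 => //; apply: smooth_continuous; exact: smooth_iter_partial ch.1.
pose H s : T -> R := suml (fun k => iter_partial s (h k)).
pose Phi n : T -> R := fun x => \sum_(k < n) h k x.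
have cPhi n : Cc_inf O (Phi n) by apply: Cc_inf_sum => k; case: (hP k).
have PhiE s n x : iter_partial s (Phi n) x = \sum_(k < n) iter_partial s (h k) x.
  rewrite /Phi iter_partial_sum// => k; by case: (hP k) => -[].
have tail r s n : r = 2 \/ r = q -> (size s <= 2)%N ->
    Lle O r (fun x => H s x - iter_partial s (Phi n) x) (4 * (c3 * norm1 r) / 2 ^+ n).
  move=> rq s2; have [r1 r0] := expo rq.
  have P0 : 0 <= c3 * norm1 r by rewrite mulr_ge0 ?ltW// norm1_gt0.
  apply: eq_Lle (@suml_tail R O mO (fun k => iter_partial s (h k)) r _ n r1 P0 _).
    by move=> x; rewrite PhiE.
  by move=> k; case: (hP k) => _ _; exact.
have HL r s : r = 2 \/ r = q -> (size s <= 2)%N -> Lle O r (H s) (4 * c3 * norm1 r).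
  move=> rq s2; have := tail r s 0%N rq s2; rewrite expr0 divr1 mulrA.
  by apply: eq_Lle => x; rewrite PhiE big_ord0 subr0.
have HL0 r : r = 2 \/ r = q -> 0 <= 4 * c3 * norm1 r.
  by move=> rq; rewrite mulr_ge0 ?mulr_ge0 ?ltW// norm1_gt0.
(* The identity is imposed on all the derivatives at once. The index is [rcons s i] because
   [iter_partial] applies the last letter first: the gradient is taken before the derivatives in
   [s]. *)
pose g i s : T -> R := fun x => phi i s x - H (rcons s i) x.
have gL r i s : r = 2 \/ r = q -> (size s <= 1)%N -> Lle O r (g i s) (4 * (1 + 4 * c3) * norm1 r).
  move=> rq s1; have [r1 r0] := expo rq; have n0 := norm1_gt0 rq.
  have -> : 4 * (1 + 4 * c3) * norm1 r = 4 * (norm1 r + 4 * c3 * norm1 r) by ring.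
  by apply: LleB => //; [exact: ltW|exact: HL0|exact: phi_Lle|apply: HL; rewrite // size_rcons].
(* Smooth approximants of [g]: [A n] is the sum of the [n + 1] increments [u 0, ..., u n], matched
   by as many potentials. *)
pose G n i : T -> R := fun x => A n i x - partial i (Phi n.+1) x.
have cG n i : Cc_inf O (G n i) by apply: Cc_infB => //; exact: (Cc_inf_iter_partial [:: i]).
have GL r i s n : r = 2 \/ r = q -> (size s <= 1)%N ->
    Lle O r (fun x => iter_partial s (G n i) x - g i s x) (4 * (1 + 4 * c3) * norm1 r / 2 ^+ n).
  move=> rq s1; have [r1 r0] := expo rq; have n0 := norm1_gt0 rq.
  have a0 : 0 <= mu / 4 ^+ n by rewrite divr_ge0 ?ltW.
  have b0 : 0 <= 4 * (c3 * norm1 r) / 2 ^+ n.+1 by rewrite divr_ge0 ?mulr_ge0 ?ltW// mulr_ge0 ?ltW.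
  have s2 : (size (rcons s i) <= 2)%N by rewrite size_rcons.
  have K := LleD mO r1 a0 b0 ((HA n i).2 s r s1 rq) (tail r (rcons s i) n.+1 rq s2).
  apply: (LleW (ltW r0) _ _ (eq_Lle _ K)); first by rewrite mulr_ge0 ?addr_ge0.
    have -> : 4 * (1 + 4 * c3) * norm1 r / 2 ^+ n =
        4 * (norm1 r / 2 ^+ n + 4 * (c3 * norm1 r) / 2 ^+ n) by ring.
    rewrite ler_pM2l//; apply: lerD.
      apply: ler_pM; rewrite ?invr_ge0 ?(ltW mu0) ?(ltW (four _)) ?mu_le//.
      by rewrite lef_pV2 ?posrE// lerXn2r ?nnegrE// ler_nat.
    apply: ler_wpM2l; first exact: mulr_ge0 (ler0n R 4) (mulr_ge0 (ltW c30) (ltW n0)).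
    by rewrite lef_pV2 ?posrE// exprS ler_peMl ?(ltW (two _))// ler1n.
  move=> x; have -> : iter_partial s (G n i) x = iter_partial s (A n i) x - iter_partial (rcons s i) (Phi n.+1) x.
    rewrite -cats1 -iter_partial_cat.
    by rewrite (iter_partialB s (cA n i).1 (Cc_inf_iter_partial [:: i] (cPhi n.+1)).1).
  by rewrite /g; ring.
exists H, g; split.
- by move=> i s x; rewrite /g subrK.
- move=> r rq; have [r1 r0] := expo rq; split; last first.
    by move=> s s2; exact: (Lle_inLq r0 (HL0 r rq) (HL r s rq s2)).2.
  split.
    by move=> s; rewrite mem_multi => s2; exact: (Lle_inLq r0 (HL0 r rq) (HL r s rq s2)).1.
  exists Phi; split => // s; rewrite mem_multi => s2.
  apply: (@Lqnorm_cvg0 R O r _ (4 * (c3 * norm1 r)) r0); first by rewrite mulrA HL0.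
  by move=> n; apply: eq_Lle (LleN (tail r s n rq s2)) => x; rewrite opprB.
- move=> r i rq; have [r1 r0] := expo rq; have n0 := norm1_gt0 rq.
  have K0 : 0 <= 4 * (1 + 4 * c3) * norm1 r by rewrite mulr_ge0 ?mulr_ge0 ?addr_ge0 ?mulr_ge0 ?ltW.
  split; last by move=> s s1; exact: (Lle_inLq r0 K0 (gL r i s rq s1)).2.
  split.
    by move=> s; rewrite mem_multi => s1; exact: (Lle_inLq r0 K0 (gL r i s rq s1)).1.
  exists (G ^~ i); split => // s; rewrite mem_multi => s1.
  by apply: (@Lqnorm_cvg0 R O r _ _ r0 K0) => n; exact: GL.
move=> i; have P0 : 0 <= c3 * norm1 2 by rewrite mulr_ge0 ?ltW// norm1_gt0//; left.
have e2 : (2 : R) = 2 \/ 2 = q by left.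
apply: (Linfnorm_le mO (gL 2 i [::] e2 isT).1); first by rewrite -mulrA mulr_ge0.
move=> t t0.
have K0 : 0 < (1 + 4 * c3) * norm1 2 by rewrite mulr_gt0 ?norm1_gt0// addr_gt0 ?mulr_gt0.
(* [mesh] is used here only as the sequence [4 K / 2^n], which is the error bound of [GL]. *)
have [n nt] := mesh_small K0 t0; exists (G n i); split; last first.
  apply: LleW (GL 2 i [::] n e2 isT) => //; first by rewrite divr_ge0 ?ltW// -mulrA mulr_gt0.
  by move: nt; rewrite /mesh mulrA natrX.
move=> x Ox.
(* Each summand is pointwise bounded by a geometric term, although [A n] and the gradient of
   [Phi n.+1] come with no uniform bound separately; this is where boundedness of [g] arises. *)
have -> : G n i x = \sum_(k < n.+1) (u k i x - partial i (h k) x).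
  by rewrite sumrB sumu /G -(PhiE [:: i]).
apply: le_trans (ler_norm_sum _ _ _) _.
apply: (@le_trans _ _ (\sum_(k < n.+1) c3 * norm1 2 / 4 ^+ k)).
  by apply: ler_sum => k _; rewrite distrC; case: (hP k) => _ + _; apply.
rewrite -[leRHS]mulrA; move: (c3 * norm1 2) P0 (n.+1) => P P0 m.
have : \sum_(k < m) P / 4 ^+ k <= 2 * P - 2 * P / 4 ^+ m.
  elim: m => [|m IH]; first by rewrite big_ord0 expr0 divr1 subrr.
  rewrite big_ord_recr/=; apply: le_trans (lerD IH (lexx _)) _; rewrite exprS invfM.
  have : 0 <= P / 4 ^+ m by rewrite divr_ge0// ltW.
  lra.
move=> /le_trans; apply; rewrite gerBl divr_ge0 ?mulr_ge0// ltW//.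
Qed.

End Nontrivial.

Lemma norm1_ge0 r : 0 <= norm1 r.
Proof. by apply: sumr_ge0 => i _; apply: sumr_ge0 => s _; exact: Lqnorm_ge0. Qed.

(** If one of the norms vanishes there is no positive [mu]; but then [phi] vanishes almost
    everywhere in [O], through [Lle_L2] when it is the [q]-norm, and [h = 0], [g = phi] will do. *)
Lemma decomposition : exists (h : seq 'I_2 -> T -> R) (g : 'I_2 -> seq 'I_2 -> T -> R),
  [/\ forall i s x, phi i s x = g i s x + h (rcons s i) x,
    forall r, r = 2 \/ r = q -> inW0 2 r O h /\ forall s, (size s <= 2)%N -> Lqnorm r O (h s) <= 4 * c3 * norm1 r,
    forall r i, r = 2 \/ r = q -> inW0 1 r O (g i) /\ forall s, (size s <= 1)%N ->
      Lqnorm r O (g i s) <= 4 * (1 + 4 * c3) * norm1 r &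
    forall i, inLinf O (g i [::]) /\ Linfnorm O (g i [::]) <= 2 * c3 * norm1 2].
Proof.
have K1 : 1 <= 4 * (1 + 4 * c3) by have := c30; lra.
have e2 : (2 : R) = 2 \/ 2 = q by left.
have eq : q = 2 \/ q = q by right.
have nn := norm1_ge0.
have zero_or_pos r : norm1 r = 0 \/ 0 < norm1 r.
  by have := nn r; rewrite le_eqVlt => /orP[/eqP <-|]; [left|right].
have zp : (norm1 2 = 0 \/ norm1 q = 0) \/ 0 < norm1 2 /\ 0 < norm1 q.
  case: (zero_or_pos 2) => [z|n2]; first exact (or_introl (or_introl z)).
  case: (zero_or_pos q) => [z|nq]; first exact (or_introl (or_intror z)).
  exact (or_intror (conj n2 nq)).
have [zero|[n2 nq]] := zp; last first.
  have [mu [mu0 mule]] : exists mu : R, 0 < mu /\ forall r : R, r = 2 \/ r = q -> mu <= norm1 r.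
    exists (Num.min (norm1 2) (norm1 q)); split.
      by move: n2 nq; generalize (norm1 2) (norm1 q) => a b a0 b0; rewrite lt_min a0.
    by move=> r [->|->]; generalize (norm1 2) (norm1 q) => a b; rewrite ge_min lexx ?orbT.
  exact (@decomposition_pos mu mu0 mule).
have K0 r : 0 <= 4 * c3 * norm1 r := mulr_ge0 (mulr_ge0 (ler0n R 4) (ltW c30)) (nn r).
have L0 r : r = 2 \/ r = q -> Lle O r (fun=> 0) 0.
  move=> rq; have [r1 r0] := expo rq; split => //.
  rewrite normr0 powR0 ?gt_eqF//; apply: le_trans (_ : (0 <= 0)%E) => //.
  by rewrite intr_cst// mul0e.
have Lt t : 0 < t -> forall i, Lle O 2 (phi i [::]) ((1 + V) * t).
  move=> t0 i; case: zero => z.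
    have := phi_Lle i e2 (isT : (size ([::] : seq 'I_2) <= 1)%N); rewrite z.
    exact: (LleW (ler0n R 2) (lexx 0) (mulr_ge0 (addr_ge0 ler01 V0) (ltW t0))).
  apply: (Lle_L2 mO V0 OV q2 t0).
  have := phi_Lle i eq (isT : (size ([::] : seq 'I_2) <= 1)%N); rewrite z.
  by have [q1 q0] := expo eq; exact: (LleW (ltW q0) (lexx 0) (ltW t0)).
exists (fun _ _ => 0), phi; split.
- by move=> i s x; rewrite addr0.
- move=> r rq; have [r1 r0] := expo rq; have [Lz nz] := Lle_inLq r0 (lexx 0) (L0 r rq).
  split; last by move=> s _; apply: le_trans nz _; exact: K0.
  split; first by move=> s _; exact: Lz.
  exists (fun _ _ => 0); split; first by move=> _; exact: Cc_inf0.
  move=> s _; apply: (@Lqnorm_cvg0 R O r _ 0 r0) => // n; rewrite mul0r.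
  by apply: eq_Lle (L0 r rq) => x; rewrite iter_partial0 subrr.
- move=> r i rq; have [r1 r0] := expo rq; split; first by case: rq => ->; [exact: phi2|exact: phiq].
  move=> s s1; have [_ H] := Lle_inLq r0 (norm1_ge0 r) (phi_Lle i rq s1).
  apply: le_trans H _; exact: ler_peMl (nn r) K1.
move=> i; have [H1 H2] : inLinf O (phi i [::]) /\ Linfnorm O (phi i [::]) <= 0.
  apply: (Linfnorm_le mO (phi_Lle i e2 (isT : (size ([::] : seq 'I_2) <= 1)%N)).1 (lexx 0)) => t t0.
  have V1 : 0 < 1 + V by rewrite ltr_pwDl.
  exists (fun=> 0); split; first by move=> x _; rewrite normr0.
  have := LleN (Lt _ (divr_gt0 t0 V1) i); rewrite mulrC mulfVK ?gt_eqF//.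
  by apply: eq_Lle => x; rewrite sub0r.
by split => //; apply: le_trans H2 (mulr_ge0 (mulr_ge0 (ler0n R 2) (ltW c30)) (nn 2)).
Qed.

End Decomposition.

(** * The domain: constants collected over components and derivatives *)

Theorem theorem2p5 (R : realType) (q : R) (O : set (R * R)) :
  2 < q -> open O -> simply_connected O -> bounded_set O -> lipschitz_boundary O ->
  exists C : R, 0 < C /\
  forall phi1 phi2 : seq 'I_2 -> R * R -> R,
    inW0 1 2 O phi1 -> inW0 1 q O phi1 ->
    inW0 1 2 O phi2 -> inW0 1 q O phi2 ->
    exists h g1 g2 : seq 'I_2 -> R * R -> R,
      (* h in H^2_0 cap W^{2,q}_0 *)
      (inW0 2 2 O h /\ inW0 2 q O h) /\
      (* g in L^oo cap H^1_0 cap W^{1,q}_0 (componentwise) *)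
      (inLinf O (g1 [::]) /\ inLinf O (g2 [::]) /\
       inW0 1 2 O g1 /\ inW0 1 q O g1 /\ inW0 1 2 O g2 /\ inW0 1 q O g2) /\
      (* (1) phi = g + grad h  a.e. in O *)
      {ae @leb2 R, forall x, O x ->
         phi1 [::] x = g1 [::] x + h [:: ord0] x /\
         phi2 [::] x = g2 [::] x + h [:: ord_max] x} /\
      (* (2) *)
      Linfnorm O (g1 [::]) + Linfnorm O (g2 [::])
        + (W0norm 1 2 O g1 + W0norm 1 2 O g2) + W0norm 2 2 O h
        <= C * (W0norm 1 2 O phi1 + W0norm 1 2 O phi2) /\
      (* (3) *)
      (W0norm 1 q O g1 + W0norm 1 q O g2) + W0norm 2 q O h
        <= C * (W0norm 1 q O phi1 + W0norm 1 q O phi2).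
Proof.
move=> q2 oO _ bO lO; have [M [M0 OM]] := bounded_box bO.
have mO := open_measurable2 oO.
have OV : (leb2 O <= ((M - - M) * (M - - M))%:E)%E.
  rewrite -leb2_rect; [|lra|lra].
  apply: (le_measure (@leb2 R)); rewrite ?inE//.
    by apply: measurableX; exact: measurable_itv.
  move=> x /OM[]; rewrite !ltr_norml => /andP[a1 a2] /andP[b1 b2].
  by split; rewrite /= in_itv/= ltW.
have V0 : 0 <= (M - - M) * (M - - M) by exact: sqr_ge0.
have [C [C0 HC]] := smooth_potential q2 oO bO lO.
pose c : R := C * (64 * 20 + 1); pose K := 4 * (1 + 4 * c).
have c0 : 0 < c by rewrite mulr_gt0// addr_gt0// mulr_gt0.
have K0 : 0 <= K := mulr_ge0 (ler0n R 4) (addr_ge0 ler01 (mulr_ge0 (ler0n R 4) (ltW c0))).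
pose S k : R := (size (multi k))%:R.
have SK : 0 <= 2 * S 1%N * K + S 2 * (4 * c).
  apply: addr_ge0; first exact: mulr_ge0 (mulr_ge0 (ler0n R 2) (ler0n R _)) K0.
  exact: mulr_ge0 (ler0n R _) (mulr_ge0 (ler0n R 4) (ltW c0)).
(* [4 c] pays for the two sup norms, at [2 c] each; [S k] counts the derivatives entering a norm of
   order [k], for two components of [g] and one function [h]. *)
exists (4 * c + (2 * S 1%N * K + S 2 * (4 * c))); split.
  by rewrite ltr_pwDl// mulr_gt0.
move=> phi1 phi2 p12 p1q p22 p2q; pose phi (i : 'I_2) := if val i == 0%N then phi1 else phi2.
have phi_2 i : inW0 1 2 O (phi i) by rewrite /phi; case: ifP.
have phi_q i : inW0 1 q O (phi i) by rewrite /phi; case: ifP.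
have [h [g [dec hW gW gL]]] := decomposition mO V0 OV C0 q2 HC phi_2 phi_q.
have e2 : (2 : R) = 2 \/ 2 = q by left.
have eq : q = 2 \/ q = q by right.
have hN r : r = 2 \/ r = q -> W0norm 2 r O h <= S 2 * (4 * c * norm1 O phi r).
  by move=> rq; apply: le_sum_seq => s; rewrite mem_multi => /((hW r rq).2 s).
have gN r i : r = 2 \/ r = q -> W0norm 1 r O (g i) <= S 1%N * (K * norm1 O phi r).
  by move=> rq; apply: le_sum_seq => s; rewrite mem_multi => /((gW r i rq).2 s).
have n0 r : 0 <= norm1 O phi r := norm1_ge0 O phi r.
have nE r : W0norm 1 r O phi1 + W0norm 1 r O phi2 = norm1 O phi r.
  exact (esym (sum_I2 (fun i => W0norm 1 r O (phi i)))).
have key D X r : X <= D * norm1 O phi r -> X <= D * (W0norm 1 r O phi1 + W0norm 1 r O phi2).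
  by move=> XD; rewrite nE.
exists h, (g ord0), (g ord_max); split; first by split; [exact: (hW 2 e2).1|exact: (hW q eq).1].
split.
  exact (conj (gL ord0).1 (conj (gL ord_max).1 (conj (gW 2 ord0 e2).1 (conj (gW q ord0 eq).1
    (conj (gW 2 ord_max e2).1 (gW q ord_max eq).1))))).
split; first by apply: aeW => x _; split; [exact: (dec ord0 [::] x)|exact: (dec ord_max [::] x)].
split.
  apply: key; apply: (le_trans (lerD (lerD (lerD (gL ord0).2 (gL ord_max).2) (lerD (gN 2 ord0 e2) (gN 2 ord_max e2))) (hN 2 e2))).
  move: (norm1 O phi 2) => n; rewrite le_eqVlt; apply/orP; left; apply/eqP; rewrite -/c; ring.
apply: key; apply: (le_trans (lerD (lerD (gN q ord0 eq) (gN q ord_max eq)) (hN q eq))).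
move: (norm1 O phi q) (n0 q) => n nn.
have -> : S 1%N * (K * n) + S 1%N * (K * n) + S 2 * (4 * c * n) = (2 * S 1%N * K + S 2 * (4 * c)) * n by ring.
by apply: ler_wpM2r => //; rewrite lerDr mulr_ge0// ltW.
Qed.
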